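(* Let $f\in C[0,T]$ with $f\not\equiv0$ on $[0,T]$. If a solution $\{u,h\}$ of Inverse Problem 2 exists in the class $C^{\alpha,2}_{t,x}(\overline{\Omega}_T)\times C(\overline{\Omega})$, then it is unique. That is, for given $\varphi,\psi,\omega$, there is at most one pair $\{u,h\}\in C^{\alpha,2}_{t,x}(\overline{\Omega}_T)\times C(\overline{\Omega})$ satisfying $$\partial_t^{\alpha}u-Lu=f(t)h(x),\quad (t,x)\in\Omega_T,$$ $$u(0,x)=\varphi(x),\quad u_t(0,x)=\psi(x),\quad x\in\overline{\Omega},$$ $$u(t,x)=0,\quad (t,x)\in[0,T]\times\partial\Omega,$$ $$\int_0^T f(t)u_t(t,x)\,dt=\omega(x),\quad x\in\overline{\Omega}.$$
   Context: Let $\alpha\in(1,2)$, $T>0$, $N\ge1$, and let $\Omega\subset\mathbb{R}^N$ be a bounded domain with smooth boundary $\partial\Omega$. Put $\Omega_T=(0,T]\times\Omega$ and $\overline{\Omega}_T=[0,T]\times\overline{\Omega}$. The operator $L$ acts in $x$ by $Lu=\operatorname{div}[\mathbf{A}(x)\nabla u]-c(x)u$, where $\mathbf{A}(x)=(a_{ij}(x))_{i,j=1,\dots,N}$ is a symmetric real matrix with $\sum_{i,j=1}^N a_{ij}(x)\xi_i\xi_j\ge\delta\sum_{i=1}^N\xi_i^2$ for all $x\in\Omega$, $\xi\in\mathbb{R}^N$, with a constant $\delta>0$, and $c(x)\ge0$. The first derivatives of the $a_{ij}$ and the function $c$ are Hölder continuous in $\Omega$. The Caputo derivative in $t$ of order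 $\alpha\in(1,2)$ is $\partial_t^{\alpha}u(t,x)=I_{0+}^{2-\alpha}u_{tt}(t,x)=\frac{1}{\Gamma(2-\alpha)}\int_0^t\frac{u_{\tau\tau}(\tau,x)}{(t-\tau)^{\alpha-1}}\,d\tau$. Function classes: $C^{1,0}_{t,x}(\overline{\Omega}_T)=\{u\in C(\overline{\Omega}_T): u_t\in C(\overline{\Omega}_T)\}$; $C^{\alpha,2}_{t,x}(\overline{\Omega}_T)=\{u\in C^{1,0}_{t,x}(\overline{\Omega}_T): \partial_t^{\alpha}u,\ u_{xx}\in C(\overline{\Omega}_T)\}$, where $u_{xx}$ stands for the second-order spatial derivatives of $u$. Inverse Problem 2 is the problem of finding the pair $\{u,h\}$ from the four displayed relations, given $L,\varphi,\psi,\alpha,f,\omega$. *)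

(* Defs.v *)
(* R^N is 'rV[R]_N, whose norm is the sup norm (equivalent to the Euclidean
   one). *)
From HB Require Import structures.
From mathcomp Require Import all_boot all_order all_algebra.
From mathcomp Require Import all_classical all_reals all_analysis.

Set Implicit Arguments.
Unset Strict Implicit.
Unset Printing Implicit Defensive.

Import Order.TTheory GRing.Theory Num.Theory numFieldNormedType.Exports.

Local Open Scope classical_set_scope.
Local Open Scope ring_scope.

Definition Gamma (R : realType) (z : R) : R :=
  \int[lebesgue_measure]_(s in `]0, +oo[) (s `^ (z - 1) * expR (- s)).

(* The derivative of g at t along points of I only: one-sided at an endpoint
   of an interval. The value is meaningful under derivable_in. *)
Definition derivable_in (R : realType) (I : set R) (g : R -> R) (t : R) : Prop :=
  cvg ((fun s => (g s - g t) / (s - t)) @ within I (t^')).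

Definition derive_in (R : realType) (I : set R) (g : R -> R) (t : R) : R :=
  lim ((fun s => (g s - g t) / (s - t)) @ within I (t^')).

(* A finite family of non-overlapping intervals is listed from left to right. *)
Definition absolutely_continuous (R : realType) (a b : R) (g : R -> R) : Prop :=
  forall e : R, 0 < e -> exists2 d : R, 0 < d &
  forall s : seq (R * R),
    all (fun p => [&& a <= p.1, p.1 <= p.2 & p.2 <= b]) s ->
    pairwise (fun p q => p.2 <= q.1) s ->
    \sum_(p <- s) (p.2 - p.1) < d ->
    \sum_(p <- s) `|g p.2 - g p.1| < e.

(* g, known on D, belongs to C(E) after extension by continuity. *)
Definition extends_continuously (T : topologicalType) (R : realType)
    (D E : set T) (g : T -> R) : Prop :=
  exists2 G : T -> R, {within E, continuous G} & (forall z, D z -> G z = g z).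

Section Space.
Context {R : realType} {N : nat}.
Implicit Types (Omega U : set 'rV[R]_N) (g : 'rV[R]_N -> R).

Definition partial (i : 'I_N) g : 'rV[R]_N -> R :=
  fun x => 'D_(delta_mx ord0 i) g x.

Definition partially_derivable (i : 'I_N) g (x : 'rV[R]_N) : Prop :=
  derivable g x (delta_mx ord0 i).

Definition iter_partial (s : seq 'I_N) g : 'rV[R]_N -> R := foldr partial g s.

(* C^oo on an open set. *)
Definition smooth_on U g : Prop :=
  forall (s : seq 'I_N) (x : 'rV[R]_N), U x ->
    {for x, continuous (iter_partial s g)} /\
    forall i, partially_derivable i (iter_partial s g) x.

Definition bounded_domain Omega : Prop :=
  [/\ open Omega, connected Omega, Omega !=set0 & bounded_set Omega].

(* For an open set this is the topological boundary. *)
Definition bd Omega : set 'rV[R]_N := closure Omega `\` Omega.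

(* C^oo boundary: near each of its points Omega is the side rho < 0 of a
   hypersurface given by a smooth function with nonvanishing gradient. *)
Definition smooth_boundary Omega : Prop :=
  forall p, bd Omega p -> exists U (rho : 'rV[R]_N -> R),
    [/\ open U, U p, smooth_on U rho,
        exists i, partial i rho p != 0 &
        forall x, U x -> (Omega x <-> rho x < 0)].

Definition hoelder_on Omega g : Prop :=
  exists gamma K : R, [/\ 0 < gamma, gamma <= 1 &
    forall x y, Omega x -> Omega y -> `|g x - g y| <= K * `|x - y| `^ gamma].

(* div (A grad v) - c v *)
Definition Lop (A : 'rV[R]_N -> 'M[R]_N) (c v : 'rV[R]_N -> R) : 'rV[R]_N -> R :=
  fun x => \sum_i partial i (fun y => \sum_j A y i j * partial j v y) x
           - c x * v x.

Record elliptic_coefficients Omega (delta : R)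
    (A : 'rV[R]_N -> 'M[R]_N) (c : 'rV[R]_N -> R) : Prop := {
  coef_sym : forall x, Omega x -> forall i j, A x i j = A x j i ;
  coef_elliptic : forall x, Omega x -> forall xi : 'I_N -> R,
    \sum_i \sum_j A x i j * xi i * xi j >= delta * \sum_i xi i ^+ 2 ;
  coef_derivable : forall i j k x, Omega x ->
    partially_derivable k (fun y => A y i j) x ;
  coef_hoelder : forall i j k, hoelder_on Omega (partial k (fun y => A y i j)) ;
  pot_ge0 : forall x, Omega x -> 0 <= c x ;
  pot_hoelder : hoelder_on Omega c }.

End Space.

Section SpaceTime.
Context {R : realType} {N : nat}.
Implicit Types (T alpha : R) (Omega : set 'rV[R]_N) (u : R -> 'rV[R]_N -> R).

Definition closed_cyl T Omega : set (R * 'rV[R]_N) :=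
  `[0, T]%classic `*` closure Omega.

Definition dt T u (t : R) (x : 'rV[R]_N) : R := derive_in `[0, T] (u ^~ x) t.

(* Only used at interior times 0 < t < T. *)
Definition dtt T u (t : R) (x : 'rV[R]_N) : R := derive1 (dt T u ^~ x) t.

Definition caputo_integrand alpha T u (t : R) (x : 'rV[R]_N) (tau : R) : R :=
  dtt T u tau x / (t - tau) `^ (alpha - 1).

Definition caputo alpha T u (t : R) (x : 'rV[R]_N) : R :=
  (Gamma (2 - alpha))^-1 *
  \int[lebesgue_measure]_(tau in `]0, t[) caputo_integrand alpha T u t x tau.

Record C_1_0 T Omega u : Prop := {
  C10_cont : {within closed_cyl T Omega, continuous (fun z => u z.1 z.2)} ;
  C10_dt : forall t x, closed_cyl T Omega (t, x) ->
    derivable_in `[0, T] (u ^~ x) t ;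
  C10_dt_cont :
    {within closed_cyl T Omega, continuous (fun z => dt T u z.1 z.2)} }.

(* The Caputo derivative is formed for every 0 < t <= T. That it exists means:
   u_t is absolutely continuous in time (so that u_tt exists almost everywhere
   and integrates back to u_t; this is automatic when u_tt exists at every
   interior time and is Lebesgue integrable, while almost-everywhere existence
   alone would admit Cantor-type functions u_t) and the singular integral
   converges absolutely.
   At t = 0 the integral is empty although its limit as t -> 0+ need not
   vanish, and the spatial derivatives are formed in the open set Omega only;
   membership in C of the closed cylinder is therefore understood after
   extension by continuity. *)
Record C_alpha_2 alpha T Omega u : Prop := {
  Ca2_C10 : C_1_0 T Omega u ;
  Ca2_ac : forall x, closure Omega x ->
    absolutely_continuous 0 T (dt T u ^~ x) ;
  Ca2_integrable : forall t x, 0 < t <= T -> closure Omega x ->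
    lebesgue_measure.-integrable `]0, t[
      (EFin \o caputo_integrand alpha T u t x) ;
  Ca2_caputo :
    extends_continuously (`]0, T]%classic `*` closure Omega)
      (closed_cyl T Omega) (fun z => caputo alpha T u z.1 z.2) ;
  Ca2_dx : forall i t x, 0 <= t <= T -> Omega x ->
    partially_derivable i (u t) x ;
  Ca2_dxx : forall i j t x, 0 <= t <= T -> Omega x ->
    partially_derivable i (partial j (u t)) x ;
  Ca2_dxx_cont : forall i j,
    extends_continuously (`[0, T]%classic `*` Omega)
      (closed_cyl T Omega) (fun z => partial i (partial j (u z.1)) z.2) }.

Record solves_inverse_problem2 alpha T Omega
    (A : 'rV[R]_N -> 'M[R]_N) (c : 'rV[R]_N -> R) (f : R -> R)
    (phi psi omega : 'rV[R]_N -> R) u (h : 'rV[R]_N -> R) : Prop := {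
  ip_u : C_alpha_2 alpha T Omega u ;
  ip_h : {within closure Omega, continuous h} ;
  ip_eq : forall t x, 0 < t <= T -> Omega x ->
    caputo alpha T u t x - Lop A c (u t) x = f t * h x ;
  ip_phi : forall x, closure Omega x -> u 0 x = phi x ;
  ip_psi : forall x, closure Omega x -> dt T u 0 x = psi x ;
  ip_bd : forall t x, 0 <= t <= T -> bd Omega x -> u t x = 0 ;
  ip_omega : forall x, closure Omega x ->
    \int[lebesgue_measure]_(t in `[0, T]) (f t * dt T u t x) = omega x }.

End SpaceTime.

(* Main.v *)
Require Import Defs.
From HB Require Import structures.
From mathcomp Require Import all_boot all_order all_algebra.
From mathcomp Require Import all_classical all_reals all_analysis.
From mathcomp Require Import measurable_realfun ring lra.

Set Implicit Arguments.
Unset Strict Implicit.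
Unset Printing Implicit Defensive.

Import Order.TTheory GRing.Theory Num.Theory numFieldNormedType.Exports.

Local Open Scope classical_set_scope.
Local Open Scope ring_scope.

(** Let u and h be the differences of the two solutions and w = u_t. Then
    w = 0 at t = 0, the time integral of f w vanishes at every point, and
    L u = D u - f h where D is the Caputo derivative of order alpha. The proof
    multiplies this equation by w and evaluates the result in two ways.

    In time, at a fixed point x: the term f h w integrates to 0, and D u is up
    to a positive factor the integral of w_t against the kernel
    (t - tau)^-(alpha - 1). This kernel is positive and decreasing, and so the
    integral of (L u) w over time is at least a positive multiple of the
    integral of w^2 ([velocity_energy], from [energy_le]).

    In space: the operator L is symmetric and nonpositive, and the integral of
    (L u) u_t over Omega and [0, T] is half the increment of the energy
    (L u, u) from t = 0, where u vanishes, to t = T. It is therefore at most 0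
    ([work_mean], from [energy_telescope]). The two bounds force w = 0, then
    u = 0, and finally f h = 0, whence h = 0 as f does not vanish identically.

    Three points need care. First, space integrals: the functions at hand are
    bounded on Omega, and all that the argument uses is a positive linear
    functional that annihilates the partial derivatives of compactly supported
    functions and is positive on functions bounded below on a ball. The limit
    of averages over finer and finer grids along an ultrafilter has these
    properties ([mean_div], [mean_gt0]): on a periodic grid the difference
    quotients sum to zero.

    Second, Green identities: solutions are regular inside Omega only, while
    they are continuous up to the boundary and vanish there. Hence a cutoff
    function of u^2 + v^2 has compact support in Omega. Testing the equations
    with it first bounds the Dirichlet energy independently of the cutoff; the
    error terms are then differences of a bounded monotone sequence, and they
    tend to 0 ([Lflux_sym], [Lflux_neg]).

    Third, time regularity: u_t is absolutely continuous, and u_tt is only its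
    almost everywhere derivative. The fundamental theorem of calculus in this
    generality ([ac_ftc]) comes from the total variation, which splits the
    function into monotone ones, and the Radon-Nikodym density of their
    Stieltjes measures. Moreover u_t need not have spatial derivatives, so the
    time integral of (L u) u_t is replaced by the sums of
    L u(t_(k+1)) (u(t_(k+1)) - u(t_k)), which involve only functions in the
    domain of L and whose mean has a sign exactly as in the backward Euler
    scheme. *)

(** * Derivatives and uniform continuity *)

(** Restriction to a line turns a directional derivative into an ordinary one,
    which brings the mean value theorem to bear on functions of several
    variables. *)
Lemma is_derive_line (R : realType) (V : normedModType R) (f : V -> R)
    (v y : V) (t l : R) :
  is_derive (t *: v + y) v f l -> is_derive t 1 (fun h : R => f (h *: v + y)) l.
Proof.
move=> [df fl].
have E : (fun h : R => h^-1 *: ((f \o shift (t *: v + y)) (h *: v) - f (t *: v + y)))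
  = (fun h : R => h^-1 *: (((fun h : R => f (h *: v + y)) \o shift t) (h *: (1:R))
      - f (t *: v + y))).
  apply/funext => h /=; congr (_ *: (f _ - _)).
  by rewrite scalerDl addrA /GRing.scale /= mulr1.
apply: DeriveDef; first by rewrite /derivable -E.
by rewrite -fl /derive E.
Qed.

Lemma is_derive_comp_real (R : realType) (V : normedModType R) (f : V -> R)
    (g : R -> R) (v x : V) (l m : R) :
  is_derive x v f l -> is_derive (f x) 1 g m ->
  is_derive x v (fun y => g (f y)) (m * l).
Proof.
move=> df dg.
have df' : is_derive (0:R) 1 (fun h : R => f (h *: v + x)) l.
  by apply: is_derive_line; rewrite scale0r add0r.
have dg' : is_derive ((fun h : R => f (h *: v + x)) 0) 1 g m.
  by rewrite scale0r add0r.
have [d1 d2] : is_derive (0:R) 1 (g \o (fun h : R => f (h *: v + x))) (m * l).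
  have d1 : derivable (g \o (fun h : R => f (h *: v + x))) 0 1.
    apply/derivable1_diffP; apply: differentiable_comp; apply/derivable1_diffP.
      by case: df'.
    by case: dg'.
  apply: DeriveDef => //.
  rewrite -derive1E derive1_comp; [|by case: df'|by case: dg'].
  by rewrite !derive1E; case: df' => _ ->; case: dg' => _ ->.
apply: DeriveDef; first by apply/derivable1P; exact: d1.
rewrite -d2 /derive.
set F := (X in lim (X @ _) = _); set G := (X in _ = lim (X @ _)).
suff -> : F = G by [].
by apply/funext => h; rewrite /F /G /= addr0 scale0r add0r [_%:A]mulr1.
Qed.

Lemma ultra_fmap (T U : Type) (f : T -> U) (F : set_system T) :
  UltraFilter F -> UltraFilter (f @ F).
Proof.
move=> FU; split=> [|G GP FG]; first exact: fmap_proper_filter.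
rewrite eqEsubset; split => // A GA; rewrite /fmap/=.
have [//|FnA] := in_ultra_setVsetC (f @^-1` A) FU.
have /(filterI GA) : G (~` A) by exact: FG.
by rewrite setICr => /filter_not_empty.
Qed.

Lemma within_continuousP (R : realType) (V : pseudoMetricType R) (K : set V)
    (f : V -> R) : {within K, continuous f} <->
  forall x, K x -> forall e, 0 < e -> exists2 d, 0 < d &
    forall y, K y -> ball x d y -> `|f x - f y| < e.
Proof.
split=> [fK x Kx e e0|H].
  move/subspace_continuousP/(_ x Kx)/cvgrPdist_lt/(_ e e0) : fK.
  move=> /nbhs_ballP[d d0 Hd].
  by exists d => // y Ky xy; apply: Hd.
apply/subspace_continuousP => x Kx.
apply/cvgrPdist_lt => e /(H x Kx)[d d0 Hd].
by apply/nbhs_ballP; exists d => //= y xy Ky; apply: Hd.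
Qed.

Lemma compact_uniform_continuity (R : realType) (V : pseudoMetricType R)
    (K : set V) (f : V -> R) :
  compact K -> {within K, continuous f} ->
  forall e, 0 < e -> exists2 d, 0 < d &
    forall x y, K x -> K y -> ball x d y -> `|f x - f y| < e.
Proof.
move=> cK /within_continuousP fK e e0.
pose P (d : R) x := forall y, K y -> ball x d y -> `|f x - f y| < e.
have : \forall d \near (0:R)^'+, K `<=` P d.
  move/compact_near_coveringP/near_covering_withinP: cK; apply => x Kx.
  have [|r r0 Hr] := fK x Kx (e / 2); first by rewrite divr_gt0.
  exists (ball x (r / 2), [set d : R | 0 < d < r / 2]).
    split; first by apply: nbhsx_ballx; rewrite divr_gt0.
    have r20 : 0 < r / 2 by rewrite divr_gt0.
    near=> d; apply/andP; split; near: d; [exact: nbhs_right_gt|exact: nbhs_right_lt].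
  move=> [x' d] /= [xx' /andP[d0 dr]] Kx' y Ky x'y.
  rewrite (splitr e).
  have h1 : `|f x - f x'| < e / 2.
    by apply: Hr => //; apply: le_ball xx'; rewrite ler_pdivrMr// ler_pMr// ler1n.
  have h2 : `|f x - f y| < e / 2.
    apply: Hr => //; rewrite (splitr r); apply: ball_triangle xx' _.
    by apply: le_ball x'y; exact: ltW.
  rewrite (_ : f x' - f y = (f x - f y) - (f x - f x')); last by ring.
  by rewrite (le_lt_trans (ler_normB _ _))// ltrD.
move=> H.
have [d [d0 Kd]] : exists d, 0 < d /\ K `<=` P d.
  have := @nbhs_right_gt R 0; move=> H0.
  have [d [h1 h2]] := filter_ex (filterI H0 H).
  by exists d.
by exists d => // x y Kx; exact: Kd.
Unshelve. all: by end_near. Qed.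

Lemma rV_ballP (R : realType) N (x y : 'rV[R]_N) (d : R) : 0 < d ->
  ball x d y <-> forall i, `|x ord0 i - y ord0 i| < d.
Proof.
move=> d0; split=> [[_ h] i|h]; first exact: (h ord0 i).
by split=> // i j; rewrite (ord1 i); exact: h.
Qed.

(** * A finitely additive mean over Omega *)
Section mean.
Context {R : realType} {N : nat}.
Variables (Omega : set 'rV[R]_N) (M : R).
Hypothesis M0 : 0 < M.
Hypothesis OmegaM : forall x, Omega x -> forall i, - M < x ord0 i < M.

(** The right endpoint M is left out, so that the nodes form a cycle under the
    shift by one step. *)
Definition node m (j : 'I_m.+1) : R := - M + 2 * M / m.+1%:R * j%:R.

Definition grid m (k : {ffun 'I_N -> 'I_m.+1}) : 'rV[R]_N := \row_i node (k i).

Definition avg (f : 'rV[R]_N -> R) (m : nat) : R :=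
  ((m.+1 ^ N)%:R)^-1 * \sum_(k : {ffun 'I_N -> 'I_m.+1})
    (if `[< Omega (grid k) >] then f (grid k) else 0).

Definition bounded_in (f : 'rV[R]_N -> R) := exists B, forall x, Omega x -> `|f x| <= B.

(** Along an ultrafilter every bounded sequence converges, which makes the limit
    of the averages a total linear functional on bounded functions. *)
Definition ultra_oo : set_system nat :=
  projT1 (cid (ultraFilterLemma eventually_filter)).

Local Instance ultra_oo_ultra : UltraFilter ultra_oo.
Proof. by rewrite /ultra_oo; case: cid => ? []. Qed.

Lemma ultra_oo_ge : \oo `<=` ultra_oo.
Proof. by rewrite /ultra_oo; case: cid => ? []. Qed.

Definition mean (f : 'rV[R]_N -> R) : R := lim (avg f m @[m --> ultra_oo]).

Lemma avg_norm f B m : 0 <= B -> (forall x, Omega x -> `|f x| <= B) -> `|avg f m| <= B.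
Proof.
move=> B0 fB; rewrite /avg normrM ger0_norm ?invr_ge0 ?ler0n//.
rewrite ler_pdivrMl ?ltr0n ?expn_gt0//.
apply: (le_trans (ler_norm_sum _ _ _)).
apply: (@le_trans _ _ (\sum_(k : {ffun 'I_N -> 'I_m.+1}) B)).
  by apply: ler_sum => k _; case: asboolP => [/fB//|_]; rewrite normr0.
by rewrite sumr_const card_ffun !card_ord -[leLHS]mulr_natl.
Qed.

Lemma avg_cvg f : bounded_in f -> cvg (avg f m @[m --> ultra_oo]).
Proof.
move=> [B fB].
have [C fC C0] : exists2 C, (forall x, Omega x -> `|f x| <= C) & 0 <= C.
  exists (Num.max B 0); last by rewrite le_max lexx orbT.
  by move=> x /fB h; rewrite le_max h.
have := @segment_compact R (- C) C; rewrite compact_ultra => /(_ (avg f m @[m --> ultra_oo])).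
case; first exact: ultra_fmap.
  apply: ultra_oo_ge; exists 0%N => // m _ /=.
  by rewrite in_itv /= -ler_norml; exact: avg_norm.
by move=> l [_ /= h]; apply/cvg_ex; exists l.
Qed.

Lemma bounded_inD f g : bounded_in f -> bounded_in g -> bounded_in (fun x => f x + g x).
Proof.
move=> [B fB] [C gC]; exists (B + C) => x Ox.
by apply: (le_trans (ler_normD _ _)); rewrite lerD ?fB ?gC.
Qed.

Lemma bounded_inM f g : bounded_in f -> bounded_in g -> bounded_in (fun x => f x * g x).
Proof.
move=> [B fB] [C gC]; exists (B * C) => x Ox.
by rewrite normrM ler_pM ?fB ?gC.
Qed.

Lemma bounded_in_cst a : bounded_in (fun=> a).
Proof. by exists `|a|. Qed.

Lemma bounded_in_sum n (f : 'I_n -> 'rV[R]_N -> R) :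
  (forall i, bounded_in (f i)) -> bounded_in (fun x => \sum_i f i x).
Proof.
move=> fB; have /choice [B hB] : forall i, exists B, forall x, Omega x -> `|f i x| <= B.
  by move=> i; exact: fB.
exists (\sum_i B i) => x Ox; apply: (le_trans (ler_norm_sum _ _ _)).
by apply: ler_sum => i _; exact: hB.
Qed.

Lemma bounded_in_eq f g : (forall x, Omega x -> f x = g x) -> bounded_in f -> bounded_in g.
Proof. by move=> fg [B fB]; exists B => x Ox; rewrite -fg// fB. Qed.

Lemma mean_cvg f : bounded_in f -> avg f m @[m --> ultra_oo] --> mean f.
Proof. by move=> /avg_cvg. Qed.

Lemma eq_avg f g : (forall x, Omega x -> f x = g x) -> avg f = avg g.
Proof.
move=> fg; apply/funext => m; rewrite /avg; congr (_ * _).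
by apply: eq_bigr => k _; case: asboolP => // /fg.
Qed.

Lemma eq_mean f g : (forall x, Omega x -> f x = g x) -> mean f = mean g.
Proof. by move=> fg; rewrite /mean (eq_avg fg). Qed.

Lemma avgD f g m : avg (fun x => f x + g x) m = avg f m + avg g m.
Proof.
rewrite /avg -mulrDr -big_split/=; congr (_ * _); apply: eq_bigr => k _.
by case: asboolP => //; rewrite addr0.
Qed.

Lemma avgZ a f m : avg (fun x => a * f x) m = a * avg f m.
Proof.
rewrite /avg mulrCA; congr (_ * _); rewrite mulr_sumr; apply: eq_bigr => k _.
by case: asboolP => //; rewrite mulr0.
Qed.

Lemma meanD f g : bounded_in f -> bounded_in g ->
  mean (fun x => f x + g x) = mean f + mean g.
Proof.
move=> bf bg; apply/cvg_lim => //.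
rewrite (_ : avg _ = avg f \+ avg g); last by apply/funext => m; exact: avgD.
by apply: cvgD; exact: mean_cvg.
Qed.

Lemma meanZ a f : bounded_in f -> mean (fun x => a * f x) = a * mean f.
Proof.
move=> bf; apply/cvg_lim => //.
rewrite (_ : avg _ = (fun m => a * avg f m)); last by apply/funext => m; exact: avgZ.
by apply: cvgMr; exact: mean_cvg.
Qed.

Lemma mean0 : mean (fun=> 0) = 0.
Proof. by rewrite -[RHS](mul0r (mean (fun=> 0))) -meanZ ?mul0r//; exact: bounded_in_cst. Qed.

Lemma mean_sum n (f : 'I_n -> 'rV[R]_N -> R) : (forall i, bounded_in (f i)) ->
  mean (fun x => \sum_i f i x) = \sum_i mean (f i).
Proof.
elim: n f => [|n IH] f bf.
  by rewrite big_ord0 -[RHS]mean0; apply: eq_mean => x _; rewrite big_ord0.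
rewrite big_ord_recl -IH// -meanD//; last by apply: bounded_in_sum.
by apply: eq_mean => x _; rewrite big_ord_recl.
Qed.

Lemma le_avg f g m : (forall x, Omega x -> f x <= g x) -> avg f m <= avg g m.
Proof.
move=> fg; rewrite /avg ler_wpM2l ?invr_ge0 ?ler0n//.
by apply: ler_sum => k _; case: asboolP => // /fg.
Qed.

Lemma mean_ge f c : bounded_in f -> (\forall m \near \oo, c <= avg f m) -> c <= mean f.
Proof.
move=> bf /ultra_oo_ge H.
by apply: limr_ge => //; exact: avg_cvg.
Qed.

Lemma mean_le f c : bounded_in f -> (\forall m \near \oo, avg f m <= c) -> mean f <= c.
Proof.
move=> bf /ultra_oo_ge H.
by apply: limr_le => //; exact: avg_cvg.
Qed.

Lemma le_mean f g : bounded_in f -> bounded_in g ->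
  (forall x, Omega x -> f x <= g x) -> mean f <= mean g.
Proof.
move=> bf bg fg; rewrite -subr_ge0.
have bNf : bounded_in (fun x => (-1) * f x).
  by apply: bounded_inM => //; exact: bounded_in_cst.
rewrite (_ : mean g - mean f = mean (fun x => g x + (-1) * f x)); last first.
  by rewrite meanD// meanZ// mulN1r.
have bh := bounded_inD bg bNf.
apply: mean_ge => //; near=> m; rewrite avgD avgZ mulN1r subr_ge0; exact: le_avg.
Unshelve. all: by end_near. Qed.

Lemma mean_norm f B : 0 <= B -> (forall x, Omega x -> `|f x| <= B) -> `|mean f| <= B.
Proof.
move=> B0 fB; have bf : bounded_in f by exists B.
rewrite ler_norml; apply/andP; split.
  by apply: mean_ge => //; near=> m; have := avg_norm m B0 fB; rewrite ler_norml => /andP[].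
by apply: mean_le => //; near=> m; have := avg_norm m B0 fB; rewrite ler_norml => /andP[].
Unshelve. all: by end_near. Qed.

Lemma sum_grid_prod m (w : 'I_N -> 'I_m.+1 -> R) :
  \sum_(k : {ffun 'I_N -> 'I_m.+1}) \prod_i w i (k i) = \prod_i \sum_j w i j.
Proof. by rewrite bigA_distr_bigA. Qed.

Lemma node_ge m (j : 'I_m.+1) : - M <= node j < M.
Proof.
rewrite /node lerDl mulr_ge0 ?divr_ge0 ?mulr_ge0 ?(ltW M0)//=.
rewrite mulrAC -mulrA addrC -ltrBrDr opprK -mulr2n -[M *+ 2]mulr_natl.
rewrite gtr_pMr ?mulr_gt0// ltr_pdivrMr ?ltr0n// mul1r ltr_nat.
exact: ltn_ord.
Qed.

(** The proportion of nodes in an interval is bounded below by its length: the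
    map [psi] that clamps to the inner half of the interval increases by r in
    all along the nodes, by at most one step at a node of the interval and not
    at all at the others. *)
Lemma count_nodes m (y r : R) : 0 < r -> - M <= y - r / 2 -> y + r / 2 <= M ->
  2 * M / m.+1%:R <= r / 2 ->
  r / (2 * M) <= m.+1%:R^-1 * \sum_(j < m.+1) (`|node j - y| < r)%R%:R.
Proof.
move=> r0 yl yr hr; set h := 2 * M / m.+1%:R in hr.
have h0 : 0 < h by rewrite /h divr_gt0 ?mulr_gt0 ?ltr0n.
pose psi (t : R) := Num.min (Num.max t (y - r / 2)) (y + r / 2).
pose nd (j : nat) : R := - M + h * j%:R.
have step (j : nat) : psi (nd j.+1) - psi (nd j) <= h * (`|nd j - y| < r)%R%:R.
  have E : nd j.+1 = nd j + h by rewrite /nd -natr1; ring.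
  rewrite E; move: (nd j) => x {E}; rewrite ltr_norml.
  have [_|] := boolP ((- r < x - y) && _); rewrite ?mulr1 ?mulr0.
    rewrite lerBlDr /psi addr_minr addr_maxr [h + x]addrC le_min !ge_min.
    rewrite ge_max !le_max !lexx/= lerDr (ltW h0) orbT/=.
    by apply/orP; right; rewrite lerDr ltW.
  rewrite negb_and -!leNgt => /orP[] ?; rewrite subr_le0 le_eqVlt; apply/orP; left; apply/eqP.
    rewrite /psi (@max_r _ _ (x + h)) ?(@max_r _ _ x)//; lra.
  by rewrite /psi !min_r// le_max; apply/orP; left; lra.
have tele : \sum_(0 <= j < m.+1) (psi (nd j.+1) - psi (nd j)) = r.
  rewrite telescope_sumr// /nd mulr0 addr0 /h mulfVK ?pnatr_eq0//.
  have -> : - M + 2 * M = M by ring.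
  rewrite /psi (@min_r _ _ (Num.max M _)); last by rewrite le_max yr.
  rewrite (@max_r _ _ (- M))// min_l; lra.
rewrite ler_pdivrMr ?mulr_gt0// -{1}tele big_mkord mulrAC.
rewrite [X in _ <= X * _]mulrC -/h mulr_sumr; apply: ler_sum => j _; exact: step.
Qed.

(** A ball of the sup norm is a product of intervals, so the number of grid
    points in it is a product of the counts of [count_nodes]. *)
Lemma mean_gt0 f x0 r kappa : bounded_in f -> (forall x, Omega x -> 0 <= f x) ->
  0 < kappa -> 0 < r ->
  (forall x, ball x0 r x -> Omega x /\ kappa <= f x) -> 0 < mean f.
Proof.
move=> bf f0 k0 r0 fk.
have hs (s : R) i : `|s| < r -> - M < x0 ord0 i + s < M.
  move=> sr; have : Omega (\row_j (x0 ord0 j + s)).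
    apply: (proj1 (fk _ _)); apply/rV_ballP => // j; rewrite mxE.
    by rewrite opprD addNKr normrN.
  by move=> /OmegaM/(_ i); rewrite mxE.
have r2 : 0 < r / 2 by rewrite divr_gt0.
have r2r : r / 2 < r by lra.
have x0m i : - M <= x0 ord0 i - r / 2.
  by have := @hs (- (r / 2)) i; rewrite normrN gtr0_norm// => /(_ r2r)/andP[/ltW].
have x0p i : x0 ord0 i + r / 2 <= M.
  by have := @hs (r / 2) i; rewrite gtr0_norm// => /(_ r2r)/andP[_ /ltW].
apply: (@lt_le_trans _ _ (kappa * (r / (2 * M)) ^+ N)).
  by rewrite mulr_gt0// exprn_gt0// divr_gt0// mulr_gt0.
apply: mean_ge => //.
near=> m.
have hm : 2 * M / m.+1%:R <= r / 2.
  rewrite ler_pdivrMr ?ltr0n// -ler_pdivrMl//.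
  apply: (@le_trans _ _ m%:R); last by rewrite ler_nat.
  by near: m; exact: nbhs_infty_ger.
pose w i (j : 'I_m.+1) : R := (`|node j - x0 ord0 i| < r)%R%:R.
apply: (@le_trans _ _ (((m.+1 ^ N)%:R)^-1 * \sum_(k : {ffun 'I_N -> 'I_m.+1})
   kappa * \prod_i w i (k i))).
  rewrite -mulr_sumr mulrCA ler_pM2l// sum_grid_prod natrX -exprVn.
  have -> : (m.+1%:R^-1 : R) ^+ N = \prod_(i < N) m.+1%:R^-1.
    by rewrite prodr_const card_ord.
  have -> : (r / (2 * M)) ^+ N = \prod_(i < N) (r / (2 * M)).
    by rewrite prodr_const card_ord.
  rewrite -big_split/=; apply: ler_prod => i _.
  by rewrite divr_ge0 ?mulr_ge0 ?(ltW r0) ?(ltW M0)//= count_nodes.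
rewrite /avg ler_wpM2l ?invr_ge0 ?ler0n//; apply: ler_sum => k _.
have [/forallP H|] := boolP [forall i, `|node (k i) - x0 ord0 i| < r].
  have [Ok kf] : Omega (grid k) /\ kappa <= f (grid k).
    by apply: fk; apply/rV_ballP => // j; rewrite mxE distrC.
  rewrite asboolT// big1 ?mulr1// => i _; by rewrite /w H.
rewrite negb_forall => /existsP[i Hi].
rewrite (bigD1 i)//= {1}/w (negbTE Hi) mul0r mulr0.
by case: asboolP => // /f0.
Unshelve. all: by end_near. Qed.

End mean.

Lemma near_eq_continuous (R : realType) (V : topologicalType) (f g : V -> R) x :
  {near x, f =1 g} -> {for x, continuous f} -> {for x, continuous g}.
Proof.
move=> E h; rewrite /prop_for /continuous_at -(nbhs_singleton E).
by apply: cvg_trans h; apply: near_eq_cvg.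
Qed.

(** * The mean of a partial derivative *)
Section mean_div.
Context {R : realType} {N : nat}.
Variables (Omega : set 'rV[R]_N) (M : R).
Hypothesis M0 : 0 < M.
Hypothesis OmegaM : forall x, Omega x -> forall i, - M < x ord0 i < M.
Hypothesis oOmega : open Omega.

Lemma compact_box (B : R) :
  compact [set x : 'rV[R]_N | forall i, x ord0 i \in `[- B, B]].
Proof.
apply: (@rV_compact _ _ (fun=> `[(- B), B]%classic)) => _; exact: segment_compact.
Qed.

Definition shift_grid m (i : 'I_N) (k : {ffun 'I_N -> 'I_m.+1}) :
  {ffun 'I_N -> 'I_m.+1} := [ffun j => if j == i then ordS (k j) else k j].

Lemma shift_grid_inj m i : injective (@shift_grid m i).
Proof.
apply: (@can_inj _ _ _ (fun k : {ffun 'I_N -> 'I_m.+1} =>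
  [ffun j => if j == i then ord_pred (k j) else k j])) => k.
by apply/ffunP => j; rewrite !ffunE; case: eqP => // _; rewrite ordSK.
Qed.

(** At the last node of a row the cyclic shift returns to the coordinate - M
    while the translation leads to M. Both lie outside Omega, and there G
    vanishes. *)
Lemma grid_shift m i (k : {ffun 'I_N -> 'I_m.+1}) (K : set 'rV[R]_N) (G : 'rV[R]_N -> R) :
  K `<=` Omega -> (forall x, ~ K x -> G x = 0) ->
  G (grid M (shift_grid i k)) = G ((2 * M / m.+1%:R) *: delta_mx ord0 i + grid M k).
Proof.
move=> KO G0.
have [kl|kl] := eqVneq (k i : nat) m; last first.
  congr G; apply/rowP => j; rewrite !mxE ffunE eqxx/=.
  case: eqP => [->|]; last by rewrite mulr0 add0r.
  rewrite /node/= modn_small; last first.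
    by rewrite ltnS ltn_neqAle kl -ltnS ltn_ord.
  rewrite -natr1; ring.
rewrite [LHS]G0; last first.
  move=> /KO /OmegaM/(_ i); rewrite !mxE ffunE eqxx /node/= kl modnn mulr0 addr0.
  by rewrite ltxx.
rewrite [RHS]G0// => /KO /OmegaM/(_ i); rewrite !mxE.
rewrite !eqxx/= /node kl mulr1 => /andP[_].
suff -> : 2 * M / m.+1%:R + (- M + 2 * M / m.+1%:R * m%:R) = M by rewrite ltxx.
have -> : m.+1%:R = m%:R + 1 :> R by rewrite natr1.
have : (m%:R + 1 : R) != 0 by rewrite natr1 pnatr_eq0.
by move=> ?; field.
Qed.

(** Extension by zero turns a function on Omega with compact support into a
    continuous function on the whole space, to which uniform continuity on a
    box applies. *)
Definition zero_ext (K : set 'rV[R]_N) (d : 'rV[R]_N -> R) x := if `[< K x >] then d x else 0.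

Lemma zero_ext_near_in K d x : Omega x ->
  (forall x, Omega x -> ~ K x -> d x = 0) -> {near x, d =1 zero_ext K d}.
Proof.
move=> Ox d0; near=> y; rewrite /zero_ext; case: asboolP => // nK.
by apply: d0 => //; near: y; exact: open_nbhs_nbhs.
Unshelve. all: by end_near. Qed.

Lemma zero_ext_near_out K d x : compact K -> ~ K x -> {near x, cst 0 =1 zero_ext K d}.
Proof.
move=> cK Kx.
have oK : open (~` K).
  by rewrite openC; apply: compact_closed => //; exact: norm_hausdorff.
have nK : \forall y \near x, ~ K y by exact: open_nbhs_nbhs.
by near=> y; rewrite /zero_ext asboolF//; near: y.
Unshelve. all: by end_near. Qed.

Lemma zero_ext_continuous K d : compact K -> K `<=` Omega ->
  (forall x, Omega x -> {for x, continuous d}) ->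
  (forall x, Omega x -> ~ K x -> d x = 0) -> continuous (zero_ext K d).
Proof.
move=> cK KO cd d0 x.
have [Kx|Kx] := pselect (K x).
  by apply: near_eq_continuous (cd _ (KO _ Kx)); apply: zero_ext_near_in => //; exact: KO.
by apply: near_eq_continuous (zero_ext_near_out d cK Kx) _; exact: cst_continuous.
Qed.

Lemma continuous_supp_bounded K d : compact K -> K `<=` Omega ->
  (forall x, Omega x -> {for x, continuous d}) ->
  (forall x, Omega x -> ~ K x -> d x = 0) -> bounded_in Omega d.
Proof.
move=> cK KO cd d0.
have cz := zero_ext_continuous cK KO cd d0.
have [|B [_ HB]] := @compact_bounded _ _ (zero_ext K d @` K).
  by apply: continuous_compact => //; exact: continuous_subspaceT.
exists (`|B| + 1) => x Ox; have [Kx|Kx] := pselect (K x); last first.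
  by rewrite d0// normr0.
have -> : d x = zero_ext K d x by rewrite /zero_ext asboolT.
apply: (HB (`|B| + 1)); last by exists x.
by rewrite (le_lt_trans (ler_norm _))// ltrDl.
Qed.

(** The difference quotients of G at the grid step sum to zero over the grid,
    since the cyclic shift permutes it; by the mean value theorem and uniform
    continuity they are uniformly close to d. *)
Lemma mean_div i G d K : compact K -> K `<=` Omega ->
  (forall x, Omega x -> is_derive x (delta_mx ord0 i) G (d x)) ->
  (forall x, Omega x -> {for x, continuous d}) ->
  (forall x, Omega x -> ~ K x -> G x = 0) ->
  bounded_in Omega d /\ mean Omega M d = 0.
Proof.
move=> cK KO dG cd G0.
set e := delta_mx ord0 i : 'rV[R]_N.
have d0 x : Omega x -> ~ K x -> d x = 0.
  move=> Ox Kx; have [_ <-] := dG x Ox.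
  have E : \near x, (cst 0 : 'rV[R]_N -> R) x = G x.
    have : {near x, zero_ext K G =1 cst 0}.
      by have := zero_ext_near_out G cK Kx; apply: filterS => y /esym.
    have := zero_ext_near_in Ox G0; apply: filterS2 => y /= -> //.
  by rewrite -(near_eq_derive _ E) derive_cst.
have bd := continuous_supp_bounded cK KO cd d0; split => //.
have cz := zero_ext_continuous cK KO cd d0.
set g := zero_ext K G; set dz := zero_ext K d in cz.
have dg x : is_derive x e g (dz x).
  have [Kx|Kx] := pselect (K x).
    rewrite /dz/zero_ext asboolT//; apply: near_eq_is_derive (dG _ (KO _ Kx)).
    by apply: zero_ext_near_in => //; exact: KO.
  rewrite /dz/zero_ext asboolF//; apply: near_eq_is_derive (is_derive_cst 0 x e).
  exact: zero_ext_near_out.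
have gout x : ~ K x -> g x = 0 by move=> ?; rewrite /g/zero_ext asboolF.
apply/eqP; rewrite -normr_le0; apply/ler_addgt0Pr => eps eps0; rewrite add0r.
have [eta eta0 Heta] := compact_uniform_continuity (@compact_box (M + 1))
   (continuous_subspaceT cz) eps0.
suff H : \forall m \near \oo, `|avg Omega M d m| <= eps.
  rewrite ler_norml; apply/andP; split.
    by apply: mean_ge => //; move: H; apply: filterS => m; rewrite ler_norml => /andP[].
  by apply: mean_le => //; move: H; apply: filterS => m; rewrite ler_norml => /andP[].
near=> m.
set h := 2 * M / m.+1%:R.
have h0 : 0 < h by rewrite /h divr_gt0 ?mulr_gt0 ?ltr0n.
have hsmall (r : R) : 0 < r -> 2 * M * r^-1 <= m%:R -> h <= r.
  move=> r0 hr; rewrite ler_pdivrMr ?ltr0n// -ler_pdivrMl// mulrC (le_trans hr)//.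
  by rewrite ler_nat.
have he : h <= eta / 2.
  by apply: hsmall; [rewrite divr_gt0|near: m; exact: nbhs_infty_ger].
have h1 : h <= 1 by apply: hsmall => //; near: m; exact: nbhs_infty_ger.
(* the difference quotient at one grid step, which sums to 0 over the grid *)
pose q x := h^-1 * (g (h *: e + x) - g x).
have sq : \sum_(k : {ffun 'I_N -> 'I_m.+1}) q (grid M k) = 0.
  rewrite -mulr_sumr sumrB.
  have -> : \sum_(k : {ffun 'I_N -> 'I_m.+1}) g (h *: e + grid M k) =
            \sum_(k : {ffun 'I_N -> 'I_m.+1}) g (grid M k).
    rewrite [RHS](reindex_inj (@shift_grid_inj m i)) /=.
    by apply: eq_bigr => k _; rewrite (grid_shift i k KO gout).
  by rewrite subrr mulr0.
have dq k : `|dz (@grid R N M m k) - q (grid M k)| <= eps.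
  set x := grid M k.
  have [|c] := @MVT R (fun s => g (s *: e + x)) (fun s => dz (s *: e + x)) 0 h h0
     (fun s _ => is_derive_line (dg (s *: e + x))).
    apply: derivable_within_continuous => s _.
    by have [] := is_derive_line (dg (s *: e + x)).
  rewrite in_itv/= => /andP[c0 ch].
  rewrite scale0r add0r subr0 => E.
  rewrite /q E mulrC mulfK ?gt_eqF//.
  have inbox t : 0 <= t <= 1 -> forall j, (t *: e + x) ord0 j \in `[- (M + 1), M + 1].
    move=> /andP[t0 t1] j; rewrite !mxE in_itv/=.
    have := node_ge M0 (k j); set nn := node _ _ => /andP[n1 n2].
    by case: (j == i); rewrite ?mulr1 ?mulr0; apply/andP; split; lra.
  apply/ltW; apply: Heta.
  - by rewrite -[x]add0r -(scale0r e); apply: inbox; rewrite lexx ler01.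
  - by apply: inbox; rewrite (ltW c0) (le_trans (ltW ch)).
  - apply/rV_ballP => // j; rewrite !mxE.
    set xx := node _ _; rewrite opprD addrCA subrr addr0 normrN normrM (gtr0_norm c0).
    have : `|(((ord0 : 'I_1) == ord0) && (j == i))%:R : R| <= 1.
      by case: (_ && _); rewrite ?normr1 ?normr0.
    move=> hb; apply: (@le_lt_trans _ _ (c * 1)); first by rewrite ler_wpM2l// ltW.
    by rewrite mulr1 (lt_le_trans ch)// (le_trans he)// ler_pdivrMr// ler_pMr// ler1n.
rewrite /avg.
have -> : \sum_(k : {ffun 'I_N -> 'I_m.+1})
   (if `[< Omega (grid M k) >] then d (grid M k) else 0) =
   \sum_(k : {ffun 'I_N -> 'I_m.+1}) (dz (grid M k) - q (grid M k)).
  rewrite sumrB sq subr0; apply: eq_bigr => k _; rewrite /dz /zero_ext.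
  case: asboolP => Ok; case: asboolP => Kk //; last by case: Ok; exact: KO.
  exact: d0.
rewrite normrM ger0_norm ?invr_ge0 ?ler0n//.
rewrite ler_pdivrMl ?ltr0n ?expn_gt0//.
apply: (le_trans (ler_norm_sum _ _ _)).
apply: (@le_trans _ _ (\sum_(k : {ffun 'I_N -> 'I_m.+1}) eps)); first exact: ler_sum.
by rewrite sumr_const card_ffun !card_ord -[leLHS]mulr_natl.
Unshelve. all: by end_near. Qed.

End mean_div.

Lemma is_derive_congr (R : realType) (V : normedModType R) (f g : V -> R) x v df dg :
  is_derive x v f df -> f =1 g -> df = dg -> is_derive x v g dg.
Proof. by move=> fd /funext <- <-. Qed.

(** * Cutoff functions *)
Section smoothstep.
Context {R : realType}.
Implicit Types y s e : R.

Definition pos_part y : R := Num.max y 0.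
Definition pos_sq y : R := pos_part y ^+ 2.

(** The error of the linear approximation is at most h^2, whatever the signs of
    y and y + h. *)
Lemma pos_sq_derive y : is_derive y 1 pos_sq (2 * pos_part y).
Proof.
have H : h^-1 *: ((pos_sq \o shift y) (h *: (1:R)) - pos_sq y) @[h --> (0:R)^'] -->
  2 * pos_part y.
  apply/cvgrPdist_le => e e0; near=> h.
  have h0 : h != 0 by near: h; exact: nbhs_dnbhs_neq.
  have he : `|h| <= e by near: h; apply: dnbhs0_le.
  apply: le_trans he; rewrite /= /GRing.scale/= mulr1.
  rewrite -(ler_pM2l (_ : 0 < `|h|)) ?normr_gt0// -normrM mulrBr mulVKf//.
  rewrite -normrM -expr2 (ger0_norm (sqr_ge0 h)).
  rewrite /pos_sq /pos_part ler_norml.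
  case: (ltP (h + y) 0) => ?; case: (ltP y 0) => ?; apply/andP; split; nra.
apply: DeriveDef; first by apply/cvg_ex; eexists; exact: H.
exact/cvg_lim.
Unshelve. all: by end_near. Qed.

Lemma pos_part_continuous : continuous (pos_part : R -> R).
Proof. by move=> y; apply: continuous_max; [exact: cvg_id|exact: cvg_cst]. Qed.

(** A spline with continuous derivative that goes from 0 on ]-oo, 1] to 1 on
    [2, +oo[. *)
Definition step y : R :=
  2 * pos_sq (y - 1) - 4 * pos_sq (y - 3 / 2) + 2 * pos_sq (y - 2).
Definition dstep y : R :=
  4 * pos_part (y - 1) - 8 * pos_part (y - 3 / 2) + 4 * pos_part (y - 2).

Lemma step_derive y : is_derive y 1 step (dstep y).
Proof.
have sh a : is_derive y 1 (fun y => pos_sq (y - a)) (2 * pos_part (y - a)).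
  have := @is_derive_comp_real R R (fun y => y - a) pos_sq 1 y 1 (2 * pos_part (y - a)).
  rewrite mulr1; apply; last exact: pos_sq_derive.
  rewrite -[X in is_derive _ _ _ X]subr0.
  exact: (@is_deriveB _ _ _ id (cst a)).
rewrite /step /dstep.
have := is_deriveD (is_deriveB (is_deriveZ 2 (sh 1)) (is_deriveZ 4 (sh (3/2)))) (is_deriveZ 2 (sh 2)).
move=> /is_derive_congr; apply => [t|]; first by [].
rewrite /GRing.scale/=; ring.
Qed.

Lemma dstep_continuous : continuous dstep.
Proof.
have sh (a b : R) : continuous (fun y => b * pos_part (y - a)).
  move=> y; apply: cvgM; first exact: cvg_cst.
  apply: (@continuous_comp _ _ _ (fun y => y - a) pos_part); last exact: pos_part_continuous.
  by apply: cvgB; [exact: cvg_id|exact: cvg_cst].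
by move=> y; apply: cvgD; [apply: cvgB|]; exact: sh.
Qed.

Ltac step_cases y := rewrite /step /dstep /pos_sq /pos_part;
  case: (ltP (y - 1) 0) => ?; case: (ltP (y - 3 / 2) 0) => ?; case: (ltP (y - 2) 0) => ?.

Lemma step0 y : y <= 1 -> step y = 0.
Proof. by move=> y1; rewrite /step /pos_sq /pos_part !max_r; lra. Qed.

Lemma step1 y : 2 <= y -> step y = 1.
Proof. by move=> y1; rewrite /step /pos_sq /pos_part !max_l; [field|lra..]. Qed.

Lemma step_itv y : 0 <= step y <= 1.
Proof. by apply/andP; split; step_cases y; nra. Qed.

Lemma dstep_ge0 y : 0 <= dstep y.
Proof. by step_cases y; lra. Qed.

(** The derivative lives on [1, 2], where the right-hand side is the constant 4.
    This controls the logarithmic derivative of a cutoff by a difference of two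
    cutoffs, at twice and at half the scale. *)
Lemma dstep_le y : 0 <= y -> y * dstep y <= 4 * (step (2 * y) - step (y / 2)).
Proof.
move=> y0; have [y1|y1] := ltP y 1.
  rewrite (@step0 (y / 2)); last lra.
  have -> : dstep y = 0 by rewrite /dstep /pos_part !max_r; lra.
  by have /andP[] := step_itv (2 * y); lra.
rewrite (@step1 (2 * y)); last lra.
have [y2|y2] := leP y 2.
  rewrite (@step0 (y / 2)); last lra.
  by step_cases y; nra.
have -> : dstep y = 0 by rewrite /dstep /pos_part !max_l; lra.
by have /andP[] := step_itv (y / 2); lra.
Qed.

Definition cutoff e s := step (s / e).
Definition dcutoff e s := dstep (s / e) / e.

Lemma cut_derive e s : is_derive s 1 (cutoff e) (dcutoff e s).
Proof.
apply: is_derive_comp_real; last exact: step_derive.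
have := is_deriveM (is_derive_id s 1) (is_derive_cst (e^-1) s 1).
move=> /is_derive_congr; apply => [t|]; first by [].
rewrite /GRing.scale/=; ring.
Qed.

Lemma dcut_continuous e : continuous (dcutoff e).
Proof.
move=> s; apply: cvgM; last exact: cvg_cst.
apply: (@continuous_comp _ _ _ (fun y => y / e) dstep); last exact: dstep_continuous.
by apply: cvgM; [exact: cvg_id|exact: cvg_cst].
Qed.

End smoothstep.

(** * Green identities *)
Section green.
Context {R : realType} {N : nat}.
Variables (Omega : set 'rV[R]_N) (M : R).
Hypothesis M0 : 0 < M.
Hypothesis OmegaM : forall x, Omega x -> forall i, - M < x ord0 i < M.
Hypothesis oOmega : open Omega.
Variables (A : 'rV[R]_N -> 'M[R]_N) (c : 'rV[R]_N -> R).
Hypothesis Asym : forall x, Omega x -> forall i j, A x i j = A x j i.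
Hypothesis Apos : forall x, Omega x -> forall xi : 'I_N -> R,
  0 <= \sum_i \sum_j A x i j * xi i * xi j.
Hypothesis c0 : forall x, Omega x -> 0 <= c x.

Notation e i := (delta_mx ord0 i : 'rV[R]_N).
Notation mean := (mean Omega M).
Notation bounded_in := (bounded_in Omega).
Implicit Types (u v w p : 'rV[R]_N -> R) (du dv dw dF : 'I_N -> 'rV[R]_N -> R).

Definition continuous_in (f : 'rV[R]_N -> R) := forall x, Omega x -> {for x, continuous f}.

Lemma continuous_inB f g : continuous_in f -> continuous_in g ->
  continuous_in (fun x => f x - g x).
Proof. by move=> cf cg x Ox; exact: cvgB (cf x Ox) (cg x Ox). Qed.

Lemma continuous_inD f g : continuous_in f -> continuous_in g ->
  continuous_in (fun x => f x + g x).
Proof. by move=> cf cg x Ox; exact: cvgD (cf x Ox) (cg x Ox). Qed.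

Lemma continuous_inM f g : continuous_in f -> continuous_in g ->
  continuous_in (fun x => f x * g x).
Proof. by move=> cf cg x Ox; exact: cvgM (cf x Ox) (cg x Ox). Qed.

Lemma continuous_in_cst (a : R) : continuous_in (fun=> a).
Proof. by move=> x _; exact: cst_continuous. Qed.

Lemma continuous_in_sum n (f : 'I_n -> 'rV[R]_N -> R) :
  (forall i, continuous_in (f i)) -> continuous_in (fun x => \sum_i f i x).
Proof.
elim: n f => [|n IH] f cf.
  rewrite (_ : (fun x => _) = fun=> 0); first exact: continuous_in_cst.
  by apply/funext => x; rewrite big_ord0.
rewrite (_ : (fun x => _) = fun x => f ord0 x + \sum_(i < n) f (lift ord0 i) x).
  by apply: continuous_inD => //; exact: IH.
by apply/funext => x; rewrite big_ord_recl.
Qed.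

Definition flux dw (i : 'I_N) : 'rV[R]_N -> R := fun x => \sum_j A x i j * dw j x.

Definition Lflux w dF : 'rV[R]_N -> R := fun x => \sum_i dF i x - c x * w x.

(** A function w that vanishes on the boundary, its gradient [dw], and the
    derivatives [dF] of the components of its flux, which add up to the
    divergence part of L w. Only w is continuous up to the boundary, and L w is
    bounded although its separate terms need not be. *)
Record admissible w dw dF : Prop := {
  adm_cont : {within closure Omega, continuous w} ;
  adm_bd : forall x, bd Omega x -> w x = 0 ;
  adm_dw : forall j x, Omega x -> is_derive x (e j) w (dw j x) ;
  adm_dwc : forall j, continuous_in (dw j) ;
  adm_dF : forall i x, Omega x -> is_derive x (e i) (flux dw i) (dF i x) ;
  adm_fluxc : forall i, continuous_in (flux dw i) ;
  adm_dFc : forall i, continuous_in (dF i) ;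
  adm_L : bounded_in (Lflux w dF) }.

Arguments adm_dwc {w dw dF}.
Arguments adm_fluxc {w dw dF}.
Arguments adm_dFc {w dw dF}.

Lemma admissibleB w1 dw1 dF1 w2 dw2 dF2 :
  admissible w1 dw1 dF1 -> admissible w2 dw2 dF2 ->
  admissible (fun x => w1 x - w2 x) (fun j x => dw1 j x - dw2 j x)
             (fun i x => dF1 i x - dF2 i x) /\
  (forall x, Lflux (fun x => w1 x - w2 x) (fun i x => dF1 i x - dF2 i x) x =
     Lflux w1 dF1 x - Lflux w2 dF2 x).
Proof.
move=> a1 a2.
have fB i x : flux (fun j x => dw1 j x - dw2 j x) i x = flux dw1 i x - flux dw2 i x.
  by rewrite /flux -sumrB; apply: eq_bigr => j _; rewrite mulrBr.
have LB x : Lflux (fun x => w1 x - w2 x) (fun i x => dF1 i x - dF2 i x) x =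
     Lflux w1 dF1 x - Lflux w2 dF2 x.
  by rewrite /Lflux sumrB; ring.
split => //; split.
- by move=> x; apply: cvgB; [exact: (adm_cont a1)|exact: (adm_cont a2)].
- by move=> x bx; rewrite (adm_bd a1)// (adm_bd a2)// subrr.
- by move=> j x Ox; exact: is_deriveB (adm_dw a1 j Ox) (adm_dw a2 j Ox).
- by move=> j; exact: continuous_inB (adm_dwc a1 j) (adm_dwc a2 j).
- move=> i x Ox; rewrite (_ : flux _ i = fun x => flux dw1 i x - flux dw2 i x); last first.
    by apply/funext => y; exact: fB.
  exact: is_deriveB (adm_dF a1 i Ox) (adm_dF a2 i Ox).
- move=> i; rewrite (_ : flux _ i = fun x => flux dw1 i x - flux dw2 i x); last first.
    by apply/funext => y; exact: fB.
  exact: continuous_inB (adm_fluxc a1 i) (adm_fluxc a2 i).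
- by move=> i /=; exact: continuous_inB (adm_dFc a1 i) (adm_dFc a2 i).
- apply: bounded_in_eq (bounded_inD (adm_L a1) (bounded_inM (bounded_in_cst Omega (-1)) (adm_L a2))).
  by move=> x _; rewrite LB mulN1r.
Qed.

Lemma admissible_continuous w dw dF : admissible w dw dF -> continuous_in w.
Proof.
move=> a x Ox; have := adm_cont a => /continuous_subspaceW.
move=> /(_ Omega (@subset_closure _ Omega)).
by rewrite continuous_open_subspace// => /(_ x); apply; rewrite inE.
Qed.

Lemma compact_closure : compact (closure Omega).
Proof.
apply: (subclosed_compact (@closed_closure _ _) (@compact_box _ _ M)).
rewrite closureE; apply: smallest_sub.
  by apply: compact_closed; [exact: norm_hausdorff|exact: compact_box].
by move=> x /OmegaM Ox i; rewrite in_itv/=; have /andP[/ltW-> /ltW->] := Ox i.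
Qed.

Lemma admissible_bounded w dw dF : admissible w dw dF -> bounded_in w.
Proof.
move=> a; have [|B [_ HB]] := @compact_bounded _ _ (w @` closure Omega).
  by apply: continuous_compact; [exact: adm_cont a|exact: compact_closure].
exists (`|B| + 1) => x Ox; apply: (HB (`|B| + 1)).
  by rewrite (le_lt_trans (ler_norm _))// ltrDl.
by exists x => //; exact: subset_closure.
Qed.

(** The cutoffs below vanish off sets of this form. *)
Lemma superlevel_compact (s : 'rV[R]_N -> R) (r : R) :
  {within closure Omega, continuous s} ->
  compact [set x | closure Omega x /\ r <= s x].
Proof.
move=> /within_continuousP cs.
apply: subclosed_compact compact_closure _; last by move=> x [].
move=> x clx; have Ox : closure Omega x.
  by apply: (@closed_closure _ Omega); apply: closureS clx => y [].
split => //; rewrite leNgt; apply/negP => sr.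
have [|d d0 Hd] := cs x Ox (r - s x); first by rewrite subr_gt0.
have [y [[Oy ry] xy]] := clx _ (nbhsx_ballx x d d0).
have := Hd y Oy xy; rewrite distrC ltNge => /negP; apply.
by rewrite (le_trans _ (ler_norm _))// lerD2r.
Qed.

Lemma superlevel_in (s : 'rV[R]_N -> R) (r : R) : 0 < r ->
  (forall x, bd Omega x -> s x = 0) ->
  [set x | closure Omega x /\ r <= s x] `<=` Omega.
Proof.
move=> r0 s0 x [cx rx]; apply: contrapT => Ox; move: rx.
by rewrite s0// leNgt r0.
Qed.

(** The divergence theorem for the compactly supported fields flux_i p, one
    coordinate at a time. *)
Lemma green_test w dw dF p dp K : admissible w dw dF -> compact K -> K `<=` Omega ->
  (forall i x, Omega x -> is_derive x (e i) p (dp i x)) ->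
  continuous_in p -> (forall i, continuous_in (dp i)) ->
  (forall x, Omega x -> ~ K x -> p x = 0) ->
  let E x := (Lflux w dF x + c x * w x) * p x + \sum_i flux dw i x * dp i x in
  bounded_in E /\ mean E = 0.
Proof.
move=> a cK KO dpP cp cdp p0 E.
pose d i x := dF i x * p x + flux dw i x * dp i x.
have ED x : E x = \sum_i d i x.
  by rewrite /d big_split/= -mulr_suml /E /Lflux subrK.
have md i : bounded_in (d i) /\ mean (d i) = 0.
  apply: (mean_div M0 OmegaM oOmega (i := i) (G := fun x => flux dw i x * p x) cK KO).
  - move=> x Ox; apply: is_derive_congr (is_deriveM (adm_dF a i Ox) (dpP i x Ox)) _ _ => //.
    by rewrite /d /GRing.scale/=; ring.
  - apply: continuous_inD; apply: continuous_inM => //.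
      exact: (adm_dFc a i).
    exact: (adm_fluxc a i).
  - by move=> x Ox Kx; rewrite p0// mulr0.
split.
  apply: bounded_in_eq (bounded_in_sum (fun i => (md i).1)).
  by move=> x _; rewrite ED.
rewrite (eq_mean M (fun x _ => ED x)) mean_sum; last by move=> i; exact: (md i).1.
by rewrite big1// => i _; exact: (md i).2.
Qed.

Definition form du dv x := \sum_i flux du i x * dv i x.

Lemma formC du dv x : Omega x -> form du dv x = form dv du x.
Proof.
move=> Ox; rewrite /form /flux.
under eq_bigr do rewrite mulr_suml; under [RHS]eq_bigr do rewrite mulr_suml.
rewrite exchange_big/=; apply: eq_bigr => i _; apply: eq_bigr => j _.
rewrite Asym//; ring.
Qed.

(** Nonnegativity of the form of A at a du + b dv, expanded. *)
Lemma form_ge0 du dv (a b : R) x : Omega x ->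
  0 <= a ^+ 2 * form du du x + 2 * a * b * form du dv x + b ^+ 2 * form dv dv x.
Proof.
move=> Ox; have := Apos Ox (fun i => a * du i x + b * dv i x).
set S := \sum_i _; suff -> : S = a ^+ 2 * form du du x + 2 * a * b * form du dv x
   + b ^+ 2 * form dv dv x by [].
have -> : 2 * a * b * form du dv x = a * b * form du dv x + a * b * form dv du x.
  by rewrite (formC du dv)//; ring.
rewrite /S /form !mulr_sumr -!big_split/=; apply: eq_bigr => i _.
rewrite /flux !mulr_suml !mulr_sumr -!big_split/=; apply: eq_bigr => j _.
ring.
Qed.

Section pair.
Variables (u v : 'rV[R]_N -> R) (du dv dFu dFv : 'I_N -> 'rV[R]_N -> R).
Hypotheses (au : admissible u du dFu) (av : admissible v dv dFv).

(** The variable of the cutoffs. A cutoff of u^2 + v^2 vanishes near the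
    boundary, equals 1 wherever u or v is not small, and its gradient is a
    combination of u du and v dv, so that its contribution is again expressed by
    the forms X, Y and Z. *)
Definition sumsq (u v : 'rV[R]_N -> R) (x : 'rV[R]_N) : R := u x ^+ 2 + v x ^+ 2.
Local Notation s := (sumsq u v).
Local Notation X := (form du du).
Local Notation Y := (form du dv).
Local Notation Z := (form dv dv).
Local Notation Lu := (Lflux u dFu).
Local Notation Lv := (Lflux v dFv).

Lemma sumsq_ge0 x : 0 <= s x.
Proof. by rewrite addr_ge0 ?sqr_ge0. Qed.

Lemma sumsq_continuous : {within closure Omega, continuous s}.
Proof.
have cu := adm_cont au; have cv := adm_cont av.
move=> x; apply: cvgD.
  exact: cvgM (cu x) (cu x).
exact: cvgM (cv x) (cv x).
Qed.

Lemma sumsq_bd x : bd Omega x -> s x = 0.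
Proof. by move=> bx; rewrite /sumsq (adm_bd au)// (adm_bd av)// expr0n addr0. Qed.

Lemma sumsq_derive i x : Omega x ->
  is_derive x (e i) s (2 * u x * du i x + 2 * v x * dv i x).
Proof.
move=> Ox; apply: is_derive_congr
  (is_deriveD (is_deriveM (adm_dw au i Ox) (adm_dw au i Ox))
              (is_deriveM (adm_dw av i Ox) (adm_dw av i Ox))) _ _ => //.
by rewrite /GRing.scale/=; ring.
Qed.

Lemma continuous_in_comp (g : R -> R) f : continuous g -> continuous_in f ->
  continuous_in (fun x => g (f x)).
Proof. by move=> cg cf x Ox; apply: (continuous_comp (cf x Ox)); exact: cg. Qed.

Lemma sumsq_cin : continuous_in s.
Proof.
have cu := admissible_continuous au; have cv := admissible_continuous av.
by apply: continuous_inD; apply: continuous_inM.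
Qed.

Lemma cut_continuous eps : continuous (@cutoff R eps).
Proof.
move=> y; apply: differentiable_continuous; apply/derivable1_diffP.
by have [] := cut_derive eps y.
Qed.

Lemma cut_out eps x : 0 < eps -> Omega x ->
  ~ [set x | closure Omega x /\ eps <= s x] x -> cutoff eps (s x) = 0.
Proof.
move=> e0 Ox nK; apply: step0; rewrite ler_pdivrMr// mul1r leNgt; apply/negP => /ltW h.
by apply: nK; split => //; exact: subset_closure.
Qed.

Lemma cut_supp_bounded eps (g : 'rV[R]_N -> R) : 0 < eps -> continuous_in g ->
  bounded_in (fun x => cutoff eps (s x) * g x).
Proof.
move=> e0 cg.
apply: (continuous_supp_bounded oOmega (superlevel_compact sumsq_continuous)
  (superlevel_in e0 sumsq_bd)).
  apply: continuous_inM => //; apply: continuous_in_comp; last exact: sumsq_cin.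
  exact: cut_continuous.
by move=> x Ox nK; rewrite (cut_out e0 Ox nK) mul0r.
Qed.

Lemma cut_test eps w dw dF r dr dG : 0 < eps ->
  admissible w dw dF -> admissible r dr dG ->
  let E x := (Lflux w dF x + c x * w x) * (r x * cutoff eps (s x)) +
    (cutoff eps (s x) * form dw dr x +
     r x * dcutoff eps (s x) * (2 * u x * form dw du x + 2 * v x * form dw dv x)) in
  bounded_in E /\ mean E = 0.
Proof.
move=> e0 aw ar E.
pose dp i x := dr i x * cutoff eps (s x) +
   r x * (dcutoff eps (s x) * (2 * u x * du i x + 2 * v x * dv i x)).
have cu := admissible_continuous au; have cv := admissible_continuous av.
have cr := admissible_continuous ar.
have ccut : continuous_in (fun x => cutoff eps (s x)).
  by apply: continuous_in_comp; [exact: cut_continuous|exact: sumsq_cin].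
have cdcut : continuous_in (fun x => dcutoff eps (s x)).
  by apply: continuous_in_comp; [exact: dcut_continuous|exact: sumsq_cin].
have EE x : E x = (Lflux w dF x + c x * w x) * (r x * cutoff eps (s x)) +
   \sum_i flux dw i x * dp i x.
  rewrite /E; congr (_ + _); rewrite /form !mulr_sumr -!big_split/= mulr_sumr -big_split/=.
  by apply: eq_bigr => i _; rewrite /dp; ring.
have dpP i x : Omega x -> is_derive x (e i) (fun x => r x * cutoff eps (s x)) (dp i x).
  move=> Ox; apply: is_derive_congr (is_deriveM (adm_dw ar i Ox)
    (is_derive_comp_real (sumsq_derive i Ox) (cut_derive eps (s x)))) _ _ => //.
  by rewrite /dp /GRing.scale/=; ring.
have cdp i : continuous_in (dp i).
  apply: continuous_inD; apply: continuous_inM => //; first exact: (adm_dwc ar i).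
  apply: continuous_inM => //.
  apply: continuous_inD; apply: continuous_inM.
  + by apply: continuous_inM => //; exact: continuous_in_cst.
  + exact: (adm_dwc au i).
  + by apply: continuous_inM => //; exact: continuous_in_cst.
  + exact: (adm_dwc av i).
have p0 x : Omega x -> ~ [set x | closure Omega x /\ eps <= s x] x ->
    r x * cutoff eps (s x) = 0.
  by move=> Ox nK; rewrite (cut_out e0 Ox nK) mulr0.
have [bE mE] := green_test aw (superlevel_compact (r := eps) sumsq_continuous)
  (superlevel_in e0 sumsq_bd) dpP (continuous_inM cr ccut) cdp p0.
split; first by apply: bounded_in_eq bE => x _; rewrite EE.
by rewrite -mE; apply: eq_mean => x _; rewrite EE.
Qed.

Lemma cut_energy_bounded eps : 0 < eps ->
  bounded_in (fun x => cutoff eps (s x) * (X x + Z x)).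
Proof.
move=> e0; apply: cut_supp_bounded => //.
have cform da db : (forall i, continuous_in (flux da i)) -> (forall i, continuous_in (db i)) ->
   continuous_in (form da db).
  by move=> ca cb; apply: continuous_in_sum => i; exact: continuous_inM.
apply: continuous_inD; apply: cform => i.
- exact: (adm_fluxc au i).
- exact: (adm_dwc au i).
- exact: (adm_fluxc av i).
- exact: (adm_dwc av i).
Qed.

(** Test the equation of u with u times the cutoff and that of v with v times
    the cutoff, and add. The terms with the derivative of the cutoff form the
    quadratic form of u du + v dv, which is nonnegative, as is the potential
    term, and what remains is bounded by the sup norms of u, v, L u and L v.
    Hence the energy is bounded uniformly in the cutoff. *)
Lemma cut_energy_le : exists C, forall eps, 0 < eps ->
  mean (fun x => cutoff eps (s x) * (X x + Z x)) <= C.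
Proof.
have [C HC] : bounded_in (fun x => Lu x * u x + Lv x * v x).
  apply: bounded_inD; apply: bounded_inM.
  - exact: adm_L au.
  - exact: admissible_bounded au.
  - exact: adm_L av.
  - exact: admissible_bounded av.
exists `|C| => eps e0.
have [b1 m1] := cut_test e0 au au; have [b2 m2] := cut_test e0 av av.
set E1 := (X in mean X = 0) in m1 b1; set E2 := (X in mean X = 0) in m2 b2.
pose f x := - (Lu x * u x + Lv x * v x) * cutoff eps (s x).
have fC x : Omega x -> `|f x| <= `|C|.
  move=> Ox; rewrite /f normrM normrN -[leRHS]mulr1 ler_pM//.
    by rewrite (le_trans (HC x Ox))// ler_norm.
  by have /andP[h1 h2] := step_itv (s x / eps); rewrite ger0_norm.
have bf : bounded_in f by exists `|C|.
have bE := bounded_inD b1 b2.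
have mE : mean (fun x => E1 x + E2 x) = 0 by rewrite meanD// m1 m2 addr0.
apply: (@le_trans _ _ (mean (fun x => (E1 x + E2 x) + f x))).
  apply: le_mean; [exact: cut_energy_bounded|exact: bounded_inD|].
  move=> x Ox; rewrite /E1 /E2 /f.
  have /andP[t0 _] := step_itv (s x / eps); rewrite -/(cutoff eps (s x)) in t0.
  have d0 : 0 <= dcutoff eps (s x) by rewrite divr_ge0 ?dstep_ge0// ltW.
  have W0 := form_ge0 du dv (u x) (v x) Ox.
  have cs : 0 <= c x * s x * cutoff eps (s x).
    by rewrite mulr_ge0// mulr_ge0 ?c0 ?sumsq_ge0.
  rewrite (formC dv du)//.
  have W1 : 0 <= dcutoff eps (s x) * (u x ^+ 2 * X x + 2 * u x * v x * Y x + v x ^+ 2 * Z x).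
    exact: mulr_ge0.
  move: cs W1; rewrite /sumsq; set T := cutoff _ _; set D := dcutoff _ _ => cs W1.
  rewrite -subr_ge0.
  set rhs := (X in 0 <= X).
  have -> : rhs = c x * (u x ^+ 2 + v x ^+ 2) * T +
     2 * (D * (u x ^+ 2 * X x + 2 * u x * v x * Y x + v x ^+ 2 * Z x)) by rewrite /rhs; ring.
  by rewrite addr_ge0// mulr_ge0.
rewrite meanD// mE add0r; apply: le_trans (ler_norm _) _.
exact: mean_norm.
Qed.

Lemma small_of_sumsq (eta : R) x : 0 <= eta -> s x <= eta ^+ 2 ->
  `|u x| <= eta /\ `|v x| <= eta.
Proof.
move=> eta0 se; split; rewrite -ler_sqr ?nnegrE// real_normK ?num_real//;
  apply: le_trans se; rewrite /sumsq ?lerDl ?lerDr sqr_ge0//.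
Qed.

(** Test the equation of u with v times the cutoff and that of v with u times
    the cutoff, and subtract: the terms with du and dv exchanged cancel by the
    symmetry of A, and those with the derivative of the cutoff are at most
    2 s dcutoff(s) (X + Z), to which [dstep_le] applies. Where the cutoff differs
    from 1, both u and v are at most eta. *)
Lemma cut_commutator_le (eps eta B : R) : 0 < eps -> 0 <= eta -> 2 * eps <= eta ^+ 2 ->
  0 <= B -> (forall x, Omega x -> `|Lu x| <= B) -> (forall x, Omega x -> `|Lv x| <= B) ->
  mean (fun x => Lu x * v x - Lv x * u x) <=
  8 * (mean (fun x => cutoff (eps / 2) (s x) * (X x + Z x)) -
       mean (fun x => cutoff (2 * eps) (s x) * (X x + Z x))) + 2 * B * eta.
Proof.
move=> e0 eta0 eeta B0 LuB LvB.
have [bE1 mE1] := cut_test e0 au av; have [bE2 mE2] := cut_test e0 av au.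
set E1 := (X in mean X = 0) in mE1 bE1; set E2 := (X in mean X = 0) in mE2 bE2.
have N1 f : bounded_in f -> bounded_in (fun x => (-1) * f x).
  by move=> bf; apply: bounded_inM => //; exact: bounded_in_cst.
have eh : 0 < eps / 2 by rewrite divr_gt0.
have e2 : 0 < 2 * eps by rewrite mulr_gt0.
have b1 := cut_energy_bounded eh; have b2 := cut_energy_bounded e2.
set Q1 := (fun x => cutoff (eps / 2) (s x) * _) in b1 *.
set Q2 := (fun x => cutoff (2 * eps) (s x) * _) in b2 *.
pose T x := cutoff eps (s x).
pose f x := (1 - T x) * (Lu x * v x - Lv x * u x).
have T01 x : 0 <= T x <= 1 by exact: step_itv.
have fB x : Omega x -> `|f x| <= 2 * B * eta.
  move=> Ox; rewrite /f normrM.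
  have [st|st] := leP (2 * eps) (s x).
    rewrite /T /cutoff step1; last by rewrite ler_pdivlMr.
    by rewrite subrr normr0 mul0r !mulr_ge0.
  have [ux vx] := small_of_sumsq eta0 (le_trans (ltW st) eeta).
  have /andP[t0 t1] := T01 x.
  have t2 : `|1 - T x| <= 1 by rewrite ger0_norm ?subr_ge0// lerBlDr lerDl.
  rewrite -[leRHS]mul1r; apply: ler_pM => //.
  rewrite (le_trans (ler_normB _ _))// !normrM.
  have -> : 2 * B * eta = B * eta + B * eta by ring.
  by rewrite lerD// ler_pM ?LuB ?LvB.
have bf : bounded_in f by exists (2 * B * eta).
have mf : mean f <= 2 * B * eta.
  by apply: le_trans (ler_norm _) _; apply: mean_norm fB; rewrite !mulr_ge0.
have bEE : bounded_in (fun x => E1 x + (-1) * E2 x) by exact: bounded_inD bE1 (N1 _ bE2).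
have mEE : mean (fun x => E1 x + (-1) * E2 x) = 0.
  by rewrite meanD//; [rewrite meanZ// mE1 mE2 mulr0 addr0|exact: N1].
have bQ : bounded_in (fun x => Q1 x + (-1) * Q2 x) by exact: bounded_inD b1 (N1 _ b2).
have b8Q : bounded_in (fun x => 8 * (Q1 x + (-1) * Q2 x)).
  by apply: bounded_inM => //; exact: bounded_in_cst.
have mQ : mean (fun x => 8 * (Q1 x + (-1) * Q2 x)) = 8 * (mean Q1 - mean Q2).
  by rewrite meanZ// meanD//; [rewrite meanZ// mulN1r|exact: N1].
have bL : bounded_in (fun x => Lu x * v x - Lv x * u x).
  apply: bounded_in_eq (bounded_inD (bounded_inM (adm_L au) (admissible_bounded av))
    (N1 _ (bounded_inM (adm_L av) (admissible_bounded au)))).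
  by move=> x _; rewrite mulN1r.
rewrite -mQ.
apply: (@le_trans _ _ (mean (fun x => 8 * (Q1 x + (-1) * Q2 x)) + mean f)); last first.
  by rewrite lerD2l; exact: mf.
rewrite -[X in _ <= X + _]addr0 -mEE -meanD// -meanD//; last exact: bounded_inD.
apply: le_mean => //; first by apply: bounded_inD => //; exact: bounded_inD.
move=> x Ox; rewrite /f /E1 /E2 /Q1 /Q2 (formC dv du)// -/(T x).
set D := dcutoff eps (s x); set T1 := cutoff (eps / 2) _; set T2 := cutoff (2 * eps) _.
have D0 : 0 <= D by rewrite divr_ge0 ?dstep_ge0// ltW.
have X0 : 0 <= X x by have := form_ge0 du dv 1 0 Ox; rewrite !(expr1n, expr0n, mulr0, mul0r, mul1r, addr0).
have Z0 : 0 <= Z x by have := form_ge0 du dv 0 1 Ox; rewrite !(expr1n, expr0n, mulr0, mul0r, mul1r, add0r).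
have P0 : 0 <= X x + 2 * Y x + Z x.
  by have := form_ge0 du dv 1 1 Ox; rewrite !(expr1n, mulr1, mul1r).
have P1 : 0 <= X x - 2 * Y x + Z x.
  have := form_ge0 du dv 1 (-1) Ox; rewrite expr1n sqrrN expr1n !mul1r mulr1.
  by rewrite (_ : 2 * -1 * Y x = - (2 * Y x)) //; ring.
have sD : s x * D <= 4 * (T1 - T2).
  have y0 : 0 <= s x / eps by rewrite divr_ge0 ?sumsq_ge0// ltW.
  have := dstep_le y0; rewrite /D /dcutoff /T1 /T2 /cutoff.
  have -> : 2 * (s x / eps) = s x / (eps / 2) by field; rewrite gt_eqF.
  have -> : s x / eps / 2 = s x / (2 * eps) by field; rewrite gt_eqF.
  by move=> h; rewrite (_ : s x * _ = s x / eps * dstep (s x / eps))//; ring.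
(* completing squares in the combinations du + dv and du - dv *)
have key : - (u x * v x * X x + (v x ^+ 2 - u x ^+ 2) * Y x - u x * v x * Z x)
   <= s x * (X x + Z x).
  rewrite -subr_ge0; set rhs := (X in 0 <= X).
  have -> : rhs = 2^-1 * ((u x + v x) ^+ 2 * X x + (u x - v x) ^+ 2 * Z x +
     v x ^+ 2 * (X x + 2 * Y x + Z x) + u x ^+ 2 * (X x - 2 * Y x + Z x)).
    by rewrite /rhs /sumsq; field.
  by rewrite mulr_ge0// ?invr_ge0// !addr_ge0// mulr_ge0// sqr_ge0.
have key2 : - (2 * D * (u x * v x * X x + (v x ^+ 2 - u x ^+ 2) * Y x - u x * v x * Z x))
   <= 8 * (T1 - T2) * (X x + Z x).
  apply: (@le_trans _ _ (2 * D * (s x * (X x + Z x)))).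
    by rewrite -mulrN ler_wpM2l// mulr_ge0.
  have -> : 2 * D * (s x * (X x + Z x)) = 2 * (s x * D) * (X x + Z x) by ring.
  have -> : 8 * (T1 - T2) * (X x + Z x) = 2 * (4 * (T1 - T2)) * (X x + Z x) by ring.
  by rewrite ler_wpM2r ?addr_ge0// ler_wpM2l.
rewrite -subr_ge0; set rhs := (X in 0 <= X).
rewrite -subr_ge0 in key2; move: key2; set rhs2 := (X in 0 <= X -> _).
suff -> : rhs = rhs2 by [].
by rewrite /rhs /rhs2; ring.
Qed.

(** Along the scales 4^-j the bound of [cut_commutator_le] is a difference of
    consecutive terms of a sequence that is nondecreasing and, by
    [cut_energy_le], bounded; it tends to 0. *)
Lemma Lflux_commutator_le0 : mean (fun x => Lu x * v x - Lv x * u x) <= 0.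
Proof.
have [Bu HBu] := adm_L au; have [Bv HBv] := adm_L av.
pose B := `|Bu| + `|Bv|.
have B0 : 0 <= B by rewrite addr_ge0.
have LuB x : Omega x -> `|Lu x| <= B.
  by move=> /HBu h; rewrite (le_trans h)// (le_trans (ler_norm _))// lerDl.
have LvB x : Omega x -> `|Lv x| <= B.
  by move=> /HBv h; rewrite (le_trans h)// (le_trans (ler_norm _))// lerDr.
pose m (j : nat) := mean (fun x => cutoff (4^-1 ^+ j) (s x) * (X x + Z x)).
have p4 j : 0 < (4^-1 : R) ^+ j by rewrite exprn_gt0.
have XZ0 x : Omega x -> 0 <= X x + Z x.
  move=> Ox; have := form_ge0 du dv 1 0 Ox; have := form_ge0 du dv 0 1 Ox.
  by rewrite !(expr1n, expr0n, mulr0, mul0r, mul1r, addr0, add0r) => *; rewrite addr_ge0.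
(* the factor 2 makes eps / 2 and 2 eps consecutive powers of 1 / 4 *)
pose eps j : R := 2 * 4^-1 ^+ j.+1.
have eps2 j : eps j / 2 = 4^-1 ^+ j.+1 by rewrite /eps; field.
have eps4 j : 2 * eps j = 4^-1 ^+ j by rewrite /eps exprS; field.
have eps0 j : 0 < eps j by rewrite mulr_gt0.
have ndm : nondecreasing_seq m.
  apply/nondecreasing_seqP => j; apply: le_mean; [exact: cut_energy_bounded..|].
  move=> x Ox; rewrite ler_wpM2r ?XZ0// -(eps4 j) -(eps2 j).
  have y0 : 0 <= s x / eps j by rewrite divr_ge0 ?sumsq_ge0// ltW.
  have := dstep_le y0; rewrite /cutoff.
  have -> : 2 * (s x / eps j) = s x / (eps j / 2) by field; rewrite gt_eqF.
  have -> : s x / eps j / 2 = s x / (2 * eps j) by field; rewrite gt_eqF.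
  have : 0 <= s x / eps j * dstep (s x / eps j) by rewrite mulr_ge0 ?dstep_ge0.
  by move=> h1 h2; have := le_trans h1 h2; rewrite pmulr_rge0// subr_ge0.
have [C HC] := cut_energy_le.
have cm : cvgn m.
  by apply: nondecreasing_is_cvgn => //; exists C => _ [j _ <-]; exact: HC.
have lim0 : 8 * (m j.+1 - m j) + 2 * B * 2^-1 ^+ j @[j --> \oo] --> 0.
  rewrite -[X in _ --> X]addr0; apply: cvgD.
    rewrite -(mulr0 8); apply: cvgM; first exact: cvg_cst.
    rewrite -(subrr (limn m)); apply: cvgB; last exact: cm.
    by rewrite (cvg_shiftS m).
  rewrite -(mulr0 (2 * B)); apply: cvgM; first exact: cvg_cst.
  by apply: cvg_expr; rewrite ger0_norm// invf_lt1// ltr1n.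
rewrite -(cvg_lim _ lim0)//; apply: limr_ge; first by apply/cvg_ex; eexists; exact: lim0.
near=> j; rewrite /m -(eps4 j) -(eps2 j); apply: cut_commutator_le => //.
rewrite eps4 -exprM mulnC exprM.
have -> : (2^-1 : R) ^+ 2 = 4^-1 by rewrite expr2; field.
by [].
Unshelve. all: by end_near. Qed.

End pair.

(** Green's identity for u tested with u times a cutoff: all terms other than
    (L u) u have a sign, and the mean of (L u) u where the cutoff is below 1 is
    small because u is. *)
Lemma Lflux_neg u du dF : admissible u du dF ->
  mean (fun x => Lflux u dF x * u x) <= 0.
Proof.
move=> au.
have [B0 HB0] := adm_L au; pose B := `|B0|; have Bge0 : 0 <= B by exact: normr_ge0.
have LB x : Omega x -> `|Lflux u dF x| <= B.
  by move=> /HB0 h; rewrite (le_trans h)// ler_norm.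
apply/ler_addgt0Pr => d d0; rewrite add0r.
pose eta := d / (B + 1).
have B1 : 0 < B + 1 by rewrite ltr_wpDl.
have eta0 : 0 < eta by rewrite divr_gt0.
pose eps := eta ^+ 2 / 2.
have e0 : 0 < eps by rewrite divr_gt0// exprn_gt0.
have [bE mE] := cut_test au au e0 au au.
set E := (X in mean X = 0) in mE bE.
pose T x := cutoff eps (sumsq u u x).
pose f x := (1 - T x) * (Lflux u dF x * u x).
have fB x : Omega x -> `|f x| <= d.
  move=> Ox; have [st|st] := leP (2 * eps) (sumsq u u x).
    rewrite /f /T /cutoff step1; last by rewrite ler_pdivlMr.
    by rewrite subrr mul0r normr0 ltW.
  have [ux _] : `|u x| <= eta /\ `|u x| <= eta.
    by apply: small_of_sumsq (ltW eta0) _; rewrite (le_trans (ltW st))// /eps mulrC divfK.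
  have /andP[t0 t1] : 0 <= T x <= 1 by exact: step_itv.
  rewrite /f !normrM; apply: (@le_trans _ _ (1 * (B * eta))).
    have t2 : `|1 - T x| <= 1 by rewrite ger0_norm ?subr_ge0// lerBlDr lerDl.
    by apply: ler_pM => //; apply: ler_pM => //; exact: LB.
  by rewrite mul1r /eta mulrCA ler_piMr ?(ltW d0)// ler_pdivrMr// mul1r lerDl.
have bf : bounded_in f by exists d.
apply: (@le_trans _ _ (mean (fun x => E x + f x))); last first.
  by rewrite meanD// mE add0r (le_trans (ler_norm _))// mean_norm// ltW.
apply: le_mean; first exact: bounded_inM (adm_L au) (admissible_bounded au).
  exact: bounded_inD.
move=> x Ox; rewrite /f /E -/(T x).
have D0 : 0 <= dcutoff eps (sumsq u u x) by rewrite divr_ge0 ?dstep_ge0// ltW.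
have X0 : 0 <= form du du x.
  by have := form_ge0 du du 1 0 Ox; rewrite !(expr1n, expr0n, mulr0, mul0r, mul1r, addr0).
have /andP[t0 _] : 0 <= T x <= 1 by exact: step_itv.
have c1 := c0 Ox.
rewrite -subr_ge0; set rhs := (X in 0 <= X).
have -> : rhs = c x * u x ^+ 2 * T x + T x * form du du x +
   4 * (dcutoff eps (sumsq u u x) * (u x ^+ 2 * form du du x)) by rewrite /rhs; ring.
have u20 := sqr_ge0 (u x).
have h4 : 0 <= (4 : R) by [].
exact: addr_ge0 (addr_ge0 (mulr_ge0 (mulr_ge0 c1 u20) t0) (mulr_ge0 t0 X0)) (mulr_ge0 h4 (mulr_ge0 D0 (mulr_ge0 u20 X0))).
Qed.

(** Both inequalities are the commutator bound, for (u, v) and for (v, u). *)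
Lemma Lflux_sym u du dF v dv dG : admissible u du dF -> admissible v dv dG ->
  mean (fun x => Lflux u dF x * v x) = mean (fun x => Lflux v dG x * u x).
Proof.
move=> au av.
have h (f g : 'rV[R]_N -> R) : bounded_in f -> bounded_in g ->
    mean (fun x => f x - g x) = mean f - mean g.
  move=> bf bg; have bg1 : bounded_in (fun x => (-1) * g x).
    by apply: bounded_inM => //; exact: bounded_in_cst.
  rewrite -mulN1r -meanZ// -meanD//; apply: eq_mean => x _; by rewrite mulN1r.
have buv := bounded_inM (adm_L au) (admissible_bounded av).
have bvu := bounded_inM (adm_L av) (admissible_bounded au).
apply/le_anti/andP; split; rewrite -subr_le0 -h//.
  exact: Lflux_commutator_le0 au av.
exact: Lflux_commutator_le0 av au.
Qed.

End green.

(** * Total variation of an absolutely continuous function *)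
Section tv_ac.
Context {R : realType}.
Implicit Types (a b e d : R) (f : R -> R) (s r : seq (R * R)).

Definition admissible_itvs a b s :=
  all (fun p => [&& a <= p.1, p.1 <= p.2 & p.2 <= b]) s &&
  pairwise (fun p q => p.2 <= q.1) s.

Definition itvs_of a (l : seq R) : seq (R * R) := [seq (x.2, x.1) | x <- zip l (a :: l)].

Lemma itvs_of_admissible a b l : itv_partition a b l -> admissible_itvs a b (itvs_of a l).
Proof.
elim: l a => // x l IH a abl; have ax : a < x by case: abl => /= /andP[].
have xbl := itv_partition_cons abl; have xb := itv_partition_le xbl.
have /andP[/allP h1 h2] := IH x xbl.
rewrite /admissible_itvs /itvs_of /= lexx (ltW ax) xb/= -/(itvs_of x l) h2 andbT.
apply/andP; split; apply/allP => p /h1 /and3P[p1 p2 p3].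
  by rewrite (le_trans (ltW ax) p1) p2 p3.
exact: p1.
Qed.

Lemma itvs_of_length a b l : itv_partition a b l ->
  \sum_(p <- itvs_of a l) (p.2 - p.1) = b - a.
Proof.
elim: l a => [a /itv_partition_nil ->|x l IH a abl]; first by rewrite big_nil subrr.
rewrite /itvs_of /= big_cons -/(itvs_of x l) (IH x (itv_partition_cons abl))/=; ring.
Qed.

Lemma itvs_of_variation f a b l : itv_partition a b l ->
  \sum_(p <- itvs_of a l) `|f p.2 - f p.1| = variation a b f l.
Proof. by move=> abl; rewrite variation_zip// /itvs_of big_map. Qed.

Lemma admissible_insert a b r p s t : admissible_itvs a b (r ++ p :: s) ->
  admissible_itvs p.1 p.2 t -> admissible_itvs a b (r ++ t ++ s).
Proof.
rewrite /admissible_itvs !all_cat !pairwise_cat /= !allrel_catr !allrel_consr.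
move=> /andP[/and3P[-> /and3P[p1 p2 p3] ->] /and3P[/andP[rp ->] -> /andP[ps ->]]].
move=> /andP[/allP tp ->]; rewrite !andbT /=.
have -> : all (fun p => [&& a <= p.1, p.1 <= p.2 & p.2 <= b]) t.
  apply/allP => q /tp /and3P[q1 q2 q3].
  by rewrite (le_trans p1 q1) q2 (le_trans q3 p3).
have -> : allrel (fun p q => p.2 <= q.1) r t.
  apply/allrelP => x q xr /tp /and3P[q1 q2 q3].
  by rewrite (le_trans _ q1)//; move/allP: rp => /(_ x xr).
rewrite /= ; apply/allrelP => q y /tp /and3P[q1 q2 q3] ys.
by rewrite (le_trans q3)//; move/allP: ps => /(_ y ys).
Qed.

Local Notation TV := total_variation.

(** Absolute continuity bounds the increments over every admissible family;
    refining each interval and taking suprema gives the same bound for the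
    total variations. The suprema are taken one interval at a time: r collects
    the intervals already refined, s those that still carry a total variation. *)
Lemma TV_sum_le a b f e d :
  (forall s, admissible_itvs a b s -> \sum_(p <- s) (p.2 - p.1) < d ->
     \sum_(p <- s) `|f p.2 - f p.1| <= e) ->
  forall s r, admissible_itvs a b (r ++ s) -> \sum_(p <- r ++ s) (p.2 - p.1) < d ->
  ((\sum_(p <- r) `|f p.2 - f p.1|)%:E + \sum_(p <- s) TV p.1 p.2 f <= e%:E)%E.
Proof.
move=> H; elim => [r|p s IH r] adm len.
  by rewrite big_nil adde0 lee_fin; apply: H; rewrite cats0 in adm len *.
rewrite big_cons addeCA.
have p12 : p.1 <= p.2.
  by move: adm; rewrite /admissible_itvs all_cat/= => /andP[/and3P[_ /and3P[]]].
set C := ((_)%:E + _)%E.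
have key x : variations p.1 p.2 f x -> (x%:E + C <= e%:E)%E.
  move=> [l pl <-].
  have := IH (r ++ itvs_of p.1 l); rewrite -catA.
  move=> /(_ (admissible_insert adm (itvs_of_admissible pl))).
  rewrite !big_cat/= (itvs_of_length pl) (itvs_of_variation _ pl).
  move: len; rewrite big_cat big_cons/= => len; move=> /(_ len).
  by move=> h; apply: le_trans h; rewrite /C addeA -EFinD addrC.
(* a single variation shows that C is finite and can change sides *)
have [x0 x0P] : variations p.1 p.2 f !=set0.
  move: p12; rewrite le_eqVlt => /predU1P[->|]; last exact: variations_neq0.
  by exists 0; rewrite variationsxx.
have Cfin : C \is a fin_num.
  rewrite fin_numElt; apply/andP; split; last first.
    by have := key _ x0P; case: (C) => //= *; rewrite ?ltry ?ltNye.
  apply: (@lt_le_trans _ _ 0%E) => //; rewrite adde_ge0// ?lee_fin ?sumr_ge0//.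
  rewrite big_seq sume_ge0// => q qs; apply: total_variation_ge0.
  move: adm; rewrite /admissible_itvs all_cat/= => /andP[/and3P[_ _ /allP /(_ q qs)]].
  by move=> /and3P[].
rewrite -leeBrDr//; apply: ub_ereal_sup => _ [x xP <-].
by rewrite leeBrDr//; exact: key.
Qed.

End tv_ac.

Section ac.
Context {R : realType}.
Variables (a b : R) (f : R -> R).
Hypothesis ab : a < b.
Hypothesis acf : absolutely_continuous a b f.
Local Notation TV := total_variation.

Lemma ac_TV e : 0 < e -> exists2 d, 0 < d &
  forall s, admissible_itvs a b s -> \sum_(p <- s) (p.2 - p.1) < d ->
    (\sum_(p <- s) TV p.1 p.2 f <= e%:E)%E.
Proof.
move=> /acf[d d0 H]; exists d => // s adm len.
have H' t : admissible_itvs a b t -> \sum_(p <- t) (p.2 - p.1) < d ->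
   \sum_(p <- t) `|f p.2 - f p.1| <= e.
  by move=> /andP[h1 h2] h3; apply/ltW/H.
by have := TV_sum_le H' (s := s) (r := [::]) adm len; rewrite big_nil add0e.
Qed.

(** On an interval shorter than d the variation is at most 1, and finitely many
    of these cover [a, b]. *)
Lemma ac_TV_fin : TV a b f \is a fin_num.
Proof.
have [d d0 H] := ac_TV ltr01.
have tv1 p q : a <= p -> p <= q -> q <= b -> q - p < d -> (TV p q f <= 1)%E.
  move=> ap pq qb qpd; have := H [:: (p, q)].
  by rewrite !big_seq1/=; apply => //; rewrite /admissible_itvs /= ap pq qb.
have [n nd] : exists n : nat, (b - a) / n.+1%:R < d.
  exists (Num.trunc ((b - a) / d)); rewrite ltr_pdivrMr// mulrC -ltr_pdivrMr//.
  exact: truncnS_gt.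
set h := (b - a) / n.+1%:R in nd.
have h0 : 0 < h by rewrite divr_gt0// subr_gt0.
have bE : b = a + h * n.+1%:R by rewrite /h divfK ?pnatr_eq0// addrC subrK.
have step k : (k <= n.+1)%N -> (TV a (a + h * k%:R) f < +oo)%E.
  elim: k => [_|k IH kn]; first by rewrite mulr0 addr0 total_variationxx.
  have e1 : a + h * k%:R <= a + h * k.+1%:R by rewrite lerD2l ler_pM2l// ler_nat.
  have e0 : a <= a + h * k%:R by rewrite lerDl mulr_ge0// ltW.
  rewrite (total_variationD _ e0 e1) lte_add_pinfty ?IH 1?ltnW//.
  apply: (@le_lt_trans _ _ 1%E); last by rewrite ltry.
  apply: tv1 => //; first by rewrite bE lerD2l ler_pM2l// ler_nat.
  by rewrite -natr1 (_ : _ - _ = h)//; ring.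
rewrite ge0_fin_numE; last by apply: total_variation_ge0; exact: ltW.
by rewrite [X in TV a X]bE step.
Qed.

Definition tvar (x : R) : R := fine (TV a x f).

Lemma TV_fin p q : a <= p -> p <= q -> q <= b -> TV p q f \is a fin_num.
Proof.
move=> ap pq qb; have bv : bounded_variation a b f.
  by apply/bounded_variationP; [exact: ltW|exact: ac_TV_fin].
apply/bounded_variationP => //.
apply: (bounded_variationr ap pq); apply: (bounded_variationl (le_trans ap pq) qb bv).
Qed.

Lemma tvarB p q : a <= p -> p <= q -> q <= b ->
  ((tvar q - tvar p)%:E = TV p q f)%E.
Proof.
move=> ap pq qb; rewrite /tvar (total_variationD f ap pq).
rewrite fineD ?TV_fin// ?(le_trans pq qb)//.
by rewrite addrAC subrr add0r fineK// TV_fin.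
Qed.

Lemma tvar_nd p q : a <= p -> p <= q -> q <= b -> `|f q - f p| <= tvar q - tvar p.
Proof. by move=> ap pq qb; rewrite -lee_fin tvarB// total_variation_ge. Qed.

Lemma tvar_ac : forall e, 0 < e -> exists2 d, 0 < d &
  forall s, admissible_itvs a b s -> \sum_(p <- s) (p.2 - p.1) < d ->
    \sum_(p <- s) (tvar p.2 - tvar p.1) <= e.
Proof.
move=> e /ac_TV[d d0 H]; exists d => // s adm len.
rewrite -lee_fin -sumEFin; apply: le_trans (H s adm len).
rewrite le_eqVlt; apply/orP; left; apply/eqP; rewrite big_seq [RHS]big_seq.
apply: eq_bigr => p ps; move/andP: adm => [/allP/(_ p ps)/and3P[p1 p2 p3] _].
exact: tvarB.
Qed.

End ac.

(** * The Stieltjes measure of a monotone absolutely continuous function *)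
Section mono_ac.
Context {R : realType}.
Variables (a b : R) (F : R -> R).
Hypothesis ab : a < b.
Hypothesis ndF : {homo F : x y / x <= y}.
Hypothesis cF : continuous F.
Hypothesis acF : forall e, 0 < e -> exists2 d, 0 < d &
  forall s, admissible_itvs a b s -> \sum_(p <- s) (p.2 - p.1) < d ->
    \sum_(p <- s) (F p.2 - F p.1) <= e.

Local Notation lam := (@lebesgue_measure R).

Definition cumF : cumulative R R :=
  HB.pack F (isCumulative.Build R _ R F ndF (right_continuousW cF)).

Local Notation muF := (lebesgue_stieltjes_measure cumF).

Lemma LS_itv (G : cumulative R R) p q : p <= q ->
  lebesgue_stieltjes_measure G `]p, q]%classic = (G q - G p)%:E.
Proof.
move=> pq; rewrite /lebesgue_stieltjes_measure /measure_extension.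
rewrite measurable_mu_extE/=; last exact: is_ocitv.
by rewrite wlength_itv_bnd.
Qed.

Definition mesh n : R := (b - a) / n.+1%:R.
Definition pt n (k : nat) : R := a + mesh n * k%:R.
Definition cell n (k : nat) : set R := `]pt n k, pt n k.+1]%classic.

Lemma mesh_gt0 n : 0 < mesh n.
Proof. by rewrite divr_gt0// subr_gt0. Qed.

Lemma pt_le n k l : (k <= l)%N -> pt n k <= pt n l.
Proof. by move=> kl; rewrite lerD2l ler_pM2l ?mesh_gt0// ler_nat. Qed.

Lemma pt_max n : pt n n.+1 = b.
Proof. by rewrite /pt /mesh divfK ?pnatr_eq0// addrC subrK. Qed.

Lemma pt0 n : pt n 0 = a.
Proof. by rewrite /pt mulr0 addr0. Qed.

Lemma cell_trivIset n (D : set 'I_n.+1) : trivIset D (fun k : 'I_n.+1 => cell n k).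
Proof.
move=> i j _ _ [x []]; rewrite /cell /= !in_itv/= => /andP[xi1 xi2] /andP[xj1 xj2].
apply/val_inj/eqP; rewrite eqn_leq; apply/andP; split; rewrite leqNgt; apply/negP => ij.
  by have := lt_le_trans xi1 (le_trans xj2 (pt_le n ij)); rewrite ltxx.
by have := lt_le_trans xj1 (le_trans xi2 (pt_le n ij)); rewrite ltxx.
Qed.

Lemma cell_cover n x : a < x <= b -> exists k : 'I_n.+1, cell n k x.
Proof.
move=> /andP[ax xb].
have ex : exists k, x <= pt n k by exists n.+1; rewrite pt_max.
have kn : (ex_minn ex <= n.+1)%N.
  by case: ex_minnP => k _; apply; rewrite pt_max.
case: ex_minnP kn => -[|k] xk kmin kn; first by move: xk; rewrite pt0 leNgt ax.
exists (Ordinal kn); rewrite /cell/= in_itv/= xk andbT ltNge.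
by apply/negP => /kmin; rewrite ltnn.
Qed.

(** An open set is exhausted by its points at distance at least two grid steps
    from the complement. These are covered by the grid cells contained in the
    open set, which form an admissible family of total length less than d. *)
Lemma muF_open_le e : 0 < e -> exists2 d, 0 < d & forall U, open U ->
  (lam U < d%:E)%E -> (muF (U `&` `]a, b]) <= e%:E)%E.
Proof.
move=> /acF[d d0 H]; exists d => // U oU Ud.
(* the cell of a point of W n lies in U *)
pose W n := [set x | a < x <= b /\ forall y, `|x - y| < 2 * mesh n -> U y].
have mW n : measurable (W n).
  rewrite (_ : W n = `]a, b] `\` \bigcup_(y in ~` U) ball y (2 * mesh n)).
    apply: measurableD => //; apply: open_measurable.
    by apply: bigcup_open => y _; exact: ball_open.
  apply/seteqP; split => x /=.
    move=> [xab xU]; rewrite in_itv/=; split => // -[y Uy yx]; apply: Uy; apply: xU.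
    by move: yx; rewrite /ball/= distrC.
  rewrite in_itv/= => -[xab Hx]; split => // y xy; apply: contrapT => Uy; apply: Hx.
  by exists y => //; rewrite /ball/= distrC.
have WU : \bigcup_n W n = U `&` `]a, b].
  apply/seteqP; split => [x [n _ [xab xU]]|x [Ux xab]].
    split; last by rewrite /= in_itv.
    by apply: xU; rewrite subrr normr0 mulr_gt0// mesh_gt0.
  have /nbhs_ballP[r /= r0 xr] : nbhs x U by exact: open_nbhs_nbhs.
  exists (Num.trunc (2 * (b - a) / r)) => //; split; first by rewrite /= in_itv in xab.
  move=> y xy; apply: xr; rewrite /ball/=; apply: lt_le_trans xy _.
  rewrite /mesh mulrA ler_pdivrMr// [r * _]mulrC -ler_pdivrMr//.
  exact/ltW/truncnS_gt.
have mesh_nd n m : (n <= m)%N -> mesh m <= mesh n.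
  move=> nm; rewrite ler_wpM2l// ?subr_ge0 ?(ltW ab)// lef_pV2 ?posrE ?ltr0n// ler_nat ltnS//.
have Wnd : nondecreasing_seq W.
  move=> n m nm; apply/subsetPset => x [xab xU]; split => // y xy; apply: xU.
  by rewrite (lt_le_trans xy)// ler_pM2l// mesh_nd.
have cvgW : (muF (W n) @[n --> \oo] --> muF (U `&` `]a, b]))%E.
  rewrite -WU; apply: nondecreasing_cvg_mu => //.
  by apply: bigcup_measurable => k _; exact: mW.
rewrite -(cvg_lim _ cvgW)//; apply: lime_le; first by apply/cvg_ex; eexists; exact: cvgW.
near=> n.
pose P (k : 'I_n.+1) := `[< cell n k `<=` U >].
have cE (G : cumulative R R) (k : nat) :
    lebesgue_stieltjes_measure G (cell n k) = (G (pt n k.+1) - G (pt n k))%:E.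
  by rewrite /cell LS_itv// pt_le.
have cU (G : cumulative R R) :
    lebesgue_stieltjes_measure G (\big[setU/set0]_(k < n.+1 | P k) cell n k) =
    (\sum_(k < n.+1 | P k) (G (pt n k.+1) - G (pt n k)))%:E.
  rewrite measure_bigsetU_ord_cond//; last exact: cell_trivIset; first by rewrite -sumEFin; apply: eq_bigr => k _; exact: cE.
  by move=> k _; exact: measurable_itv.
apply: (@le_trans _ _ (muF (\big[setU/set0]_(k < n.+1 | P k) cell n k))).
  have mC : measurable (\big[setU/set0]_(k < n.+1 | P k) cell n k).
    by apply: bigsetU_measurable => k _; exact: measurable_itv.
  apply: le_measure; [by rewrite inE; exact: mW|by rewrite inE; exact: mC|].
  move=> x [xab xU]; have [k kx] := cell_cover n xab.
  have Pk : P k.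
    apply/asboolP => y ky; apply: xU; move: kx ky; rewrite /cell/= !in_itv/=.
    move=> /andP[k1 k2] /andP[k3 k4].
    have E : pt n k.+1 = pt n k + mesh n by rewrite /pt -natr1; ring.
    have m0 := mesh_gt0 n; rewrite E in k2 k4.
    by rewrite ltr_norml; apply/andP; split; lra.
  by rewrite (bigD1 k)//=; left.
rewrite cU lee_fin.
pose s := [seq (pt n (val k), pt n (val k).+1) | k <- enum 'I_n.+1 & P k].
have -> : \sum_(k < n.+1 | P k) (F (pt n k.+1) - F (pt n k)) = \sum_(p <- s) (F p.2 - F p.1).
  by rewrite /s big_map big_filter big_enum_cond.
apply: H.
  rewrite /admissible_itvs /s all_map; apply/andP; split.
    apply/allP => k _ /=; rewrite -{1}(pt0 n) -(pt_max n) !pt_le//.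
  rewrite pairwise_map; apply: (subseq_pairwise (filter_subseq _ _)).
  have : pairwise ltn (map val (enum 'I_n.+1)) by rewrite val_enum_ord -sorted_pairwise ?iota_ltn_sorted//; exact: ltn_trans.
  by rewrite pairwise_map; apply: sub_pairwise => i j /= ij; exact: pt_le.
rewrite -lte_fin; apply: le_lt_trans Ud.
have cUid : lam (\big[setU/set0]_(k < n.+1 | P k) cell n k) =
  (\sum_(k < n.+1 | P k) (pt n k.+1 - pt n k))%:E := cU idfun.
apply: (@le_trans _ _ (lam (\big[setU/set0]_(k < n.+1 | P k) cell n k))).
  by rewrite cUid lee_fin /s big_map big_filter big_enum_cond.
apply: le_measure.
- apply/mem_set/bigsetU_measurable => k _; exact: measurable_itv.
- by apply/mem_set; exact: (open_measurable oU).
- elim/big_ind : _ => [x //|A B AU BU x [/AU|/BU]//|k /asboolP//].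
Unshelve. all: by end_near. Qed.

End mono_ac.

Section density.
Context {R : realType}.
Variables (a b : R) (F : R -> R).
Hypothesis ab : a < b.
Hypothesis ndF : {homo F : x y / x <= y}.
Hypothesis cF : continuous F.
Hypothesis acF : forall e, 0 < e -> exists2 d, 0 < d &
  forall s, admissible_itvs a b s -> \sum_(p <- s) (p.2 - p.1) < d ->
    \sum_(p <- s) (F p.2 - F p.1) <= e.

Local Notation lam := (@lebesgue_measure R).
Local Notation muF := (lebesgue_stieltjes_measure (cumF ndF cF)).

Lemma muF_fin : (muF `]a, b]%classic < +oo)%E.
Proof. by rewrite LS_itv ?ltry// ltW. Qed.

(** By outer regularity a null set is contained in open sets of arbitrarily
    small length, to which [muF_open_le] applies. *)
Lemma muF_dominated A : measurable A -> lam A = 0%E -> muF (A `&` `]a, b]) = 0%E.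
Proof.
move=> mA A0; apply/eqP; rewrite eq_le measure_ge0 andbT.
apply/lee_addgt0Pr => e e0; rewrite add0e.
have [d d0 Hd] := muF_open_le ab ndF cF acF e0.
have Afin : (lam A < +oo)%E by rewrite A0.
have [U [oU AU Ud]] := lebesgue_regularity_outer mA Afin d0.
have mU : measurable U by exact: open_measurable.
have lU : (lam U < d%:E)%E.
  rewrite (_ : U = (U `\` A) `|` A); last by rewrite setUC setDUK.
  apply: (@le_lt_trans _ _ (lam (U `\` A) + lam A)%E).
    by apply: measureU2 => //; exact: measurableD.
  by rewrite A0 adde0.
apply: le_trans (Hd U oU lU); apply: le_measure.
- by rewrite inE; apply: measurableI.
- by rewrite inE; apply: measurableI.
- exact: setSI.
Qed.

Lemma density_ex : exists g : R -> R, [/\ (forall x, 0 <= g x),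
  lam.-integrable setT (EFin \o g) &
  forall x, a <= x <= b -> F x - F a = \int[lam]_(t in `]a, x]) g t].
Proof.
pose nu : {finite_measure set (measurableTypeR R) -> \bar R} := @mfrestr _ (measurableTypeR R) R `]a, b]%classic muF (measurable_itv `]a, b]) muF_fin.
have dom : nu `<< lam.
  apply/null_content_dominatesP => A mA A0; exact: muF_dominated.
have [f [f0 ffin fint fE]] := radon_nikodym_sigma_finite dom.
exists (fine \o f); split.
- by move=> x; exact: fine_ge0.
- by rewrite (_ : EFin \o _ = f)//; apply/funext => x /=; rewrite fineK.
- move=> x /andP[ax xb].
  have := fE `]a, x]%classic (measurable_itv _).
  rewrite /nu /= /mfrestr /mrestr.
  rewrite (_ : `]a, x]%classic `&` `]a, b]%classic = `]a, x]%classic); last first.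
    apply/seteqP; split => [y []//|y]; rewrite /= !in_itv/= => /andP[ay yx].
    by rewrite ay yx (le_trans yx).
  rewrite LS_itv// => E; rewrite /Rintegral -[LHS]/(fine (F x - F a)%:E) E.
  by congr fine; apply: eq_integral => y _; rewrite /= fineK.
Qed.

End density.

(** * The fundamental theorem of calculus for absolutely continuous functions *)
Section ac_ftc.
Context {R : realType}.
Variables (a b : R).
Hypothesis ab : a < b.
Local Notation lam := (@lebesgue_measure R).

(** Freezing a function outside [a, b] extends its monotonicity or continuity to
    the whole line. *)
Definition clamp (x : R) : R := Num.max a (Num.min x b).

Lemma clamp_itv x : a <= clamp x <= b.
Proof. by rewrite /clamp le_max lexx/= ge_max (ltW ab)/= ge_min lexx orbT. Qed.

Lemma clamp_id x : a <= x <= b -> clamp x = x.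
Proof. by move=> /andP[ax xb]; rewrite /clamp min_l// max_r. Qed.

Lemma clamp_nd : {homo clamp : x y / x <= y}.
Proof.
move=> x y xy; rewrite /clamp ge_max le_max lexx/= le_max; apply/orP; right.
by rewrite le_min !ge_min xy lexx/= orbT.
Qed.

Lemma clamp_dist x y : `|clamp x - clamp y| <= `|x - y|.
Proof.
wlog xy : x y / x <= y.
  move=> H; have [/H//|/ltW/H] := leP x y.
  by rewrite distrC [leRHS]distrC.
rewrite ler0_norm ?subr_le0 ?clamp_nd// ler0_norm ?subr_le0// !opprB.
have d0 : 0 <= y - x by rewrite subr_ge0.
rewrite lerBlDr /clamp addr_maxr addr_minr subrK ge_max !le_max lerDr d0/=.
apply/orP; right; rewrite le_min !ge_min lexx/=; apply/orP; right.
by rewrite lerDr.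
Qed.

Lemma nd_ac_density (F : R -> R) :
  (forall p q, a <= p -> p <= q -> q <= b -> F p <= F q) ->
  (forall e, 0 < e -> exists2 d, 0 < d &
    forall s, admissible_itvs a b s -> \sum_(p <- s) (p.2 - p.1) < d ->
    \sum_(p <- s) (F p.2 - F p.1) <= e) ->
  exists g : R -> R, lam.-integrable setT (EFin \o g) /\
    forall x, a <= x <= b -> F x - F a = \int[lam]_(t in `]a, x]) g t.
Proof.
move=> nd ac; pose G x := F (clamp x).
have ndG : {homo G : x y / x <= y}.
  move=> x y xy; have /andP[h1 h2] := clamp_itv x; have /andP[h3 h4] := clamp_itv y.
  by apply: nd => //; exact: clamp_nd.
have GE x : a <= x <= b -> G x = F x by move=> h; rewrite /G clamp_id.
have cG : continuous G.
  move=> x; apply/cvgrPdist_le => e e0.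
  have [d d0 Hd] := ac e e0.
  suff key y z : `|y - z| < d -> `|G y - G z| <= e.
    by near=> y; apply: key; near: y; exact: cvgr_dist_lt.
  wlog yz : y z / y <= z.
    move=> H; have [/H//|/ltW/H] := leP y z.
    by move=> {}H; rewrite distrC => /H; rewrite distrC.
  move=> yd; rewrite ler0_norm ?subr_le0 ?ndG// opprB.
  have /andP[h1 h2] := clamp_itv y; have /andP[h3 h4] := clamp_itv z.
  have := Hd [:: (clamp y, clamp z)]; rewrite !big_seq1/=; apply.
    by rewrite /admissible_itvs/= h1 h4 clamp_nd.
  by rewrite (le_lt_trans (ler_norm _))// (le_lt_trans (clamp_dist z y))// distrC.
have acG e : 0 < e -> exists2 d, 0 < d &
    forall s, admissible_itvs a b s -> \sum_(p <- s) (p.2 - p.1) < d ->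
    \sum_(p <- s) (G p.2 - G p.1) <= e.
  move=> /ac[d d0 H]; exists d => // s adm len.
  have := H s adm len; congr (_ <= _); rewrite big_seq [RHS]big_seq; apply: eq_bigr => p ps.
  move/andP: adm => [/allP/(_ p ps)/and3P[p1 p2 p3] _].
  by rewrite !GE// ?p1 ?p3 ?(le_trans p1 p2) ?(le_trans p2 p3).
have [g [g0 gi gE]] := density_ex ab ndG cG acG.
exists g; split => // x xab; rewrite -gE// !GE// lexx ltW//.
Unshelve. all: by end_near. Qed.

(** The total variation and its difference with f are both nondecreasing, and
    both inherit absolute continuity. *)
Lemma ac_integral (f : R -> R) : absolutely_continuous a b f ->
  exists g : R -> R, lam.-integrable setT (EFin \o g) /\
    forall x, a <= x <= b -> f x - f a = \int[lam]_(t in `]a, x]) g t.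
Proof.
move=> acf.
have [g1 [i1 E1]] : exists g : R -> R, lam.-integrable setT (EFin \o g) /\
    forall x, a <= x <= b -> tvar a f x - tvar a f a = \int[lam]_(t in `]a, x]) g t.
  apply: nd_ac_density; last exact: tvar_ac.
  move=> p q ap pq qb; rewrite -subr_ge0.
  exact: le_trans (normr_ge0 _) (tvar_nd ab acf ap pq qb).
have [g2 [i2 E2]] : exists g : R -> R, lam.-integrable setT (EFin \o g) /\
    forall x, a <= x <= b -> (tvar a f x - f x) - (tvar a f a - f a) = \int[lam]_(t in `]a, x]) g t.
  apply: (@nd_ac_density (fun x => tvar a f x - f x)).
    move=> p q ap pq qb.
    by have := tvar_nd ab acf ap pq qb; rewrite ler_norml => /andP[_ h]; lra.
  move=> e e0.
  have e20 : 0 < e / 2 by rewrite divr_gt0.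
  have [d1 d10 H1] := tvar_ac ab acf e20; have [d2 d20 H2] := acf _ e20.
  exists (Num.min d1 d2); first by rewrite lt_min d10.
  move=> s adm; rewrite lt_min => /andP[l1 l2].
  have A1 := H1 s adm l1; have A2 := ltW (H2 s (andP adm).1 (andP adm).2 l2).
  rewrite (splitr e); apply: le_trans (lerD A1 A2); rewrite -big_split/=.
  apply: ler_sum => p _.
  by have := ler_norm (- (f p.2 - f p.1)); rewrite normrN => h; lra.
exists (fun x => g1 x - g2 x).
have i12 (x : R) : lam.-integrable `]a, x] (EFin \o g1) /\ lam.-integrable `]a, x] (EFin \o g2).
  by split; [apply: integrableS i1|apply: integrableS i2].
split; first by exact: (integrableB measurableT i1 i2).
move=> x xab.
rewrite RintegralB//; [|exact: (i12 x).1|exact: (i12 x).2].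
by rewrite -E1// -E2//; ring.
Qed.

(** The derivative statement is Lebesgue differentiation of the indefinite
    integral of the density. *)
Lemma ac_ftc (f : R -> R) : absolutely_continuous a b f ->
  exists g : R -> R, [/\ lam.-integrable setT (EFin \o g),
    (forall x, a <= x <= b -> f x - f a = \int[lam]_(t in `]a, x]) g t) &
    {ae lam, forall x, a < x < b -> derive1 f x = g x}].
Proof.
move=> /ac_integral[g [ig gE]]; exists g; split => //.
have ig' y : lam.-integrable [set` Interval (BRight a) (BRight y)] (EFin \o g).
  exact: integrableS ig.
have lg : locally_integrable setT g.
  split.
  - by have /measurable_int/measurable_EFinP := ig.
  - exact: openT.
  - move=> K _ cK.
    have mK : measurable (K : set (measurableTypeR R)) by exact: compact_measurable.
    by have /integrableP[_] := integrableS measurableT mK (@subsetT _ K) ig.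
have := FTC1 ig' lg; apply: filterS; first exact: (ae_filter_ringOfSetsType lam).
move=> x H /andP[ax xb].
have [] := H; first by [].
move=> dF <-; rewrite !derive1E.
have E : \near x, (fun y => f y - f a) x = (fun y => \int[lam]_(t in `]a, y]) g t) x.
  near=> y; rewrite gE//; apply/andP; split.
    by apply/ltW; near: y; exact: lt_nbhsr.
  by apply/ltW; near: y; exact: lt_nbhsl.
rewrite -(near_eq_derive _ E).
have df' : derivable (fun y => f y - f a) x 1.
  apply: near_eq_derivable dF; move: E; apply: filterS => y /= /esym //.
have df : derivable f x 1.
  rewrite (_ : f = fun y => (f y - f a) + f a); last by apply/funext => y; rewrite subrK.
  by apply: derivableD => //; exact: derivable_cst.
rewrite (_ : (fun y => f y - f a) = f - cst (f a))// deriveB// ?derive_cst ?subr0//.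
Unshelve. all: by end_near. Qed.

End ac_ftc.

(** * Translations, the power kernel and the Gamma function *)
Section lebesgue_facts.
Context {R : realType}.
Local Notation lam := (@lebesgue_measure R).
Local Open Scope ereal_scope.

Lemma measurable_shift (c : R) :
  measurable_fun [set: R] (fun x : R => (x - c)%R).
Proof. by apply: measurable_funB => //; exact: measurable_cst. Qed.

(** Both sides agree on intervals, and this determines the measure. *)
Lemma lebesgue_shift (c : R) (A : set R) : measurable A ->
  lam ((fun x : R => (x - c)%R) @^-1` A) = lam A.
Proof.
move=> mA; have mS : measurable_fun [set: measurableTypeR R] (fun x : measurableTypeR R => (x - c)%R : measurableTypeR R).
  exact: measurable_shift.
pose nu : {measure set (measurableTypeR R) -> \bar R} := measure_function_pushforward__canonical__measure_function_Measure lam mS.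
rewrite -[LHS]/(nu A); apply/esym; apply: (lebesgue_measure_unique (mu := nu)) => // X /ocitvP[->|[[p q] /= pq ->]].
  by rewrite !measure0.
rewrite /nu /= /pushforward /=.
rewrite (_ : _ @^-1` _ = `](p + c)%R, (q + c)%R]%classic); last first.
  by apply/seteqP; split => x; rewrite /= !in_itv/= ltrBrDr lerBlDr.
by rewrite !lebesgue_measure_itv/= !lte_fin ltrD2r pq -!EFinB; congr EFin; ring.
Qed.

Lemma ge0_integral_shift (f : R -> \bar R) (c : R) :
  measurable_fun [set: R] f -> (forall x, 0 <= f x) ->
  \int[lam]_x f (x - c)%R = \int[lam]_x f x.
Proof.
move=> mf f0.
have mS : measurable_fun [set: measurableTypeR R] (fun x : measurableTypeR R => (x - c)%R : measurableTypeR R).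
  exact: measurable_shift.
have := @ge0_integral_pushforward _ _ (measurableTypeR R) (measurableTypeR R) R _ mS lam setT f.
move=> <- //.
by apply: eq_measure_integral => A mA _; exact: lebesgue_shift.
Qed.

Definition power_kernel (gam b : R) (r : R) : R :=
  if ((0 < r) && (r <= b))%R then ((r `^ gam)^-1)%R else 0%R.

Lemma power_kernel_ge0 gam b r : (0 <= power_kernel gam b r)%R.
Proof. by rewrite /power_kernel; case: ifP => // _; rewrite invr_ge0 powR_ge0. Qed.

Lemma measurable_power_kernel gam b : measurable_fun [set: R] (power_kernel gam b).
Proof.
apply: measurable_fun_if => //.
  by apply: measurable_and => //; [apply: measurable_fun_ltr|apply: measurable_fun_ler].
rewrite (_ : (fun x => _) = (fun x => x `^ (- gam))%R).
  by apply: measurable_funTS; exact: measurable_powR.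
by apply/funext => x; rewrite powRN.
Qed.

(** Monotone convergence over the intervals [1 / (i + 1), b], on which the kernel
    has the primitive r^(1 - gam) / (1 - gam). *)
Lemma power_kernel_int_lty gam b : (0 < gam)%R -> (gam < 1)%R -> (0 < b)%R ->
  \int[lam]_r (power_kernel gam b r)%:E < +oo.
Proof.
move=> g0 g1 b0.
pose F i := `[(i.+1%:R^-1)%R, b]%classic.
have FE : \bigcup_i F i = `]0%R, b]%classic.
  apply/seteqP; split => [x [i _]|x]; rewrite /F /= !in_itv/= => /andP[h1 h2].
    by rewrite h2 andbT (lt_le_trans _ h1).
  exists (Num.trunc x^-1) => //; rewrite /= in_itv/= h2 andbT.
  by rewrite invf_ple ?posrE//; exact/ltW/truncnS_gt.
have -> : \int[lam]_r (power_kernel gam b r)%:E = \int[lam]_(r in \bigcup_i F i) (power_kernel gam b r)%:E.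
  rewrite FE [RHS]integral_mkcond; apply: eq_integral => x _.
  rewrite patchE; case: ifPn => //; rewrite notin_setE /= in_itv/= /power_kernel => /negP/negbTE -> //.
have mF i : measurable (F i) by exact: measurable_itv.
have mk D : measurable_fun D (fun r : R => (power_kernel gam b r)%:E).
  by apply/measurable_EFinP; apply: measurable_funTS; exact: measurable_power_kernel.
have ndF : nondecreasing_seq F.
  move=> n m nm; apply/subsetPset; apply: subset_itvr.
  by rewrite bnd_simp lef_pV2 ?posrE ?ltr0n// ler_nat.
have H : \int[lam]_(x in F i) (power_kernel gam b x)%:E @[i --> \oo] -->
   \int[lam]_(x in \bigcup_i F i) (power_kernel gam b x)%:E.
  apply: ge0_nondecreasing_set_cvg_integral; [exact: ndF|exact: mF|by move=> i; exact: mk|].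
  by move=> i x _; rewrite lee_fin power_kernel_ge0.
rewrite -(cvg_lim _ H)//.
apply: (@le_lt_trans _ _ ((b `^ (1 - gam)) / (1 - gam))%R%:E); last exact: ltry.
apply: lime_le; first by apply/cvg_ex; eexists; exact: H.
near=> i.
have [bi|ib] := leP b (i.+1%:R^-1)%R.
  have Fb : F i `<=` [set b].
    by move=> x; rewrite /F/= in_itv/= => /andP[h1 h2]; apply/le_anti; rewrite h2 (le_trans bi h1).
  apply: (@le_trans _ _ (\int[lam]_(x in [set b]) (power_kernel gam b x)%:E)).
    apply: ge0_subset_integral; [exact: mF|exact: measurable_set1|exact: mk| |exact: Fb].
    by move=> x _; rewrite lee_fin power_kernel_ge0.
  by rewrite integral_set1 lee_fin divr_ge0 ?powR_ge0// subr_ge0 ltW.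
have i0 : (0 < i.+1%:R^-1 :> R)%R by [].
pose P (r : R) := (r `^ (1 - gam) / (1 - gam))%R.
have dP (r : R) : (0 < r)%R -> is_derive r (1%R:R) P (r `^ (- gam))%R.
  move=> r0; apply: is_derive_congr (is_deriveM (is_derive1_powR (1 - gam) r0) (is_derive_cst (1 - gam)^-1%R r 1%R)) _ _ => //.
  rewrite /GRing.scale/= mulr0 add0r mulrA mulVf ?mul1r ?subr_eq0 ?gt_eqF//.
  by congr (_ `^ _)%R; ring.
have cP (r : R) : (0 < r)%R -> {for r, continuous P}.
  move=> r0; apply: differentiable_continuous; apply/derivable1_diffP.
  by have [] := dP r r0.
have -> : \int[lam]_(x in F i) (power_kernel gam b x)%:E = \int[lam]_(x in F i) (x `^ (- gam))%:E.
  apply: eq_integral => x; rewrite inE /F /= in_itv/= => /andP[h1 h2].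
  by rewrite /power_kernel (lt_le_trans i0 h1) h2/= powRN.
rewrite (@continuous_FTC2 _ (fun x => x `^ (- gam))%R P)//.
- rewrite -EFinB lee_fin /P lerBlDr lerDl divr_ge0 ?powR_ge0// subr_ge0 ltW//.
- apply: derivable_within_continuous => x; rewrite in_itv/= => /andP[h1 h2].
  by have [] := is_derive1_powR (- gam) (lt_le_trans i0 h1).
- split.
  + by move=> x; rewrite in_itv/= => /andP[h1 h2]; have [] := dP x (lt_trans i0 h1).
  + by apply: cvg_at_right_filter; exact: cP.
  + by apply: cvg_at_left_filter; exact: cP.
- move=> x; rewrite in_itv/= => /andP[h1 h2]; rewrite derive1E.
  by have [_ ->] := dP x (lt_trans i0 h1).
Unshelve. all: by end_near. Qed.

End lebesgue_facts.

Section gamma.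
Context {R : realType}.
Local Notation lam := (@lebesgue_measure R).

(** A real-valued integral is 0 when the integral diverges, so positivity has two
    halves: the integrand is dominated by the power kernel on ]0, 1] plus an
    exponential density, and it is at least exp(-1) on ]0, 1]. *)
Lemma Gamma_gt0 (gam : R) : 0 < gam -> gam < 1 -> 0 < Gamma (1 - gam).
Proof.
move=> g0 g1; rewrite /Gamma.
have -> : (1 - gam - 1 : R) = - gam by ring.
pose f (s : R) : R := s `^ (- gam) * expR (- s).
have f0 s : 0 <= f s by rewrite mulr_ge0 ?powR_ge0 ?expR_ge0.
have mf : measurable_fun [set: R] f.
  apply: measurable_funM; first exact: measurable_powR.
  by apply: measurableT_comp => //; exact: measurable_funN.
pose h (s : R) : R := power_kernel gam 1 s + exponential_pdf 1 s.
have mh1 : measurable_fun [set: R] (fun s : R => power_kernel gam 1 s) by exact: measurable_power_kernel.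
have mh2 : measurable_fun [set: R] (fun s : R => exponential_pdf 1 s) by exact: measurable_exponential_pdf.
have e0 s : 0 <= exponential_pdf (1:R) s by exact: exponential_pdf_ge0.
have hfin : (\int[lam]_s (h s)%:E < +oo)%E.
  under eq_integral do rewrite EFinD.
  rewrite ge0_integralD//=.
  - rewrite integral_exponential_pdf// lte_add_pinfty ?ltry//; exact: power_kernel_int_lty.
  - by move=> s _; rewrite lee_fin power_kernel_ge0.
  - exact/measurable_EFinP.
  - by move=> s _; rewrite lee_fin.
  - exact/measurable_EFinP.
have fh s : 0 < s -> f s <= h s.
  move=> s0; rewrite /h /power_kernel s0 /=.
  have [s1|s1] := leP s 1.
    rewrite -powRN -[leLHS]addr0 lerD//; rewrite /f ler_piMr ?powR_ge0//.
    by rewrite -expR0 ler_expR oppr_le0 ltW.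
  have -> : exponential_pdf 1 s = expR (- s) by rewrite exponential_pdfE ?ltW//= mul1r mulN1r.
  rewrite add0r /f ler_piMl ?expR_ge0//.
  rewrite powRN invf_le1 ?powR_gt0// -(powRr0 s) ler_powR// ltW//.
pose A : set R := `]0, +oo[%classic.
have mA : measurable A by exact: measurable_itv.
have Ifin : (\int[lam]_(s in A) (f s)%:E < +oo)%E.
  apply: le_lt_trans hfin.
  apply: (@le_trans _ _ (\int[lam]_(s in A) (h s)%:E)%E).
    apply: ge0_le_integral => //.
    - by move=> s _; rewrite lee_fin.
    - by apply/measurable_EFinP; exact: measurable_funTS.
    - by apply/measurable_EFinP; apply: measurable_funTS; exact: measurable_funD.
    - by move=> s; rewrite /A/= in_itv/= andbT lee_fin; exact: fh.
  apply: ge0_subset_integral => //.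
    by apply/measurable_EFinP; exact: measurable_funD.
  by move=> s _; rewrite lee_fin addr_ge0 ?power_kernel_ge0.
pose B : set R := `]0, 1]%classic.
have mB : measurable B by exact: measurable_itv.
apply: fine_gt0; rewrite Ifin andbT.
apply: (@lt_le_trans _ _ (\int[lam]_(s in B) (expR (-1))%:E)%E).
  have lB : lam B = 1%E by rewrite /B lebesgue_measure_itv/= lte_fin ltr01 oppr0 adde0.
  rewrite integral_cst//= [X in (_ * X)%E](_ : _ = 1%E); last exact: lB.
  by rewrite mule1 lte_fin expR_gt0.
apply: (@le_trans _ _ (\int[lam]_(s in B) (f s)%:E)%E).
  apply: ge0_le_integral => //.
  - by apply/measurable_EFinP; exact: measurable_funTS.
  - move=> s; rewrite /B/= in_itv/= => /andP[s0 s1]; rewrite lee_fin /f.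
    rewrite -[leLHS]mul1r ler_pM ?expR_ge0//; last by rewrite ler_expR lerN2.
    rewrite powRN invf_ge1 ?powR_gt0// -[leRHS](powRr0 s).
    by apply: ger_powR; rewrite ?s0 ?s1// ltW.
apply: ge0_subset_integral => //.
- by apply/measurable_EFinP; exact: measurable_funTS.
- by move=> s _; rewrite lee_fin.
- by move=> s; rewrite /B/= !in_itv/= => /andP[->].
Qed.

End gamma.

(** * Positivity of the Caputo derivative *)
Section step_kernel.
Context {R : realType}.
Implicit Types (gam r rho : R) (n j : nat).

Definition level n j : R := j.+1%:R / n.+1%:R.
(** For r > 0 each summand is the indicator of r <= rho for some radius rho, and
    the sum rounds r^-gam down to a multiple of 1 / (n + 1), capped at n + 1.
    Positivity against the kernel r^-gam thus reduces to positivity against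
    indicators. *)
Definition skernel gam n r : R :=
  n.+1%:R^-1 * \sum_(j < n.+1 * n.+1) (level n j <= (r `^ gam)^-1)%R%:R.

(** The number of levels below a value is the integer part of its multiple by
    n + 1, capped by the number of all levels. *)
Lemma skernelE gam n r :
  skernel gam n r = (minn (n.+1 * n.+1) (Num.trunc (n.+1%:R * (r `^ gam)^-1)))%:R / n.+1%:R.
Proof.
rewrite /skernel mulrC; congr (_ / _).
set N := Num.trunc _.
have -> : \sum_(j < n.+1 * n.+1) (level n j <= (r `^ gam)^-1)%R%:R =
    (\sum_(j < n.+1 * n.+1) nat_of_bool (j < N))%N%:R :> R.
  rewrite natr_sum; apply: eq_bigr => j _; congr ((nat_of_bool _)%:R).
  by rewrite /N truncn_gt_nat /level ler_pdivrMr ?ltr0n// mulrC.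
congr (_%:R).
elim: (n.+1 * n.+1)%N => [|m IH]; first by rewrite big_ord0 min0n.
rewrite big_ord_recr/= IH; case: (ltnP m N) => h.
  by rewrite (minn_idPl h) addn1.
by rewrite addn0 (minn_idPr _)// (leq_trans h).
Qed.

Lemma skernel_ge0 gam n r : 0 <= skernel gam n r.
Proof. by rewrite skernelE divr_ge0. Qed.

Lemma skernel_le gam n r : skernel gam n r <= (r `^ gam)^-1.
Proof.
rewrite skernelE ler_pdivrMr ?ltr0n//.
have K0 : 0 <= n.+1%:R * (r `^ gam)^-1 :> R by rewrite mulr_ge0 ?invr_ge0 ?powR_ge0.
apply: (@le_trans _ _ (Num.trunc (n.+1%:R * (r `^ gam)^-1))%:R).
  by rewrite ler_nat geq_minr.
by rewrite mulrC truncn_le mulrC.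
Qed.

Lemma skernel_ge gam n r : (r `^ gam)^-1 <= n.+1%:R ->
  (r `^ gam)^-1 - n.+1%:R^-1 <= skernel gam n r.
Proof.
move=> Kn; rewrite skernelE lerBlDr -[X in _ + X]mul1r -mulrDl ler_pdivlMr ?ltr0n//.
have K0 : 0 <= n.+1%:R * (r `^ gam)^-1 :> R by rewrite mulr_ge0 ?invr_ge0 ?powR_ge0.
have h : (Num.trunc (n.+1%:R * (r `^ gam)^-1) <= n.+1 * n.+1)%N.
  by rewrite -(ler_nat R) natrM (le_trans (_ : _ <= n.+1%:R * (r `^ gam)^-1))// ?truncn_le// ler_pM2l ?ltr0n.
by rewrite (minn_idPr h) natr1 mulrC; have /andP[_ /ltW] := truncn_itv K0.
Qed.

Lemma skernel_cvg gam r : skernel gam n r @[n --> \oo] --> (r `^ gam)^-1.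
Proof.
apply/cvgrPdist_le => e e0; near=> n.
rewrite ger0_norm ?subr_ge0 ?skernel_le// lerBlDr -lerBlDl.
apply: le_trans (skernel_ge _); last first.
  near: n; exists (Num.trunc (r `^ gam)^-1) => // n /= hn.
  apply/ltW/(lt_le_trans (truncnS_gt _)); by rewrite ler_nat ltnS.
rewrite lerD2l lerN2; near: n; exists (Num.trunc e^-1) => // n /= hn.
rewrite invf_ple ?posrE//; apply/ltW/(lt_le_trans (truncnS_gt _)).
by rewrite ler_nat ltnS.
Unshelve. all: by end_near. Qed.

Definition radius_of gam n j : R := ((level n j)^-1) `^ gam^-1.

Lemma level_radius gam n j r : 0 < gam -> 0 < r ->
  (level n j <= (r `^ gam)^-1) = (r <= radius_of gam n j).
Proof.
move=> g0 r0.
have l0 : 0 < level n j by rewrite divr_gt0.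
rewrite -[level n j]invrK lef_pV2 ?posrE ?invr_gt0 ?powR_gt0//.
rewrite /radius_of; set c := (level n j)^-1.
have c0 : 0 < c by rewrite invr_gt0.
have cE : c = (c `^ gam^-1) `^ gam by rewrite -powRrM mulVf ?gt_eqF// powRr1// ltW.
apply/idP/idP => [|h].
  rewrite {1}cE => h; rewrite leNgt; apply/negP => /(gt0_ltr_powR g0).
  by rewrite nnegrE powR_ge0 nnegrE ltW// => /(_ isT isT); rewrite ltNge h.
by rewrite [leRHS]cE; apply: ge0_ler_powR => //; rewrite ?nnegrE ?powR_ge0 ?ltW.
Qed.

Lemma radius_gt0 gam n j : 0 < radius_of gam n j.
Proof. by rewrite powR_gt0// invr_gt0 divr_gt0. Qed.

End step_kernel.

Section convolution.
Context {R : realType}.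
Local Notation lam := (@lebesgue_measure R).
Local Open Scope ereal_scope.

(** Tonelli's theorem and translation invariance. *)
Lemma convolution_integrable (a phi : measurableTypeR R -> R) :
  measurable_fun [set: measurableTypeR R] a -> measurable_fun [set: measurableTypeR R] phi ->
  (forall x, 0 <= a x)%R -> (forall x, 0 <= phi x)%R ->
  \int[lam]_x (a x)%:E < +oo -> \int[lam]_x (phi x)%:E < +oo ->
  lam.-integrable setT (fun t : measurableTypeR R => \int[lam]_x (a x * phi (t - x)%R)%:E).
Proof.
move=> ma mphi a0 phi0 aoo phioo.
pose f (z : measurableTypeR R * measurableTypeR R) := (a z.2 * phi (z.1 - z.2)%R)%:E.
have mf : measurable_fun [set: measurableTypeR R * measurableTypeR R] f.
  apply/measurable_EFinP; apply: measurable_funM.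
    by apply: measurableT_comp => //; exact: measurable_snd.
  apply: (@measurableT_comp _ _ _ _ _ _ phi _ (fun z : measurableTypeR R * measurableTypeR R => (z.1 - z.2)%R)) => //.
  by apply: measurable_funB; [exact: measurable_fst|exact: measurable_snd].
have f0 z : 0 <= f z by rewrite lee_fin mulr_ge0.
have F0 t : 0 <= \int[lam]_x (a x * phi (t - x)%R)%:E.
  by apply: integral_ge0 => x _; rewrite lee_fin mulr_ge0.
apply/integrableP; split.
  exact: (measurable_fun_fubini_tonelli_F f mf f0).
under eq_integral do rewrite gee0_abs//.
rewrite -[X in X < _]/(\int[lam]_t \int[lam]_x f (t, x)).
rewrite (fubini_tonelli f mf f0) /f /=.
have E x : \int[lam]_t (a x * phi (t - x)%R)%:E = (\int[lam]_t (phi t)%:E) * (a x)%:E.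
  under eq_integral do rewrite EFinM.
  rewrite ge0_integralZl//; last 3 first.
  - apply/measurable_EFinP; apply: measurableT_comp => //; exact: measurable_shift.
  - by move=> t _; rewrite lee_fin.
  - by rewrite lee_fin.
  rewrite muleC; congr (_ * _).
  apply: (ge0_integral_shift (f := fun t => (phi t)%:E)); last by move=> t; rewrite lee_fin.
  by apply/measurable_EFinP.
under eq_integral do rewrite E.
rewrite ge0_integralZl//; last 3 first.
- exact/measurable_EFinP.
- by move=> x _; rewrite lee_fin.
- by apply: integral_ge0 => x _; rewrite lee_fin.
have p0 : 0 <= \int[lam]_t (phi t)%:E by apply: integral_ge0 => x _; rewrite lee_fin.
by apply: lte_mul_pinfty => //; rewrite ge0_fin_numE.
Qed.

End convolution.

Section time_energy.
Context {R : realType}.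
Local Notation lam := (@lebesgue_measure R).

Lemma Rintegral_sum (D : set R) n (F : 'I_n -> R -> R) : measurable D ->
  (forall j, lam.-integrable D (EFin \o F j)) ->
  lam.-integrable D (EFin \o (fun x => \sum_j F j x)) /\
  \int[lam]_(x in D) (\sum_j F j x) = \sum_j \int[lam]_(x in D) F j x.
Proof.
move=> mD; elim: n F => [|n IH] F iF.
  rewrite (_ : (fun x => _) = cst 0); last by apply/funext => x; rewrite big_ord0.
  split; first exact: integrable0.
  by rewrite big_ord0 /Rintegral integral0.
have [i1 E1] := IH (fun j => F (lift ord0 j)) (fun j => iF _).
rewrite (_ : (fun x => _) = (fun x => F ord0 x + \sum_j F (lift ord0 j) x)); last first.
  by apply/funext => x; rewrite big_ord_recl.
split; first by apply: (integrableD _ (iF ord0) i1).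
by rewrite RintegralD// E1 big_ord_recl.
Qed.

Variables (T gam : R) (g w Dc : R -> R).
Hypotheses (T0 : 0 < T) (gam0 : 0 < gam) (gam1 : gam < 1).
Hypothesis ig : lam.-integrable setT (EFin \o g).
Hypothesis cw : continuous w.
Hypothesis w0 : forall x, x <= 0 -> w x = 0.
Hypothesis wE : forall x, 0 <= x <= T -> w x = \int[lam]_(t in `]0, x]) g t.

Lemma measurable_density : measurable_fun [set: R] g.
Proof. by have /measurable_int/measurable_EFinP := ig. Qed.

Lemma integrable_density (D : set R) : measurable D -> lam.-integrable D (EFin \o g).
Proof. by move=> mD; apply: integrableS ig. Qed.

(** The indicator kernel turns the convolution with g = w' into the increment of
    w over a window of length rho, w being 0 at negative times. *)
Lemma window_integral t rho : 0 < t <= T -> 0 < rho ->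
  lam.-integrable `]0, t[ (EFin \o (fun x => g x * (t - x <= rho)%R%:R)) /\
  \int[lam]_(x in `]0, t[) (g x * (t - x <= rho)%R%:R) = w t - w (t - rho).
Proof.
move=> /andP[t0 tT] r0.
pose P : set R := `[t - rho, +oo[%classic.
have mP : measurable P by exact: measurable_itv.
have E : (fun x => g x * (t - x <= rho)%R%:R) = g \_ P.
  apply/funext => x; rewrite patchE /P; case: ifPn; rewrite ?inE ?notin_setE/= in_itv/= andbT.
    by rewrite lerBlDr addrC -lerBlDr => ->; rewrite mulr1.
  by rewrite lerBlDr addrC -lerBlDr => /negP/negbTE ->; rewrite mulr0.
rewrite E; split.
  apply: le_integrable (integrable_density (measurable_itv `]0, t[)) => //.
    apply/measurable_EFinP; apply: measurable_funTS.
    apply/(measurable_restrictT _ mP); apply: measurable_funTS; exact: measurable_density.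
  by move=> x _; rewrite /= lee_fin patchE; case: ifPn => // _; rewrite normr0.
rewrite -Rintegral_mkcondr.
have [tr|tr] := leP (t - rho) 0.
  rewrite (_ : `]0, t[%classic `&` P = `]0, t[%classic); last first.
    apply/setIidPl => x; rewrite /P/= !in_itv/= => /andP[x0 _]; rewrite andbT.
    exact: le_trans tr (ltW x0).
  rewrite (w0 tr) subr0 wE ?(ltW t0)// Rintegral_itv_bndo_bndc//; exact: integrable_density.
rewrite (_ : `]0, t[%classic `&` P = `[t - rho, t[%classic); last first.
  apply/seteqP; split => x; rewrite /P/= !in_itv/= ?andbT.
    by move=> [/andP[_ ->] ->].
  by move=> /andP[h ->]; rewrite h (lt_le_trans tr h).
rewrite Rintegral_itv_bndo_bndc; last exact: integrable_density.
rewrite -Rintegral_itv_obnd_cbnd; last exact: integrable_density.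
have trt : t - rho <= t by rewrite gerBl ltW.
rewrite !wE ?(ltW t0) ?(ltW tr) ?(le_trans trt)//.
rewrite Rintegral_itvB//; first exact: integrable_density.
  by rewrite bnd_simp ltW.
Qed.

Definition Dstep n t : R :=
  n.+1%:R^-1 * \sum_(j < n.+1 * n.+1) (w t - w (t - radius_of gam n j)).

Lemma Dstep_integral n t : 0 < t <= T ->
  lam.-integrable `]0, t[ (EFin \o (fun x => g x * skernel gam n (t - x))) /\
  Dstep n t = \int[lam]_(x in `]0, t[) (g x * skernel gam n (t - x)).
Proof.
move=> tT.
pose F (j : 'I_(n.+1 * n.+1)) x := g x * (t - x <= radius_of gam n j)%R%:R.
have mD : measurable (`]0, t[%classic : set R) by exact: measurable_itv.
have [iF EF] := @Rintegral_sum _ _ F mD (fun j => (window_integral tT (radius_gt0 gam n j)).1).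
have E : {in `]0, t[%classic, (fun x => g x * skernel gam n (t - x)) =1
     (fun x => n.+1%:R^-1 * \sum_j F j x)}.
  move=> x; rewrite inE/= in_itv/= => /andP[x0 xt].
  rewrite /skernel mulrCA; congr (_ * _); rewrite mulr_sumr; apply: eq_bigr => j _.
  by rewrite level_radius// subr_gt0.
split.
  have iZ : lam.-integrable `]0, t[ (EFin \o (fun x => n.+1%:R^-1 * \sum_j F j x)).
    by apply: (integrableZl _ _ iF).
  by apply: eq_integrable iZ => // x xD; rewrite /= E.
have -> : \int[lam]_(x in `]0, t[) (g x * skernel gam n (t - x)) =
    \int[lam]_(x in `]0, t[) (n.+1%:R^-1 * \sum_j F j x) by exact: eq_Rintegral.
rewrite RintegralZl// EF /Dstep; congr (_ * _).
by apply: eq_bigr => j _; rewrite /F (window_integral tT (radius_gt0 gam n j)).2.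
Qed.

Lemma continuous_integrable (f : R -> R) : continuous f ->
  lam.-integrable `]0, T] (EFin \o f).
Proof.
move=> cf.
have H : lam.-integrable `[0, T] (EFin \o f).
  by apply: continuous_compact_integrable; [exact: segment_compact|exact: continuous_subspaceT].
apply: integrableS H => //.
by move=> x; rewrite /= !in_itv/= => /andP[/ltW -> ->].
Qed.

Lemma shift_continuous rho : continuous (fun t => w (t - rho)).
Proof.
move=> t; apply: (@continuous_comp _ _ _ (fun t => t - rho) w); last exact: cw.
by apply: cvgB; [exact: cvg_id|exact: cvg_cst].
Qed.

Lemma continuousMf (f h : R -> R) : continuous f -> continuous h ->
  continuous (fun x => f x * h x).
Proof. by move=> cf ch x; exact: cvgM (cf x) (ch x). Qed.

Lemma continuousBf (f h : R -> R) : continuous f -> continuous h ->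
  continuous (fun x => f x - h x).
Proof. by move=> cf ch x; exact: cvgB (cf x) (ch x). Qed.

(** Translate the integral: only the part of w before T - rho is seen. *)
Lemma shift_square_le rho : 0 < rho ->
  \int[lam]_(t in `]0, T]) (w (t - rho) * w (t - rho)) <=
  \int[lam]_(t in `]0, T]) (w t * w t).
Proof.
move=> r0.
have c1 := continuousMf (shift_continuous (rho := rho)) (shift_continuous (rho := rho)).
have c2 := continuousMf cw cw.
rewrite /Rintegral; apply: fine_le.
- exact: integrable_fin_num (continuous_integrable c1).
- exact: integrable_fin_num (continuous_integrable c2).
pose F (r : R) : \bar R := (((fun t => w t * w t) \_ `]0, T]) r)%:E.
have mF : measurable_fun [set: R] F.
  apply/measurable_EFinP; apply/(measurable_restrictT _ _).1 => //.
  by apply: measurable_funTS; exact: continuous_measurable_fun.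
have F0 r : (0 <= F r)%E.
  by rewrite lee_fin patchE; case: ifPn => // _; exact: sqr_ge0.
pose A : set R := `]0, T]%classic.
have E2 : (\int[lam]_(t in A) (w t * w t)%:E = \int[lam]_t F t)%E.
  by rewrite integral_mkcond; apply: eq_integral => x _; rewrite /F restrict_EFin.
rewrite [leRHS]E2 -(ge0_integral_shift rho mF F0) integral_mkcond.
apply: ge0_le_integral => //.
- by move=> x _; rewrite patchE; case: ifPn => // _; rewrite lee_fin sqr_ge0.
- rewrite restrict_EFin; apply/measurable_EFinP; apply/(measurable_restrictT _ _).1 => //.
  by apply: measurable_funTS; exact: continuous_measurable_fun.
- by apply: (measurableT_comp mF); exact: measurable_shift.
- move=> x _; rewrite patchE; case: ifPn => // xT; rewrite /F lee_fin patchE; case: ifPn => //.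
  rewrite notin_setE/= in_itv/= => h; rewrite w0 ?mul0r//.
  rewrite leNgt; apply/negP => x0; apply: h; rewrite x0/=.
  by move: xT; rewrite inE/= in_itv/= => /andP[_ h]; rewrite lerBlDr (le_trans h)// lerDl ltW.
Qed.

Definition energy := \int[lam]_(t in `]0, T]) (w t * w t).

(** w (w - w(. - rho)) is half of w^2 - w(. - rho)^2 + (w - w(. - rho))^2, whose
    first two terms integrate to something nonnegative. For rho >= T the shifted
    function vanishes and the integral is the full energy. *)
Lemma shift_energy rho : 0 < rho ->
  (T <= rho)%R%:R * energy <= \int[lam]_(t in `]0, T]) (w t * (w t - w (t - rho))).
Proof.
move=> r0.
have c1 := continuousMf (shift_continuous (rho := rho)) (shift_continuous (rho := rho)).
have c2 := continuousMf cw cw.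
have c3 := continuousMf cw (continuousBf cw (shift_continuous (rho := rho))).
have [Tr|Tr] := leP T rho; rewrite ?mul1r ?mul0r.
  rewrite /energy le_eqVlt; apply/orP; left; apply/eqP; apply: eq_Rintegral => t.
  rewrite inE/= in_itv/= => /andP[t0 tT].
  by rewrite [w (t - rho)]w0 ?subr0// subr_le0 (le_trans tT).
have c4 := continuousBf c2 c1.
have c5 : continuous (fun t => 2^-1 * (w t * w t - w (t - rho) * w (t - rho))).
  by apply: continuousMf c4 => x; exact: cvg_cst.
apply: (@le_trans _ _ (\int[lam]_(t in `]0, T])
   (2^-1 * (w t * w t - w (t - rho) * w (t - rho))))).
  rewrite RintegralZl//; last exact: continuous_integrable.
  rewrite RintegralB//; [|exact: continuous_integrable..].
  by rewrite mulr_ge0// subr_ge0; exact: shift_square_le.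
apply: le_Rintegral => //; [exact: continuous_integrable..|].
move=> t _; rewrite -subr_ge0.
rewrite (_ : _ - _ = 2^-1 * (w t - w (t - rho)) ^+ 2); last by field.
by rewrite mulr_ge0// sqr_ge0.
Qed.

Lemma Dstep_continuous n : continuous (Dstep n).
Proof.
have cs m : continuous (fun t => \sum_(j < m) (w t - w (t - radius_of gam n j))).
  elim: m => [|m IH]; first by under eq_fun do rewrite big_ord0; move=> x; exact: cvg_cst.
  under eq_fun do rewrite big_ord_recr/=.
  by move=> x; apply: cvgD; [exact: IH|exact: (continuousBf cw (shift_continuous (rho := _)))].
by apply: continuousMf => //; move=> x; exact: cvg_cst.
Qed.

Lemma Dstep_energy n :
  skernel gam n T * energy <= \int[lam]_(t in `]0, T]) (w t * Dstep n t).
Proof.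
pose F (j : 'I_(n.+1 * n.+1)) t := w t * (w t - w (t - radius_of gam n j)).
have iF j : lam.-integrable `]0, T] (EFin \o F j).
  by apply: continuous_integrable; exact: continuousMf cw (continuousBf cw (shift_continuous (rho := _))).
have mD : measurable (`]0, T]%classic : set R) by exact: measurable_itv.
have [iS ES] := Rintegral_sum mD iF.
have -> : \int[lam]_(t in `]0, T]) (w t * Dstep n t) =
   \int[lam]_(t in `]0, T]) (n.+1%:R^-1 * \sum_j F j t).
  by apply: eq_Rintegral => t _; rewrite /Dstep mulrCA mulr_sumr.
rewrite RintegralZl// ES /skernel -mulrA ler_pM2l ?invr_gt0// mulr_suml.
apply: ler_sum => j _; rewrite level_radius//; exact: shift_energy (radius_gt0 gam n j).
Qed.

Hypothesis idk : forall t, 0 < t <= T ->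
  lam.-integrable `]0, t[ (EFin \o (fun x => g x / (t - x) `^ gam)).
Hypothesis cD : {within `[0, T], continuous Dc}.
Hypothesis DE : forall t, 0 < t <= T ->
  Dc t = \int[lam]_(x in `]0, t[) (g x / (t - x) `^ gam).

Lemma Dstep_cvg t : 0 < t <= T -> Dstep n t @[n --> \oo] --> Dc t.
Proof.
move=> tT; rewrite DE//.
pose f_ n x := (g x * skernel gam n (t - x))%:E.
have iDn n := (Dstep_integral n tT).1.
have it := idk tT.
have [] := @dominated_convergence _ _ R lam `]0, t[%classic (measurable_itv _) f_
  (EFin \o (fun x => g x / (t - x) `^ gam)) (abse \o (EFin \o (fun x => g x / (t - x) `^ gam))).
- by move=> n; exact: measurable_int (iDn n).
- exact: measurable_int it.
- apply: aeW => x _; apply/cvg_EFin; first by near=> n.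
  by apply: cvgM; [exact: cvg_cst|exact: skernel_cvg].
- exact: integrable_abse.
- apply: aeW => x n _; rewrite /f_ /= lee_fin !(normrM (g x)) ler_wpM2l//.
  have k0 : 0 <= ((t - x) `^ gam)^-1 by rewrite invr_ge0 powR_ge0.
  have s0 := skernel_ge0 gam n (t - x).
  by rewrite (ger0_norm k0) (ger0_norm s0); exact: skernel_le.
move=> _ _ H.
have E n : Dstep n t = fine (\int[lam]_(x in `]0%R, t[) f_ n x)%E by exact: (Dstep_integral n tT).2.
under eq_fun do rewrite E.
apply: fine_cvg; rewrite /Rintegral fineK//.
exact: integrable_fin_num.
Unshelve. all: by end_near. Qed.

Lemma weighted_abs_integrable :
  lam.-integrable setT (fun t => \int[lam]_x (`|g x| * power_kernel gam T (t - x))%:E)%E.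
Proof.
apply: convolution_integrable => //.
- by apply: measurableT_comp => //; exact: measurable_density.
- exact: measurable_power_kernel.
- by move=> x; exact: power_kernel_ge0.
- by have /integrableP[_] := ig.
- exact: power_kernel_int_lty.
Qed.

Lemma Dstep_bound n t : 0 < t <= T ->
  (`|Dstep n t|%:E <= \int[lam]_x (`|g x| * power_kernel gam T (t - x))%:E)%E.
Proof.
move=> tT; have [iD ED] := Dstep_integral n tT.
have mD : measurable (`]0, t[%classic : set R) by exact: measurable_itv.
have K0 x : 0 <= `|g x| * power_kernel gam T (t - x) by rewrite mulr_ge0 ?power_kernel_ge0.
have mK : measurable_fun [set: R] (fun x => `|g x| * power_kernel gam T (t - x)).
  apply: measurable_funM; first by apply: measurableT_comp => //; exact: measurable_density.
  apply: (measurableT_comp (measurable_power_kernel gam T)).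
  by apply: measurable_funB => //; exact: measurable_cst.
rewrite ED.
apply: (@le_trans _ _ (\int[lam]_(x in `]0, t[) `|g x * skernel gam n (t - x)|)%:E).
  by rewrite lee_fin; exact: le_normr_Rintegral.
rewrite /Rintegral fineK; last by apply: integrable_fin_num => //; exact: (integrable_norm iD).
pose A : set R := `]0, t[%classic.
apply: (@le_trans _ _ (\int[lam]_(x in A) (`|g x| * power_kernel gam T (t - x))%:E)%E).
  apply: ge0_le_integral => //.
  - have /measurable_int/measurable_EFinP h := iD.
    by apply/measurable_EFinP; exact: measurableT_comp.
  - by apply/measurable_EFinP; exact: measurable_funTS.
  move=> x; rewrite /= in_itv/= => /andP[x0 xt]; rewrite lee_fin !(normrM (g x)) ler_wpM2l//.
  rewrite (ger0_norm (skernel_ge0 gam n (t - x))) /power_kernel subr_gt0 xt/=.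
  case/andP: tT => t0 tT; rewrite ifT; last by rewrite lerBlDr (le_trans tT)// lerDl ltW.
  exact: skernel_le.
apply: ge0_subset_integral => //; first by apply/measurable_EFinP.
by move=> x _; rewrite lee_fin.
Qed.

(** Pass to the limit in [Dstep_energy]. The approximations are dominated by the
    convolution of |g| with the power kernel, which is integrable. *)
Lemma energy_le : (T `^ gam)^-1 * energy <= \int[lam]_(t in `]0, T]) (w t * Dc t).
Proof.
have mD : measurable (`]0, T]%classic : set (measurableTypeR R)) by exact: measurable_itv.
have [B HB] : exists B, forall t, 0 < t <= T -> `|w t| <= B.
  have [|B [_ HB]] := @compact_bounded _ _ (w @` `[0, T]%classic).
    by apply: continuous_compact; [exact: continuous_subspaceT|exact: segment_compact].
  exists (`|B| + 1) => t /andP[t0 tT]; apply: (HB (`|B| + 1)).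
    by rewrite (le_lt_trans (ler_norm _))// ltrDl.
  by exists t => //; rewrite /= in_itv/= ltW.
have B0 : 0 <= B by have := HB T; rewrite T0 lexx => /(_ isT); exact: le_trans.
pose H t := (\int[lam]_x (`|g x| * power_kernel gam T (t - x))%:E)%E.
have iH : lam.-integrable `]0, T] (fun t => B%:E * H t)%E.
  apply: integrableZl => //; apply: integrableS weighted_abs_integrable => //.
have iwD : lam.-integrable `]0, T] (EFin \o (fun t => w t * Dc t)).
  apply: (@integrableS _ _ _ lam `[0, T]%classic) => //.
  - by move=> x; rewrite /= !in_itv/= => /andP[/ltW -> ->].
  - apply: continuous_compact_integrable; first exact: segment_compact.
    by move=> x; apply: cvgM; [exact: (continuous_subspaceT cw)|exact: cD].
pose f_ n t := (w t * Dstep n t)%:E.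
have iDn n : lam.-integrable `]0, T] (f_ n).
  have cwn := continuousMf cw (Dstep_continuous (n := n)).
  exact: (continuous_integrable cwn).
have [] := @dominated_convergence _ _ R lam `]0, T]%classic mD f_
  (EFin \o (fun t => w t * Dc t)) (fun t => B%:E * H t)%E.
- by move=> n; exact: measurable_int (iDn n).
- exact: measurable_int iwD.
- apply: aeW => t; rewrite /= in_itv/= => tT; apply/cvg_EFin; first by near=> n.
  by apply: cvgM; [exact: cvg_cst|exact: Dstep_cvg].
- exact: iH.
- apply: aeW => t n; rewrite /= in_itv/= => tT; rewrite /f_ /= normrM EFinM.
  apply: lee_pmul => //; rewrite ?lee_fin//; first exact: HB.
  exact: Dstep_bound.
move=> _ _ cv.
have cvR : \int[lam]_(t in `]0, T]) (w t * Dstep n t) @[n --> \oo] -->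
    \int[lam]_(t in `]0, T]) (w t * Dc t).
  apply: fine_cvg; rewrite /Rintegral fineK//.
  exact: integrable_fin_num.
have cvL : skernel gam n T * energy @[n --> \oo] --> (T `^ gam)^-1 * energy.
  by apply: cvgM; [exact: skernel_cvg|exact: cvg_cst].
rewrite -(cvg_lim _ cvL)// -(cvg_lim _ cvR)//.
apply: ler_lim; [by apply/cvg_ex; eexists; exact: cvL|by apply/cvg_ex; eexists; exact: cvR|].
by near=> n; exact: Dstep_energy.
Unshelve. all: by end_near. Qed.

End time_energy.

(** * Criteria for continuity in space *)
Section spatial_regularity.
Context {R : realType} {N : nat}.
Variables (Omega : set 'rV[R]_N).
Hypothesis oOmega : open Omega.
Notation e i := (delta_mx ord0 i : 'rV[R]_N).

Lemma continuous_atP (f : 'rV[R]_N -> R) (x : 'rV[R]_N) :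
  (forall eps, 0 < eps -> exists2 d, 0 < d & forall y, ball x d y -> `|f x - f y| < eps) ->
  {for x, continuous f}.
Proof.
move=> H; rewrite /prop_for /continuous_at; apply/(@cvgrPdist_lt _ _ _ (nbhs x)) => eps /H[d d0 Hd].
by apply/nbhs_ballP; exists d => //= y /Hd.
Qed.

Lemma continuous_atE (f : 'rV[R]_N -> R) (x : 'rV[R]_N) : {for x, continuous f} ->
  forall eps, 0 < eps -> exists2 d, 0 < d & forall y, ball x d y -> `|f x - f y| < eps.
Proof.
rewrite /prop_for /continuous_at => /(@cvgrPdist_lt _ _ _ (nbhs x)) H eps /H /nbhs_ballP[d /= d0 Hd].
by exists d.
Qed.

(** The radius solves (|K| + 1) d^gam = eps. *)
Lemma hoelder_continuous g x : hoelder_on Omega g -> Omega x -> {for x, continuous g}.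
Proof.
move=> [gam [K [g0 g1 HK]]] Ox; apply: continuous_atP => eps eps0.
have /nbhs_ballP[r /= r0 xr] : nbhs x Omega by exact: open_nbhs_nbhs.
pose d := (eps / (`|K| + 1)) `^ gam^-1.
have K1 : 0 < `|K| + 1 by rewrite ltr_wpDl.
have d0 : 0 < d by rewrite powR_gt0// divr_gt0.
exists (Num.min r d); first by rewrite lt_min r0.
move=> y xy; have Oy : Omega y by apply: xr; apply: le_ball xy; rewrite ge_min lexx.
have nxy : `|x - y| < d.
  have : ball x d y by apply: le_ball xy; rewrite ge_min lexx orbT.
  by rewrite -ball_normE.
apply: le_lt_trans (HK x y Ox Oy) _.
have h : `|x - y| `^ gam <= eps / (`|K| + 1).
  have -> : eps / (`|K| + 1) = d `^ gam.
    by rewrite /d -powRrM mulVf ?gt_eqF// powRr1// ltW// divr_gt0.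
  by apply: ge0_ler_powR; [exact: ltW|rewrite nnegrE|rewrite nnegrE ltW|exact: ltW].
apply: (@le_lt_trans _ _ (`|K| * (eps / (`|K| + 1)))).
  apply: (@le_trans _ _ (`|K| * `|x - y| `^ gam)).
    by rewrite ler_wpM2r ?powR_ge0// ler_norm.
  by rewrite ler_wpM2l.
by rewrite mulrCA gtr_pMr// ltr_pdivrMr// mul1r ltrDl.
Qed.

(** Partial derivatives that are continuous at x are bounded near x; the difference
    of f at two points is then estimated along a path parallel to the axes. *)
Lemma partial_continuous (f : 'rV[R]_N -> R) (df : 'I_N -> 'rV[R]_N -> R) x :
  Omega x -> (forall i y, Omega y -> is_derive y (e i) f (df i y)) ->
  (forall i, {for x, continuous (df i)}) -> {for x, continuous f}.
Proof.
move=> Ox dfP cdf; apply: continuous_atP => eps eps0.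
have /nbhs_ballP[r /= r0 xr] : nbhs x Omega by exact: open_nbhs_nbhs.
have [r' r'0 Hr'] : exists2 r', 0 < r' & forall i y, ball x r' y -> `|df i y| <= `|df i x| + 1.
  have /choice[r_ Hr_] : forall i, exists d, 0 < d /\ forall y, ball x d y -> `|df i x - df i y| < 1.
    by move=> i; have [d d0 Hd] := continuous_atE (cdf i) ltr01; exists d.
  exists (\big[Num.min/1]_i r_ i); first by apply: lt_bigmin => // i _; exact: (Hr_ i).1.
  move=> i y xy.
  have : ball x (r_ i) y by apply: le_ball xy; exact: bigmin_le_cond.
  move=> /(Hr_ i).2 h; rewrite -lerBlDl (le_trans _ (ltW h))//.
  by rewrite distrC (le_trans _ (lerB_dist _ _)).
pose B := \sum_i (`|df i x| + 1).
have B0 : 0 <= B by rewrite sumr_ge0// => i _; rewrite addr_ge0.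
have dB i y : ball x r' y -> `|df i y| <= B.
  move=> /(Hr' i) h; apply: le_trans h _; rewrite /B (bigD1 i)//= lerDl.
  by rewrite sumr_ge0// => j _; rewrite addr_ge0.
pose rho := Num.min r r'.
have rho0 : 0 < rho by rewrite lt_min r0.
pose d := Num.min rho (eps / (N%:R * B + 1)).
have NB : 0 < N%:R * B + 1 by rewrite ltr_wpDl// mulr_ge0.
have d0 : 0 < d by rewrite lt_min rho0 divr_gt0.
exists d => // y xy.
have xyi i : `|x ord0 i - y ord0 i| < d by move/(rV_ballP _ _ d0): xy.
(* z k has the first k coordinates of y and the others of x *)
pose z (k : nat) : 'rV[R]_N := \row_i (if (i < k)%N then y ord0 i else x ord0 i).
have z0 : z 0%N = x by apply/rowP => i; rewrite mxE.
have zN : z N = y by apply/rowP => i; rewrite mxE ltn_ord.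
have inball (w : 'rV[R]_N) : (forall i, exists2 th : R, 0 <= th <= 1 & w ord0 i = x ord0 i + th * (y ord0 i - x ord0 i)) ->
    ball x rho w.
  move=> H; apply/rV_ballP => // i; have [th /andP[th0 th1] ->] := H i.
  rewrite opprD addrA subrr add0r normrN normrM (ger0_norm th0).
  apply: (@le_lt_trans _ _ `|x ord0 i - y ord0 i|); first by rewrite distrC ler_piMl.
  by rewrite (lt_le_trans (xyi i))// /d ge_min lexx.
have step (k : 'I_N) : `|f (z k) - f (z k.+1)| <= B * d.
  set c := y ord0 k - x ord0 k.
  have zk : z k.+1 = c *: e k + z k.
    apply/rowP => i; rewrite !mxE eqxx/= ltnS leq_eqVlt.
    case: eqP => [/val_inj ->|ik] /=; first by rewrite eqxx ltnn mulr1 /c subrK.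
    have -> : (i == k) = false by apply/eqP => ik'; apply: ik; rewrite ik'.
    by rewrite mulr0 add0r.
  have seg (s : R) : 0 <= s <= 1 -> ball x rho ((s * c) *: e k + z k).
    move=> s01; apply: inball => i; rewrite !mxE eqxx/=.
    have [->|ik] := eqVneq i k.
      by exists s => //; rewrite ltnn mulr1 addrC.
    rewrite mulr0 add0r; case: ifP => _.
      by exists 1; rewrite ?ler01 ?lexx// mul1r addrC subrK.
    by exists 0; rewrite ?ler01 ?lexx// mul0r addr0.
  pose phi (s : R) := f (s *: (c *: e k) + z k).
  have dphi (s : R) : 0 <= s <= 1 -> is_derive s (1:R) phi (c * df k ((s * c) *: e k + z k)).
    move=> s01.
    have Oz : Omega ((s * c) *: e k + z k).
      by apply: xr; apply: le_ball (seg s s01); rewrite ge_min lexx.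
    have h := is_derive_line (dfP k _ Oz).
    have cs : is_derive s (1:R) (fun s => s * c) c.
      have := is_deriveM (is_derive_id s 1) (is_derive_cst c s 1).
      by move=> /is_derive_congr; apply => // ; rewrite /GRing.scale/=; ring.
    have := is_derive_comp_real cs h.
    move=> /is_derive_congr; apply; last by rewrite mulrC.
    by move=> t; rewrite /phi scalerA.
  have [||c0 c01 E] := @MVT_segment R phi (fun s => c * df k ((s * c) *: e k + z k)) 0 1 ler01.
  - by move=> s; rewrite in_itv/= => /andP[/ltW h1 /ltW h2]; apply: dphi; rewrite h1.
  - by apply: derivable_within_continuous => s; rewrite in_itv/= => s01; have [] := dphi s s01.
  - move: E; rewrite /phi scale1r scale0r add0r -zk subr0 mulr1 distrC => ->.
    rewrite normrM mulrC ler_pM//.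
      apply: dB; apply: (@le_ball _ _ _ rho); first by rewrite ge_min lexx orbT.
      by apply: seg; move: c01; rewrite in_itv.
    by rewrite /c distrC ltW.
have tele : f x - f y = \sum_(k < N) (f (z k) - f (z k.+1)).
  have := telescope_sumr (fun k => - f (z k)) (leq0n N).
  rewrite z0 zN opprK addrC => <-; rewrite big_mkord; apply: eq_bigr => k _.
  by rewrite opprK addrC.
rewrite tele; apply: (le_lt_trans (ler_norm_sum _ _ _)).
apply: (@le_lt_trans _ _ (\sum_(k < N) B * d)); first exact: ler_sum.
rewrite sumr_const card_ord -[X in X < _]mulr_natl mulrA.
apply: (@le_lt_trans _ _ (N%:R * B * (eps / (N%:R * B + 1)))).
  by rewrite ler_wpM2l ?mulr_ge0// /d ge_min lexx orbT.
by rewrite mulrCA gtr_pMr// ltr_pdivrMr// mul1r ltrDl.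
Qed.

End spatial_regularity.

(** * Increments and Riemann sums in time *)
Section time_regularity.
Context {R : realType}.
Variable T : R.
Hypothesis T0 : 0 < T.
Local Notation lam := (@lebesgue_measure R).

(** Near an interior point the restriction to [0, T] is void. *)
Lemma derivable_in_interior (u : R -> R) t : 0 < t < T ->
  derivable_in `[0, T] u t -> is_derive t (1 : R) u (derive_in `[0, T] u t).
Proof.
move=> /andP[t0 tT]; rewrite /derivable_in /derive_in => H.
set l := lim _.
have cv : h^-1 *: ((u \o shift t) (h *: (1 : R)) - u t) @[h --> (0 : R)^'] --> l.
  apply/cvgrPdist_lt => eps eps0.
  have /cvgrPdist_lt/(_ eps eps0) : (fun s => (u s - u t) / (s - t)) @ within `[0, T] (t^') --> l by exact: H.
  move=> /nbhs_ballP[d /= d0 Hd].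
  apply/nbhs_ballP; exists (Num.min d (Num.min t (T - t))) => /=.
    by rewrite !lt_min d0 t0 subr_gt0.
  move=> h; rewrite /ball/= sub0r normrN !lt_min => /and3P[hd ht hT] h0.
  have := Hd (h + t); rewrite /ball/= opprD addrCA subrr addr0 normrN => /(_ hd).
  have nh : h + t != t by rewrite -subr_eq0 addrK.
  have hI : h + t \in `[0, T].
    by move: ht hT; rewrite !ltr_norml in_itv/= => /andP[? ?] /andP[? ?]; apply/andP; split; lra.
  by move=> /(_ nh hI); rewrite addrK /GRing.scale/= mulr1 mulrC.
apply: DeriveDef; first by apply/cvg_ex; exists l.
exact/cvg_lim.
Qed.

Lemma continuous_integrable_itv (f : R -> R) (i : interval R) : continuous f ->
  [set` i] `<=` `[0, T]%classic -> lam.-integrable [set` i] (EFin \o f).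
Proof.
move=> cf iT.
have H : lam.-integrable `[0, T] (EFin \o f).
  by apply: continuous_compact_integrable; [exact: segment_compact|exact: continuous_subspaceT].
by apply: integrableS H.
Qed.

Lemma sub_itv a b : 0 <= a -> b <= T -> `]a, b]%classic `<=` `[0, T]%classic.
Proof.
move=> a0 bT x; rewrite /= !in_itv/= => /andP[ax xb].
by rewrite (le_trans a0 (ltW ax)) (le_trans xb).
Qed.

Lemma ftc_increment (u w : R -> R) a b : continuous w ->
  {within `[0, T], continuous u} ->
  (forall t, 0 < t < T -> is_derive t (1 : R) u (w t)) ->
  0 <= a -> a <= b -> b <= T ->
  u b - u a = \int[lam]_(t in `]a, b]) w t.
Proof.
move=> cw cu du a0; rewrite le_eqVlt => /predU1P[<-|ab] bT.
  by rewrite subrr set_itvoc0 Rintegral_set0.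
have iw : lam.-integrable `]a, b] (EFin \o w).
  by apply: continuous_integrable_itv => //; exact: sub_itv.
rewrite Rintegral_itv_obnd_cbnd// /Rintegral (@continuous_FTC2 _ w u)//=.
- by move=> x; exact: continuous_subspaceT.
- have cuab : {within `[a, b], continuous u}.
    apply: continuous_subspaceW cu => x; rewrite /= !in_itv/= => /andP[ax xb].
    by rewrite (le_trans a0 ax) (le_trans xb).
  have [_ cl cr] := (continuous_within_itvP _ ab).1 cuab.
  split => // x; rewrite in_itv/= => /andP[ax xb].
  by have [] := du x; rewrite ?(le_lt_trans a0 ax) ?(lt_le_trans xb).
- move=> x; rewrite in_itv/= => /andP[ax xb]; rewrite derive1E.
  by have [|_ ->] := du x; rewrite ?(le_lt_trans a0 ax) ?(lt_le_trans xb).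
Qed.

Definition tpt n (k : nat) : R := T / n.+1%:R * k%:R.

Lemma tpt_le n k l : (k <= l)%N -> tpt n k <= tpt n l.
Proof. by move=> kl; rewrite ler_wpM2l ?ler_nat// divr_ge0// ltW. Qed.

Lemma tpt_ge0 n k : 0 <= tpt n k.
Proof. by rewrite mulr_ge0// divr_ge0// ltW. Qed.

Lemma tpt_max n : tpt n n.+1 = T.
Proof. by rewrite /tpt divfK// pnatr_eq0. Qed.

Lemma tpt_leT n k : (k <= n.+1)%N -> tpt n k <= T.
Proof. by move=> /(tpt_le n); rewrite tpt_max. Qed.

Lemma tpt_step n k : tpt n k.+1 - tpt n k = T / n.+1%:R.
Proof. by rewrite /tpt -natr1; ring. Qed.

Lemma Rintegral_tpt (f : R -> R) n k : continuous f -> (k <= n.+1)%N ->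
  \int[lam]_(t in `]0, tpt n k]) f t =
  \sum_(j < k) \int[lam]_(t in `]tpt n j, tpt n j.+1]) f t.
Proof.
move=> cf; elim: k => [_|k IH kn].
  by rewrite big_ord0 /tpt mulr0 set_itvoc0 Rintegral_set0.
rewrite big_ord_recr/= -IH 1?ltnW// -(@Rintegral_itvB _ f (BRight 0) (BRight (tpt n k.+1)) (tpt n k)).
- by rewrite addrC subrK.
- by apply: continuous_integrable_itv => //; apply: sub_itv => //; exact: tpt_leT.
- by rewrite bnd_simp tpt_ge0.
- by rewrite bnd_simp tpt_le.
Qed.

(** By the fundamental theorem of calculus the increments of u are integrals of
    w, so that on each subinterval only the oscillation of f enters. *)
Lemma riemann_sum_le (u w f : R -> R) n (eps B : R) : continuous w -> continuous f ->
  {within `[0, T], continuous u} ->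
  (forall t, 0 < t < T -> is_derive t (1 : R) u (w t)) ->
  0 <= eps -> 0 <= B ->
  (forall t, 0 <= t <= T -> `|w t| <= B) ->
  (forall t s, 0 <= t <= T -> 0 <= s <= T -> `|t - s| <= T / n.+1%:R -> `|f t - f s| <= eps) ->
  `|\int[lam]_(t in `]0, T]) (f t * w t) -
    \sum_(k < n.+1) f (tpt n k.+1) * (u (tpt n k.+1) - u (tpt n k))| <= eps * B * T.
Proof.
move=> cw cf cu du e0 B0 wB fe.
have cfw : continuous (fun t => f t * w t) by move=> t; exact: cvgM (cf t) (cw t).
have := Rintegral_tpt cfw (leqnn n.+1); rewrite tpt_max => ->.
rewrite -sumrB; apply: (le_trans (ler_norm_sum _ _ _)).
have -> : eps * B * T = \sum_(k < n.+1) (eps * B * (T / n.+1%:R)).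
  rewrite sumr_const card_ord -[RHS]mulr_natl; field.
  by rewrite addrC natr1 pnatr_eq0.
apply: ler_sum => k _.
have kn : (k.+1 <= n.+1)%N by exact: ltn_ord.
have kT := tpt_leT kn; have k0 := tpt_ge0 n k; have kk := tpt_le n (leqnSn k).
have iT := sub_itv k0 kT.
have cint (h : R -> R) : continuous h -> lam.-integrable `]tpt n k, tpt n k.+1] (EFin \o h).
  by move=> ch; exact: continuous_integrable_itv.
rewrite (ftc_increment cw cu du k0 kk kT) -RintegralZl//; last exact: cint.
have cfc : continuous (fun t => f (tpt n k.+1) * w t).
  by move=> t; apply: cvgM; [exact: cvg_cst|exact: cw].
have cdiff : continuous (fun t => f t * w t - f (tpt n k.+1) * w t).
  by move=> t; exact: cvgB (cfw t) (cfc t).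
rewrite -RintegralB//; [|exact: cint..].
apply: (le_trans (le_normr_Rintegral _ _)) => //; first exact: cint.
have lm : fine (lam `]tpt n k, tpt n k.+1]%classic) = T / n.+1%:R.
  rewrite lebesgue_measure_itv/= lte_fin; case: ltP => h; first by rewrite -EFinB/= tpt_step.
  have : tpt n k.+1 - tpt n k <= 0 by rewrite subr_le0.
  by rewrite tpt_step leNgt divr_gt0.
have -> : eps * B * (T / n.+1%:R) = \int[lam]_(t in `]tpt n k, tpt n k.+1]) (eps * B).
  by rewrite Rintegral_cst// lm.
apply: le_Rintegral => //.
- by have := integrable_norm (cint _ cdiff).
- by apply: cint => t; exact: cvg_cst.
move=> t tk; have tT : 0 <= t <= T by have := iT _ tk; rewrite /= in_itv.
rewrite -mulrBl normrM ler_pM// ?wB// fe//; first by rewrite tpt_ge0.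
move: tk; rewrite /= in_itv/= => /andP[t1 t2].
rewrite ler0_norm ?subr_le0// opprB -(tpt_step n k) lerD2l lerN2.
exact: ltW.
Qed.

(** An interval of length min d T / 2 that starts or ends at t0 lies in [0, T]. *)
Lemma energy_lower (w : R -> R) t0 d eta : continuous w -> 0 <= t0 <= T -> 0 < d -> 0 <= eta ->
  (forall t, 0 <= t <= T -> `|t - t0| < d -> eta <= `|w t|) ->
  eta ^+ 2 * (Num.min d T / 2) <= energy T w.
Proof.
move=> cw /andP[t00 t0T] d0 eta0 H.
pose del := Num.min d T / 2.
have del0 : 0 < del by rewrite divr_gt0// lt_min d0.
have deld : del < d.
  by rewrite /del ltr_pdivrMr// (le_lt_trans (_ : _ <= d))// ?ge_min ?lexx// ltr_pMr// ltr1n.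
have delT : del <= T / 2 by rewrite /del ler_pM2r ?invr_gt0// ge_min lexx orbT.
pose a := if t0 <= T / 2 then t0 else t0 - del.
have aI : 0 <= a /\ a + del <= T /\ forall t, a < t -> t <= a + del -> `|t - t0| < d.
  rewrite /a; case: ifPn => h.
    split => //; split; first lra.
    by move=> t h1 h2; rewrite ger0_norm ?subr_ge0 ?ltW//; lra.
  rewrite -ltNge in h; split; first lra.
  split; first lra.
  by move=> t h1 h2; rewrite ler0_norm ?subr_le0; lra.
have [a0 [aT aH]] := aI.
have iT := sub_itv a0 aT.
have cww : continuous (fun t => w t * w t) by move=> t; exact: cvgM (cw t) (cw t).
have lm : fine (lam `]a, a + del]%classic) = del.
  by rewrite lebesgue_measure_itv/= lte_fin ltrDl del0 -EFinB/= addrC addKr.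
apply: (@le_trans _ _ (\int[lam]_(t in `]a, a + del]) (w t * w t))).
  have -> : eta ^+ 2 * (Num.min d T / 2) = \int[lam]_(t in `]a, a + del]) (eta ^+ 2).
    by rewrite Rintegral_cst// lm.
  apply: le_Rintegral => //.
  - by apply: continuous_integrable_itv => // t; exact: cvg_cst.
  - exact: continuous_integrable_itv.
  move=> t ta; have := iT _ ta; rewrite /= in_itv/= => tT.
  move: ta; rewrite /= in_itv/= => /andP[t1 t2].
  rewrite -expr2 -[w t ^+ 2]real_normK ?num_real// ler_sqr ?nnegrE//.
  exact: H (aH t t1 t2).
rewrite /energy /Rintegral; apply: fine_le.
- by apply: integrable_fin_num => //; exact: continuous_integrable_itv.
- by apply: integrable_fin_num => //; apply: continuous_integrable_itv => //; apply: sub_itv.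
apply: ge0_subset_integral => //.
- apply/measurable_EFinP; apply: measurable_funTS; exact: continuous_measurable_fun.
- by move=> t _; rewrite lee_fin; exact: sqr_ge0.
- move=> t; rewrite /= !in_itv/= => /andP[t1 t2].
  by rewrite (le_lt_trans a0 t1) (le_trans t2).
Qed.

End time_regularity.

(** * Functions on the closed cylinder *)
Section cylinder.
Context {R : realType} {N : nat}.
Variables (T : R) (Omega : set 'rV[R]_N).
Hypothesis T0 : 0 < T.
Hypothesis cOmega : compact (closure Omega).
Hypothesis oOmega : open Omega.

Lemma cylinder_compact : compact (closed_cyl T Omega).
Proof. by apply: compact_setX => //; exact: segment_compact. Qed.

Lemma cylinder_uc (G : R * 'rV[R]_N -> R) : {within closed_cyl T Omega, continuous G} ->
  forall eps, 0 < eps -> exists2 d, 0 < d & forall t s x y,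
    0 <= t <= T -> 0 <= s <= T -> closure Omega x -> closure Omega y ->
    `|t - s| < d -> ball x d y -> `|G (t, x) - G (s, y)| < eps.
Proof.
move=> cG eps eps0.
have [d d0 Hd] := compact_uniform_continuity cylinder_compact cG eps0.
exists d => // t s x y tT sT Ox Oy ts xy; apply: Hd.
- by split => //=; rewrite in_itv.
- by split => //=; rewrite in_itv.
- by split.
Qed.

Lemma cylinder_slice_space (G : R * 'rV[R]_N -> R) t : 0 <= t <= T ->
  {within closed_cyl T Omega, continuous G} ->
  {within closure Omega, continuous (fun x => G (t, x))}.
Proof.
move=> tT cG; apply/within_continuousP => x Ox eps eps0.
have [d d0 Hd] := cylinder_uc cG eps0.
by exists d => // y Oy xy; apply: Hd => //; rewrite subrr normr0.
Qed.

Lemma cylinder_slice_time (G : R * 'rV[R]_N -> R) x : closure Omega x ->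
  {within closed_cyl T Omega, continuous G} ->
  {within `[0, T], continuous (fun t => G (t, x))}.
Proof.
move=> Ox cG; apply/within_continuousP => t tT eps eps0.
have [d d0 Hd] := cylinder_uc cG eps0.
rewrite /= in_itv in tT.
exists d => // s sT ts; rewrite /= in_itv in sT; apply: Hd => //; exact: ballxx.
Qed.

Lemma cylinder_bounded (G : R * 'rV[R]_N -> R) : {within closed_cyl T Omega, continuous G} ->
  exists2 B, 0 <= B & forall t x, 0 <= t <= T -> closure Omega x -> `|G (t, x)| <= B.
Proof.
move=> cG; have [|B [_ HB]] := @compact_bounded _ _ (G @` closed_cyl T Omega).
  by apply: continuous_compact => //; exact: cylinder_compact.
exists (`|B| + 1); first by rewrite addr_ge0.
move=> t x tT Ox; apply: (HB (`|B| + 1)).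
  by rewrite (le_lt_trans (ler_norm _))// ltrDl.
by exists (t, x) => //; split => //=; rewrite in_itv.
Qed.

Lemma within_continuous_at (g : 'rV[R]_N -> R) x : {within closure Omega, continuous g} ->
  Omega x -> {for x, continuous g}.
Proof.
move=> /continuous_subspaceW => /(_ Omega (@subset_closure _ Omega)).
by rewrite continuous_open_subspace// => cg Ox; apply: cg; rewrite inE.
Qed.

Lemma eq_in_continuous_at (g h : 'rV[R]_N -> R) x : (forall y, Omega y -> g y = h y) ->
  Omega x -> {for x, continuous g} -> {for x, continuous h}.
Proof.
move=> gh Ox; apply: near_eq_continuous.
have : \forall y \near x, Omega y by exact: open_nbhs_nbhs.
by apply: filterS => y /gh.
Qed.

End cylinder.

(** * Regularity of a solution *)
Section solution.
Context {R : realType} {N : nat}.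
Variables (alpha T : R) (Omega : set 'rV[R]_N) (delta : R).
Variables (A : 'rV[R]_N -> 'M[R]_N) (c : 'rV[R]_N -> R) (f : R -> R).
Hypothesis T0 : 0 < T.
Hypothesis cOmega : compact (closure Omega).
Hypothesis oOmega : open Omega.
Hypothesis hL : elliptic_coefficients Omega delta A c.
Notation e i := (delta_mx ord0 i : 'rV[R]_N).
Local Notation lam := (@lebesgue_measure R).

Lemma coef_continuous i j : continuous_in Omega (fun y => A y i j).
Proof.
move=> x Ox.
apply: (partial_continuous oOmega (df := fun k => partial k (fun y => A y i j)) Ox).
- by move=> k y Oy; apply: derivableP; exact: (coef_derivable hL).
- by move=> k; apply: hoelder_continuous Ox => //; exact (coef_hoelder hL i j k).
Qed.

Lemma bounded_in_closure (g : 'rV[R]_N -> R) : {within closure Omega, continuous g} ->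
  exists B, forall x, closure Omega x -> `|g x| <= B.
Proof.
move=> cg; have [|B [_ HB]] := @compact_bounded _ _ (g @` closure Omega).
  exact: continuous_compact.
exists (`|B| + 1) => x Ox; apply: (HB (`|B| + 1)); last by exists x.
by rewrite (le_lt_trans (ler_norm _))// ltrDl.
Qed.

Variables (phi psi omega : 'rV[R]_N -> R) (u : R -> 'rV[R]_N -> R) (h : 'rV[R]_N -> R).
Hypothesis sol : solves_inverse_problem2 alpha T Omega A c f phi psi omega u h.

Let reg := ip_u sol.

Definition grad t (j : 'I_N) : 'rV[R]_N -> R := partial j (u t).
Definition dflux t (i : 'I_N) : 'rV[R]_N -> R := partial i (flux A (grad t) i).

Lemma Lop_flux t x : Lop A c (u t) x = Lflux c (u t) (dflux t) x.
Proof. by []. Qed.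

Lemma hess_continuous t i j : 0 <= t <= T -> continuous_in Omega (partial i (grad t j)).
Proof.
move=> tT x Ox; have [G cG GE] := Ca2_dxx_cont reg i j.
have cGt := cylinder_slice_space cOmega tT cG.
apply: (eq_in_continuous_at oOmega (g := fun y => G (t, y))) => //; last first.
  exact (within_continuous_at oOmega cGt Ox).
by move=> y Oy; rewrite /= GE//; split => //=; rewrite in_itv.
Qed.

Lemma grad_derive t i j x : 0 <= t <= T -> Omega x ->
  is_derive x (e i) (grad t j) (partial i (grad t j) x).
Proof. by move=> tT Ox; apply: derivableP; exact: (Ca2_dxx reg). Qed.

Lemma grad_continuous t j : 0 <= t <= T -> continuous_in Omega (grad t j).
Proof.
move=> tT x Ox.
apply: (partial_continuous oOmega (df := fun k => partial k (grad t j)) Ox).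
- by move=> k y Oy; exact: grad_derive.
- by move=> k; exact: hess_continuous.
Qed.

Lemma flux_derive t i x : 0 <= t <= T -> Omega x ->
  is_derive x (e i) (flux A (grad t) i)
   (\sum_j (partial i (fun y => A y i j) x * grad t j x + A x i j * partial i (grad t j) x)).
Proof.
move=> tT Ox.
have dj j : is_derive x (e i) (fun y => A y i j * grad t j y)
    (partial i (fun y => A y i j) x * grad t j x + A x i j * partial i (grad t j) x).
  have dA : is_derive x (e i) (fun y => A y i j) (partial i (fun y => A y i j) x).
    by apply: derivableP; exact: (coef_derivable hL).
  apply: is_derive_congr (is_deriveM dA (grad_derive i j tT Ox)) _ _ => //.
  by rewrite /GRing.scale/=; ring.
apply: is_derive_congr (is_derive_sum dj) _ _ => //.
by move=> y; rewrite fct_sumE.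
Qed.

(** The equation expresses L u by functions that are continuous on the closed
    cylinder. *)
Lemma solution_bounded t : 0 < t <= T -> bounded_in Omega (Lflux c (u t) (dflux t)).
Proof.
move=> tT; have [G cG GE] := Ca2_caputo reg.
have [B _ HB] := cylinder_bounded cOmega cG.
have [C HC] := bounded_in_closure (ip_h sol).
have tT' : 0 <= t <= T by case/andP: tT => /ltW -> ->.
exists (B + `|f t| * C) => x Ox; have clx := subset_closure Ox.
have := ip_eq sol tT Ox; rewrite Lop_flux => E.
have -> : Lflux c (u t) (dflux t) x = G (t, x) - f t * h x.
  rewrite GE/=; last by split => //=; rewrite in_itv.
  by rewrite -E opprB addrC subrK.
by rewrite (le_trans (ler_normB _ _))// lerD ?HB// normrM ler_wpM2l// HC.
Qed.

Lemma solution_admissible t : 0 < t <= T ->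
  admissible Omega A c (u t) (grad t) (dflux t).
Proof.
move=> tT; have tT' : 0 <= t <= T by case/andP: tT => /ltW -> ->.
have dfE i y : Omega y -> dflux t i y =
  \sum_j (partial i (fun y => A y i j) y * grad t j y + A y i j * partial i (grad t j) y).
  by move=> Oy; have [_ <-] := flux_derive i tT' Oy.
split.
- exact: (cylinder_slice_space cOmega tT' (C10_cont (Ca2_C10 reg))).
- by move=> x bx; exact: (ip_bd sol).
- by move=> j x Ox; apply: derivableP; exact: (Ca2_dx reg).
- by move=> j; exact: grad_continuous.
- by move=> i x Ox; rewrite dfE//; exact: flux_derive.
- move=> i; apply: continuous_in_sum => j; apply: continuous_inM; first exact: coef_continuous.
  exact: grad_continuous.
- move=> i x Ox; apply: (eq_in_continuous_at oOmega (g := fun y =>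
   \sum_j (partial i (fun y => A y i j) y * grad t j y + A y i j * partial i (grad t j) y))) => //.
    by move=> y Oy; rewrite dfE.
  apply: continuous_in_sum Ox => j; apply: continuous_inD; apply: continuous_inM.
  + by move=> y Oy; apply: hoelder_continuous Oy => //; exact (coef_hoelder hL i j i).
  + exact: grad_continuous.
  + exact: coef_continuous.
  + exact: hess_continuous.
- exact: solution_bounded.
Qed.

(** Almost everywhere u_tt is the density g of u_t, so the Caputo integral is
    unaffected when u_tt is replaced by the everywhere defined g. *)
Lemma caputo_density x : closure Omega x -> exists g : R -> R,
  [/\ lam.-integrable setT (EFin \o g),
   (forall t, 0 <= t <= T -> dt T u t x - dt T u 0 x = \int[lam]_(s in `]0, t]) g s),
   (forall t, 0 < t <= T ->
      lam.-integrable `]0, t[ (EFin \o (fun s => g s / (t - s) `^ (alpha - 1)))) &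
   (forall t, 0 < t <= T -> caputo alpha T u t x =
      (Gamma (2 - alpha))^-1 * \int[lam]_(s in `]0, t[) (g s / (t - s) `^ (alpha - 1)))].
Proof.
move=> Ox; have [g [ig gE dg]] := ac_ftc T0 (Ca2_ac reg Ox).
have mg : measurable_fun [set: R] g by have /measurable_int/measurable_EFinP := ig.
have mk t : measurable_fun [set: R] (fun s => g s / (t - s) `^ (alpha - 1)).
  apply: measurable_funM => //.
  rewrite (_ : (fun s => _) = (fun s => (t - s) `^ (- (alpha - 1)))); last first.
    by apply/funext => s; rewrite powRN.
  apply: (measurableT_comp (measurable_powR (- (alpha - 1)))).
  by apply: measurable_funB => //; exact: measurable_cst.
have aeE t : 0 < t <= T -> {ae lam, forall s, `]0, t[%classic s ->
    caputo_integrand alpha T u t x s = g s / (t - s) `^ (alpha - 1)}.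
  move=> /andP[t0 tT]; move: dg; apply: filterS; first exact: (ae_filter_ringOfSetsType lam).
  move=> s H; rewrite /= in_itv/= => /andP[s0 st].
  by rewrite /caputo_integrand /dtt H// s0 (lt_le_trans st).
have mD t : measurable (`]0, t[%classic : set (measurableTypeR R)) by exact: measurable_itv.
have key t : 0 < t <= T ->
    lam.-integrable `]0, t[ (EFin \o (fun s => g s / (t - s) `^ (alpha - 1))).
  move=> tT; have /integrableP[mi ioo] := Ca2_integrable reg tT Ox.
  apply/integrableP; split.
    by apply/measurable_EFinP; apply: measurable_funTS; exact: mk.
  rewrite -(@ge0_ae_eq_integral _ _ _ lam _ (fun s => `|(EFin \o caputo_integrand alpha T u t x) s|%E)) //.
  - by apply: (measurableT_comp _ mi) => //; exact: measurable_abse.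
  - by apply/measurable_EFinP/measurableT_comp => //; apply: measurable_funTS; exact: mk.
  - apply: filterS (aeE t tT); first exact: (ae_filter_ringOfSetsType lam).
    by move=> s H Ds /=; rewrite H.
exists g; split => // t tT.
rewrite /caputo; congr (_ * _); rewrite /Rintegral; congr fine.
apply: ae_eq_integral => //.
- exact: measurable_int (Ca2_integrable reg tT Ox).
- exact: measurable_int (key t tT).
- apply: filterS (aeE t tT); first exact: (ae_filter_ringOfSetsType lam).
  by move=> s H Ds /=; rewrite H.
Qed.

End solution.

(** * Backward Euler summation of the energy *)
Section telescope.
Context {R : realType} {N : nat}.
Variables (Omega : set 'rV[R]_N) (M : R).
Hypothesis M0 : 0 < M.
Hypothesis OmegaM : forall x, Omega x -> forall i, - M < x ord0 i < M.
Hypothesis oOmega : open Omega.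
Variables (A : 'rV[R]_N -> 'M[R]_N) (c : 'rV[R]_N -> R).
Hypothesis Asym : forall x, Omega x -> forall i j, A x i j = A x j i.
Hypothesis Apos : forall x, Omega x -> forall xi : 'I_N -> R,
  0 <= \sum_i \sum_j A x i j * xi i * xi j.
Hypothesis c0 : forall x, Omega x -> 0 <= c x.
Local Notation mean := (mean Omega M).

(** With B_k = (L w_k, w_k), symmetry gives
    2 (L w_(k+1), w_(k+1) - w_k) = B_(k+1) - B_k + (L d, d), d = w_(k+1) - w_k,
    and the last term is nonpositive. The sum telescopes to at most half of
    B_n - B_0, where B_0 = 0 and B_n <= 0. At k = 0 only w_0 = 0 is available,
    not admissibility. *)
Lemma energy_telescope n (w : nat -> 'rV[R]_N -> R) (dw dF : nat -> 'I_N -> 'rV[R]_N -> R) :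
  (forall k, (0 < k <= n)%N -> admissible Omega A c (w k) (dw k) (dF k)) ->
  (forall x, Omega x -> w 0%N x = 0) ->
  let S x := \sum_(k < n) Lflux c (w k.+1) (dF k.+1) x * (w k.+1 x - w k x) in
  bounded_in Omega S /\ mean S <= 0.
Proof.
move=> adm w00 S.
pose L k := Lflux c (w k) (dF k).
have bw k : (k <= n)%N -> bounded_in Omega (w k).
  case: k => [_|k kn]; first by exists 0 => x Ox; rewrite w00// normr0.
  exact (admissible_bounded OmegaM (adm k.+1 kn)).
have bL k : (0 < k <= n)%N -> bounded_in Omega (L k) by move=> kn; exact (adm_L (adm k kn)).
pose B k := if k is 0%N then 0 else mean (fun x => L k x * w k x).
have N1 g : bounded_in Omega g -> bounded_in Omega (fun x => (-1) * g x).
  by move=> bg; apply: bounded_inM => //; exact: bounded_in_cst.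
have bt (k : 'I_n) : bounded_in Omega (fun x => L k.+1 x * (w k.+1 x - w k x)).
  apply: bounded_inM; first exact (bL k.+1 (ltn_ord k)).
  have bD := bounded_inD (bw k.+1 (ltn_ord k)) (N1 _ (bw k (ltnW (ltn_ord k)))).
  by apply: (bounded_in_eq _ bD) => x _; rewrite mulN1r.
have bS : bounded_in Omega S by apply: bounded_in_sum.
split => //.
have -> : mean S = \sum_(k < n) mean (fun x => L k.+1 x * (w k.+1 x - w k x)).
  by rewrite -mean_sum.
have step (k : 'I_n) : mean (fun x => L k.+1 x * (w k.+1 x - w k x)) <= 2^-1 * (B k.+1 - B k).
  have ak := adm k.+1 (ltn_ord k).
  have bLw := bounded_inM (bL k.+1 (ltn_ord k)) (bw k.+1 (ltn_ord k)).
  have neg := Lflux_neg M0 OmegaM oOmega Asym Apos c0 ak.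
  case: k ak bLw neg => -[|k] kn /= ak bLw neg.
    rewrite subr0 (eq_mean M (g := fun x => L 1%N x * w 1%N x)); last first.
      by move=> x Ox; rewrite w00// subr0.
    by rewrite -subr_ge0 /L; move: neg; rewrite /B/=; set m := mean _ => neg; lra.
  have ak0 := adm k.+1 (ltnW kn).
  have bLw0 := bounded_inM (bL k.+1 (ltnW kn)) (bw k.+1 (ltnW kn)).
  have bX := bounded_inM (bL k.+2 kn) (bw k.+1 (ltnW kn)).
  have bY := bounded_inM (bL k.+1 (ltnW kn)) (bw k.+2 kn).
  have sym := Lflux_sym M0 OmegaM oOmega Asym Apos c0 ak ak0.
  have [aB LB] := admissibleB ak ak0.
  have := Lflux_neg M0 OmegaM oOmega Asym Apos c0 aB.
  have -> : mean (fun x => Lflux c (fun x => w k.+2 x - w k.+1 x) (fun i x => dF k.+2 i x - dF k.+1 i x) x * (w k.+2 x - w k.+1 x)) =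
    mean (fun x => (L k.+2 x * w k.+2 x + (-1) * (L k.+2 x * w k.+1 x)) +
       (L k.+1 x * w k.+1 x + (-1) * (L k.+1 x * w k.+2 x))).
    by apply: eq_mean => x Ox; rewrite LB /L; ring.
  have -> : mean (fun x => L k.+2 x * (w k.+2 x - w k.+1 x)) =
    mean (fun x => L k.+2 x * w k.+2 x + (-1) * (L k.+2 x * w k.+1 x)).
    by apply: eq_mean => x Ox; rewrite /L; ring.
  have b1 := bounded_inD bLw (N1 _ bX); have b2 := bounded_inD bLw0 (N1 _ bY).
  rewrite (meanD M b1 b2) (meanD M bLw (N1 _ bX)) (meanD M bLw0 (N1 _ bY)) !meanZ//.
  rewrite /L -sym; set m1 := mean _; set m2 := mean _; set m3 := mean _ => neg2.
  by rewrite -/m3; lra.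
apply: (@le_trans _ _ (\sum_(k < n) 2^-1 * (B k.+1 - B k))); first exact: ler_sum.
rewrite -mulr_sumr -(big_mkord xpredT (fun k => B k.+1 - B k)) telescope_sumr//=.
rewrite subr0 pmulr_rle0//; case: n adm {bw bL bt bS S step} => [|n] adm //=.
exact: (Lflux_neg M0 OmegaM oOmega Asym Apos c0 (adm n.+1 (ltnSn n))).
Qed.

End telescope.

(** * The energy estimate for the difference of two solutions *)
Section within_algebra.
Context {R : realType} {V : pseudoMetricType R}.
Implicit Types (K : set V) (f g : V -> R).

Lemma within_continuousB K f g : {within K, continuous f} -> {within K, continuous g} ->
  {within K, continuous (fun z => f z - g z)}.
Proof. by move=> cf cg z; apply: cvgB; [exact: cf|exact: cg]. Qed.

Lemma within_continuousM K f g : {within K, continuous f} -> {within K, continuous g} ->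
  {within K, continuous (fun z => f z * g z)}.
Proof. by move=> cf cg z; apply: cvgM; [exact: cf|exact: cg]. Qed.

End within_algebra.

Section clamped.
Context {R : realType}.
Variable T : R.
Hypothesis T0 : 0 < T.
Local Notation lam := (@lebesgue_measure R).

Lemma clamp_within (F : R -> R) : {within `[0, T], continuous F} ->
  continuous (fun t => F (clamp 0 T t)).
Proof.
move=> /within_continuousP cF t; apply/cvgrPdist_lt => eps eps0.
have ct s : clamp 0 T s \in `[0, T] by rewrite in_itv/= clamp_itv.
have [d d0 Hd] := cF _ (ct t) eps eps0.
near=> s; apply: Hd; first exact: ct.
rewrite /ball/= (le_lt_trans (clamp_dist _ _ _ _))//; near: s; exact: cvgr_dist_lt.
Unshelve. all: by end_near. Qed.

Lemma within_integrable (F : R -> R) : {within `[0, T], continuous F} ->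
  lam.-integrable `[0, T] (EFin \o F) /\ lam.-integrable `]0, T] (EFin \o F).
Proof.
move=> cF; have iF : lam.-integrable `[0, T] (EFin \o F).
  by apply: continuous_compact_integrable => //; exact: segment_compact.
split => //; apply: integrableS iF => //; exact: sub_itv.
Qed.

End clamped.

Section cylinder_functions.
Context {R : realType} {N : nat}.
Variables (T : R) (Omega : set 'rV[R]_N).

Lemma cylinder_time (f : R -> R) : {within `[0, T], continuous f} ->
  {within closed_cyl T Omega, continuous (fun z => f z.1)}.
Proof.
move=> /within_continuousP cf; apply/within_continuousP => -[t x] [/= tT Ox] eps eps0.
have [d d0 Hd] := cf t tT eps eps0.
by exists d => // -[s y] [/= sT Oy] [/= ts _]; exact: Hd.
Qed.

Lemma cylinder_space (h : 'rV[R]_N -> R) : {within closure Omega, continuous h} ->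
  {within closed_cyl T Omega, continuous (fun z => h z.2)}.
Proof.
move=> /within_continuousP ch; apply/within_continuousP => -[t x] [/= tT Ox] eps eps0.
have [d d0 Hd] := ch x Ox eps eps0.
by exists d => // -[s y] [/= sT Oy] [/= _ xy]; exact: Hd.
Qed.

End cylinder_functions.

Section two_solutions.
Context {R : realType} {N : nat}.
Variables (alpha T : R) (Omega : set 'rV[R]_N).
Hypothesis halpha : 1 < alpha < 2.
Hypothesis T0 : 0 < T.
Hypothesis cOmega : compact (closure Omega).
Variables (A : 'rV[R]_N -> 'M[R]_N) (c : 'rV[R]_N -> R) (f : R -> R).
Hypothesis cf : {within `[0, T], continuous f}.
Variables (phi psi omega : 'rV[R]_N -> R) (u1 u2 : R -> 'rV[R]_N -> R) (h1 h2 : 'rV[R]_N -> R).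
Hypothesis sol1 : solves_inverse_problem2 alpha T Omega A c f phi psi omega u1 h1.
Hypothesis sol2 : solves_inverse_problem2 alpha T Omega A c f phi psi omega u2 h2.
Variables G1 G2 : R * 'rV[R]_N -> R.
Hypothesis cG1 : {within closed_cyl T Omega, continuous G1}.
Hypothesis cG2 : {within closed_cyl T Omega, continuous G2}.
Hypothesis G1E : forall t x, 0 < t <= T -> closure Omega x -> G1 (t, x) = caputo alpha T u1 t x.
Hypothesis G2E : forall t x, 0 < t <= T -> closure Omega x -> G2 (t, x) = caputo alpha T u2 t x.
Local Notation lam := (@lebesgue_measure R).

Definition velocity (z : R * 'rV[R]_N) := dt T u1 z.1 z.2 - dt T u2 z.1 z.2.

(** By the equation this is L (u1 - u2) at positive times. The formula in terms
    of the extended Caputo derivatives has the advantage of being continuous on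
    the closed cylinder. *)
Definition elliptic_part (z : R * 'rV[R]_N) := G1 z - G2 z - f z.1 * (h1 z.2 - h2 z.2).

Definition coercivity : R := (Gamma (2 - alpha))^-1 * (T `^ (alpha - 1))^-1.

Lemma velocity_continuous : {within closed_cyl T Omega, continuous velocity}.
Proof.
apply: within_continuousB.
- exact: C10_dt_cont (Ca2_C10 (ip_u sol1)).
- exact: C10_dt_cont (Ca2_C10 (ip_u sol2)).
Qed.

Lemma elliptic_part_continuous : {within closed_cyl T Omega, continuous elliptic_part}.
Proof.
apply: within_continuousB; first exact: within_continuousB.
apply: within_continuousM; first exact: cylinder_time.
have ch : {within closure Omega, continuous (fun x => h1 x - h2 x)}.
  by apply: within_continuousB; [exact: ip_h sol1|exact: ip_h sol2].
exact: (cylinder_space ch).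
Qed.

Lemma coercivity_gt0 : 0 < coercivity.
Proof.
case/andP: halpha => a1 a2; rewrite mulr_gt0// invr_gt0 ?powR_gt0//.
by have := @Gamma_gt0 R (alpha - 1); rewrite opprB addrA -(natrD _ 1 1) => -> //; lra.
Qed.

(** The overdetermination condition, which both solutions satisfy with the same
    datum. *)
Lemma velocity_source_orthogonal x : closure Omega x ->
  \int[lam]_(t in `]0, T]) (f t * velocity (t, x)) = 0.
Proof.
move=> Ox.
have c1 := cylinder_slice_time cOmega Ox (C10_dt_cont (Ca2_C10 (ip_u sol1))).
have c2 := cylinder_slice_time cOmega Ox (C10_dt_cont (Ca2_C10 (ip_u sol2))).
have [i1 _] := within_integrable (within_continuousM cf c1).
have [i2 _] := within_integrable (within_continuousM cf c2).
have cv := cylinder_slice_time cOmega Ox velocity_continuous.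
have [_ iv] := within_integrable (within_continuousM cf cv).
rewrite Rintegral_itv_obnd_cbnd//.
transitivity (\int[lam]_(t in `[0, T]) (f t * dt T u1 t x - f t * dt T u2 t x)).
  by apply: eq_Rintegral => t _; rewrite /velocity/= mulrBr.
by rewrite RintegralB// (ip_omega sol1 Ox) (ip_omega sol2 Ox) subrr.
Qed.

(** The source drops out by orthogonality, and what is left is the Caputo
    derivative of u1 - u2 against its velocity. *)
Lemma velocity_energy x : closure Omega x ->
  coercivity * energy T (fun t => velocity (clamp 0 T t, x)) <=
  \int[lam]_(t in `]0, T]) (elliptic_part (clamp 0 T t, x) * velocity (clamp 0 T t, x)).
Proof.
move=> Ox; have /andP[a1 a2] := halpha.
have [g1 [ig1 g1E ik1 D1]] := caputo_density T0 sol1 Ox.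
have [g2 [ig2 g2E ik2 D2]] := caputo_density T0 sol2 Ox.
pose g t := g1 t - g2 t.
have cv := cylinder_slice_time cOmega Ox velocity_continuous.
have cw := clamp_within T0 cv.
pose w t := velocity (clamp 0 T t, x).
have cGG := within_continuousB cG1 cG2.
have cD := cylinder_slice_time cOmega Ox cGG.
pose Gam : R := Gamma (2 - alpha).
have Gam0 : 0 < Gam.
  by have := @Gamma_gt0 R (alpha - 1); rewrite opprB addrA -(natrD _ 1 1) => -> //; lra.
pose Dc t := Gam * (G1 (t, x) - G2 (t, x)).
have cl t : 0 <= t <= T -> clamp 0 T t = t by exact: clamp_id.
have v0 : velocity (0, x) = 0.
  by rewrite /velocity/= (ip_psi sol1 Ox) (ip_psi sol2 Ox) subrr.
have sub t : 0 <= t <= T -> `]0, t]%classic `<=` [set: R] by [].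
have ig : lam.-integrable setT (EFin \o g).
  have := integrableB measurableT ig1 ig2; apply: eq_integrable => //.
have E : (T `^ (alpha - 1))^-1 * energy T w <= \int[lam]_(t in `]0, T]) (w t * Dc t).
  apply: (@energy_le R T (alpha - 1) g) => //; rewrite ?subr_gt0//; first lra.
  - move=> t t0; rewrite /w /clamp min_l ?(le_trans t0 (ltW T0))// max_l//.
  - move=> t tT; rewrite /w cl// /velocity/=.
    have -> : dt T u1 t x - dt T u2 t x =
        (dt T u1 t x - dt T u1 0 x) - (dt T u2 t x - dt T u2 0 x).
      by have := v0; rewrite /velocity/= => /eqP; rewrite subr_eq0 => /eqP ->; ring.
    rewrite g1E// g2E// -RintegralB//; [exact: integrableS ig1|exact: integrableS ig2].
  - move=> t tT; have := integrableB _ (ik1 t tT) (ik2 t tT).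
    move=> /(_ (measurable_itv _)); apply: eq_integrable => // s _.
    by rewrite /= -EFinB mulrBl.
  - apply: within_continuousM => //; exact: cst_continuous.
  - move=> t tT; rewrite /Dc G1E// G2E// D1// D2// -mulrBr mulrA divff ?gt_eqF// mul1r.
    rewrite -RintegralB//; [|exact: ik1|exact: ik2].
    by apply: eq_Rintegral => s _; rewrite mulrBl.
have [_ iwD] := within_integrable (within_continuousM cv cD).
have [_ ifw] := within_integrable (within_continuousM cf cv).
have chf : {within `[0, T], continuous (fun t => (h1 x - h2 x) * (f t * velocity (t, x)))}.
  by apply: within_continuousM; [exact: cst_continuous|exact: within_continuousM].
have [_ ihf] := within_integrable chf.
have -> : \int[lam]_(t in `]0, T]) (elliptic_part (clamp 0 T t, x) * velocity (clamp 0 T t, x)) =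
  \int[lam]_(t in `]0, T]) (w t * (G1 (t, x) - G2 (t, x))).
  transitivity (\int[lam]_(t in `]0, T])
     (velocity (t, x) * (G1 (t, x) - G2 (t, x)) - (h1 x - h2 x) * (f t * velocity (t, x)))).
    apply: eq_Rintegral => t; rewrite inE/= in_itv/= => /andP[/ltW t0 tT].
    by rewrite cl ?t0// /elliptic_part/=; ring.
  rewrite RintegralB//.
  rewrite RintegralZl// velocity_source_orthogonal// mulr0 subr0.
  apply: eq_Rintegral => t; rewrite inE/= in_itv/= => /andP[/ltW t0 tT].
  by rewrite /w cl ?t0.
have DE : \int[lam]_(t in `]0, T]) (w t * Dc t) =
    Gam * \int[lam]_(t in `]0, T]) (w t * (G1 (t, x) - G2 (t, x))).
  rewrite -RintegralZl//.
    by apply: eq_Rintegral => t _; rewrite /Dc; ring.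
  apply: eq_integrable iwD => // t; rewrite inE/= in_itv/= => /andP[/ltW t0 tT].
  by rewrite /w cl ?t0.
by rewrite /coercivity -mulrA ler_pdivrMl// -DE.
Qed.

End two_solutions.

(** * Vanishing of the velocity difference *)
Section uniqueness.
Context {R : realType} {N : nat}.
Variables (alpha T : R) (Omega : set 'rV[R]_N) (delta M : R).
Hypothesis halpha : 1 < alpha < 2.
Hypothesis T0 : 0 < T.
Hypothesis oOmega : open Omega.
Hypothesis delta0 : 0 < delta.
Hypothesis M0 : 0 < M.
Hypothesis OmegaM : forall x, Omega x -> forall i, - M < x ord0 i < M.
Variables (A : 'rV[R]_N -> 'M[R]_N) (c : 'rV[R]_N -> R) (f : R -> R).
Hypothesis hL : elliptic_coefficients Omega delta A c.
Hypothesis cf : {within `[0, T], continuous f}.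
Variables (phi psi omega : 'rV[R]_N -> R) (u1 u2 : R -> 'rV[R]_N -> R) (h1 h2 : 'rV[R]_N -> R).
Hypothesis sol1 : solves_inverse_problem2 alpha T Omega A c f phi psi omega u1 h1.
Hypothesis sol2 : solves_inverse_problem2 alpha T Omega A c f phi psi omega u2 h2.
Variables G1 G2 : R * 'rV[R]_N -> R.
Hypothesis cG1 : {within closed_cyl T Omega, continuous G1}.
Hypothesis cG2 : {within closed_cyl T Omega, continuous G2}.
Hypothesis G1E : forall t x, 0 < t <= T -> closure Omega x -> G1 (t, x) = caputo alpha T u1 t x.
Hypothesis G2E : forall t x, 0 < t <= T -> closure Omega x -> G2 (t, x) = caputo alpha T u2 t x.
Local Notation lam := (@lebesgue_measure R).
Local Notation vel := (velocity T u1 u2).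
Local Notation ell := (elliptic_part f h1 h2 G1 G2).
Local Notation mean := (mean Omega M).

Let cOmega : compact (closure Omega) := compact_closure OmegaM.

Definition work x := \int[lam]_(t in `]0, T]) (ell (clamp 0 T t, x) * vel (clamp 0 T t, x)).

(** The integral of L u against u_t with u_t dt replaced by the increments of u,
    which are admissible in space. *)
Definition time_sum n x := \sum_(k < n.+1) ell (tpt T n k.+1, x) *
  ((u1 (tpt T n k.+1) x - u2 (tpt T n k.+1) x) - (u1 (tpt T n k) x - u2 (tpt T n k) x)).

Lemma time_sum_mean n : bounded_in Omega (time_sum n) /\ mean (time_sum n) <= 0.
Proof.
pose w k x := u1 (tpt T n k) x - u2 (tpt T n k) x.
pose dw k j x := grad u1 (tpt T n k) j x - grad u2 (tpt T n k) j x.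
pose dF k i x := dflux A u1 (tpt T n k) i x - dflux A u2 (tpt T n k) i x.
have tk k : (0 < k <= n.+1)%N -> 0 < tpt T n k <= T.
  by move=> /andP[k0 kn]; rewrite tpt_leT// andbT mulr_gt0 ?divr_gt0 ?ltr0n.
have adm k : (0 < k <= n.+1)%N -> admissible Omega A c (w k) (dw k) (dF k) /\
    forall x, Omega x -> Lflux c (w k) (dF k) x = ell (tpt T n k, x).
  move=> /tk kT.
  have [ad LE] := admissibleB (solution_admissible cOmega oOmega hL sol1 kT)
    (solution_admissible cOmega oOmega hL sol2 kT).
  split => // x Ox; rewrite LE -!Lop_flux /elliptic_part/=.
  have := ip_eq sol1 kT Ox; have := ip_eq sol2 kT Ox.
  have clx := subset_closure Ox.
  by rewrite -G1E// -G2E// mulrBr => <- <-; ring.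
have Apos x : Omega x -> forall xi : 'I_N -> R, 0 <= \sum_i \sum_j A x i j * xi i * xi j.
  move=> Ox xi; apply: le_trans (coef_elliptic hL Ox xi).
  by apply: mulr_ge0; [exact: ltW|apply: sumr_ge0 => i _; exact: sqr_ge0].
have [] := energy_telescope M0 OmegaM oOmega (coef_sym hL) Apos (pot_ge0 hL)
  (n := n.+1) (w := w) (dw := dw) (dF := dF).
- by move=> k /adm[].
- move=> x /(@subset_closure _ Omega) Ox.
  by rewrite /w /tpt mulr0 (ip_phi sol1 Ox) (ip_phi sol2 Ox) subrr.
have SE x : Omega x -> \sum_(k < n.+1) Lflux c (w k.+1) (dF k.+1) x * (w k.+1 x - w k x) =
    time_sum n x.
  move=> Ox; apply: eq_bigr => k _; have [_ ->] := adm k.+1 (ltn_ord k) => //.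
move=> bS mS; split; first exact: (bounded_in_eq SE bS).
by rewrite -(eq_mean M SE).
Qed.

Lemma work_time_sum eps : 0 < eps ->
  exists n, forall x, Omega x -> `|work x - time_sum n x| <= eps.
Proof.
move=> eps0.
have cv := velocity_continuous sol1 sol2.
have cl := elliptic_part_continuous cf sol1 sol2 cG1 cG2.
have [B B0 HB] := cylinder_bounded cOmega cv.
pose e := eps / (B * T + 1).
have BT : 0 < B * T + 1 by rewrite ltr_wpDl// mulr_ge0// ltW.
have e0 : 0 < e by rewrite divr_gt0.
have [d d0 Hd] := cylinder_uc cOmega cl e0.
have [n nT] : exists n, T / n.+1%:R < d.
  exists (Num.truncn (T / d)); rewrite ltr_pdivrMr ?ltr0n// -ltr_pdivrMl// mulrC.
  by rewrite truncnS_gt.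
exists n => x Ox; have clx := subset_closure Ox.
have ci t : 0 <= t <= T -> clamp 0 T t = t by exact: clamp_id.
have -> : time_sum n x = \sum_(k < n.+1) ell (clamp 0 T (tpt T n k.+1), x) *
  ((u1 (tpt T n k.+1) x - u2 (tpt T n k.+1) x) - (u1 (tpt T n k) x - u2 (tpt T n k) x)).
  by apply: eq_bigr => k _; rewrite ci// tpt_ge0// tpt_leT// ltn_ord.
apply: (@le_trans _ _ (e * B * T)); last first.
  rewrite -mulrA /e mulrAC ler_pdivrMr//.
  by apply: ler_wpM2l; [exact: ltW|rewrite lerDl].
apply: (@riemann_sum_le R T T0 (fun t => u1 t x - u2 t x)
  (fun t => vel (clamp 0 T t, x)) (fun t => ell (clamp 0 T t, x)) n e B) => //.
- exact: clamp_within (cylinder_slice_time cOmega clx cv).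
- exact: clamp_within (cylinder_slice_time cOmega clx cl).
- apply: within_continuousB.
  + exact: (cylinder_slice_time cOmega clx (C10_cont (Ca2_C10 (ip_u sol1)))).
  + exact: (cylinder_slice_time cOmega clx (C10_cont (Ca2_C10 (ip_u sol2)))).
- move=> t tT; have tT' : 0 <= t <= T by case/andP: tT => /ltW -> /ltW ->.
  have cyl : closed_cyl T Omega (t, x) by split => //=; rewrite in_itv.
  have D1 := derivable_in_interior tT (C10_dt (Ca2_C10 (ip_u sol1)) cyl).
  have D2 := derivable_in_interior tT (C10_dt (Ca2_C10 (ip_u sol2)) cyl).
  by rewrite ci//; exact: is_deriveB.
- exact: ltW.
- by move=> t tT; rewrite ci// HB.
- move=> t s tT sT ts; rewrite !ci// ltW// Hd//; last exact: ballxx.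
  exact: le_lt_trans nT.
Qed.

(** The mean of each approximating sum is nonpositive, and the approximation is
    uniform in x. *)
Lemma work_mean : bounded_in Omega work /\ mean work <= 0.
Proof.
have bdn n e : (forall x, Omega x -> `|work x - time_sum n x| <= e) ->
    bounded_in Omega (fun x => work x - time_sum n x).
  by move=> He; exists e.
have E n e : (forall x, Omega x -> `|work x - time_sum n x| <= e) ->
    bounded_in Omega work.
  move=> /bdn bd; have [bS _] := time_sum_mean n.
  by apply: (bounded_in_eq _ (bounded_inD bd bS)) => x _; rewrite subrK.
have bP : bounded_in Omega work.
  by have [n Hn] := work_time_sum ltr01; exact: E Hn.
split => //; apply/ler_addgt0Pr => e e0; rewrite add0r.
have [n Hn] := work_time_sum e0; have [bS mS] := time_sum_mean n.
have -> : mean work = mean (fun x => (work x - time_sum n x) + time_sum n x).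
  by apply: eq_mean => x _; rewrite subrK.
rewrite meanD//; last exact: bdn Hn.
rewrite -[leRHS]addr0 lerD//.
by rewrite (le_trans (ler_norm _))// mean_norm// ltW.
Qed.

(** If the velocity were nonzero at one point, then by continuity it would be
    bounded below on a neighbourhood in space and time; the energy estimate
    would make the work bounded below on a ball, hence of positive mean. *)
Lemma velocity_eq0 t x : 0 <= t <= T -> Omega x -> vel (t, x) = 0.
Proof.
move=> tT Ox; apply/eqP/negPn/negP => v0.
have cv := velocity_continuous sol1 sol2.
have c0 := coercivity_gt0 halpha T0.
have ci s : 0 <= s <= T -> clamp 0 T s = s by exact: clamp_id.
have en y : Omega y -> coercivity alpha T * energy T (fun s => vel (clamp 0 T s, y)) <= work y.
  by move=> /(@subset_closure _ Omega); exact: (velocity_energy halpha T0 cOmega cf sol1 sol2).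
pose eta := `|vel (t, x)| / 2.
have eta0 : 0 < eta by rewrite divr_gt0// normr_gt0.
have [d d0 Hd] := cylinder_uc cOmega cv eta0.
have /nbhs_ballP[r /= r0 xr] : nbhs x Omega by exact: open_nbhs_nbhs.
pose kap := coercivity alpha T * (eta ^+ 2 * (Num.min d T / 2)).
have kap0 : 0 < kap by rewrite mulr_gt0// mulr_gt0 ?exprn_gt0// divr_gt0// lt_min d0.
have [bP mP] := work_mean.
suff : 0 < mean work by rewrite ltNge mP.
apply: (mean_gt0 M0 OmegaM (x0 := x) (r := Num.min r d) (kappa := kap)) => //.
- move=> y Oy; apply: le_trans (en y Oy); rewrite mulr_ge0// ?(ltW c0)//.
  by apply: Rintegral_ge0 => s _; exact: sqr_ge0.
- by rewrite lt_min r0.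
- move=> y xy.
  have xyr : ball x r y by apply: le_ball xy; rewrite ge_min lexx.
  have xyd : ball x d y by apply: le_ball xy; rewrite ge_min lexx orbT.
  have Oy := xr _ xyr; split => //; apply: le_trans (en y Oy).
  rewrite ler_wpM2l ?(ltW c0)//.
  have cly := subset_closure Oy.
  apply: (energy_lower T0 (t0 := t)) => //.
  + exact: clamp_within (cylinder_slice_time cOmega cly cv).
  + exact: ltW.
  move=> s sT st; rewrite ci//.
  have := Hd t s x y tT sT (subset_closure Ox) cly; rewrite distrC => /(_ st xyd) H.
  rewrite /eta in H *.
  have := lerB_dist (vel (t, x)) (vel (s, y)); lra.
Qed.

End uniqueness.

(** * From the velocity to the solution and the source *)
Section agreement.
Context {R : realType} {N : nat}.
Variables (Omega : set 'rV[R]_N).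
Hypothesis oOmega : open Omega.

Lemma closure_eq (g h : 'rV[R]_N -> R) : {within closure Omega, continuous g} ->
  {within closure Omega, continuous h} ->
  (forall x, Omega x -> g x = h x) -> forall x, closure Omega x -> g x = h x.
Proof.
move=> cg ch gh x Ox; apply/eqP; rewrite -subr_eq0; apply/negPn/negP => ne0.
have /within_continuousP cgh := within_continuousB cg ch.
have [|d d0 Hd] := cgh x Ox `|g x - h x|; first by rewrite normr_gt0.
have [y [Oy xy]] := Ox _ (nbhsx_ballx x d d0).
have := Hd y (subset_closure Oy) xy.
by rewrite -[X in `|X - _|]/(g x - h x) -[X in `|_ - X|]/(g y - h y) (gh y Oy) subrr subr0 ltxx.
Qed.

Lemma partial_eq (g h : 'rV[R]_N -> R) i : (forall x, Omega x -> g x = h x) ->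
  forall x, Omega x -> partial i g x = partial i h x.
Proof.
move=> gh x Ox; apply: (@near_eq_derive R).
have : \forall y \near x, Omega y by exact: open_nbhs_nbhs.
by apply: filterS => y /gh.
Qed.

Lemma Lop_eq (A : 'rV[R]_N -> 'M[R]_N) (c v w : 'rV[R]_N -> R) : (forall x, Omega x -> v x = w x) ->
  forall x, Omega x -> Lop A c v x = Lop A c w x.
Proof.
move=> vw x Ox.
have E i y : Omega y -> \sum_j A y i j * partial j v y = \sum_j A y i j * partial j w y.
  by move=> Oy; apply: eq_bigr => j _; rewrite (partial_eq j vw Oy).
rewrite /Lop; apply: (f_equal2 (fun a b => a - b)).
  by apply: eq_bigr => i _; exact (partial_eq i (E i) Ox).
exact: (congr1 (fun a => c x * a) (vw x Ox)).
Qed.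

Lemma caputo_eq alpha T (u v : R -> 'rV[R]_N -> R) x :
  (forall s, 0 <= s <= T -> dt T u s x = dt T v s x) ->
  forall t, 0 < t <= T -> caputo alpha T u t x = caputo alpha T v t x.
Proof.
move=> uv t /andP[t0 tT]; rewrite /caputo.
apply: (congr1 (fun I => (Gamma (2 - alpha))^-1 * I)); apply: eq_Rintegral => s.
rewrite inE/= in_itv/= => /andP[s0 st]; rewrite /caputo_integrand.
apply: (congr1 (fun a => a / (t - s) `^ (alpha - 1))).
rewrite /dtt !derive1E; apply: (@near_eq_derive R).
have sT : s \in `]0, T[ by rewrite in_itv/= s0 (lt_le_trans st).
have : \forall r \near s, r \in `]0, T[ by exact: near_in_itvoo.
by apply: filterS => r; rewrite in_itv/= => /andP[/ltW r0 /ltW rT]; apply: uv; rewrite r0.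
Qed.

End agreement.

(** The equation is posed at positive times only. *)
Lemma nonzero_at_positive (R : realType) (T : R) (f : R -> R) : 0 < T ->
  {within `[0, T], continuous f} -> (exists2 t, 0 <= t <= T & f t != 0) ->
  exists2 t, 0 < t <= T & f t != 0.
Proof.
move=> T0 /within_continuousP cf [t /andP[]].
rewrite le_eqVlt => /predU1P[<- _ f0|t0 tT ft]; last by exists t => //; rewrite t0 tT.
have I0 : `[0, T]%classic (0 : R) by rewrite /= in_itv/= lexx ltW.
have [|d d0 Hd] := cf 0 I0 `|f 0|; first by rewrite normr_gt0.
pose s := Num.min (d / 2) T.
have s0 : 0 < s by rewrite lt_min T0 divr_gt0.
have sT : s <= T by rewrite ge_min lexx orbT.
exists s; first by rewrite s0.
apply/negP => /eqP fs; have := Hd s; rewrite fs subr0 ltxx => H.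
suff : false by []; apply: H.
  by rewrite /= in_itv/= ltW.
rewrite /ball/= sub0r normrN gtr0_norm// (le_lt_trans (_ : _ <= d / 2))//.
  by rewrite ge_min lexx.
by rewrite ltr_pdivrMr// ltr_pMr// ltr1n.
Qed.

Theorem theorem5 (R : realType) (N : nat) (hN : (1 <= N)%N)
    (alpha T : R) (halpha : 1 < alpha < 2) (hT : 0 < T)
    (Omega : set 'rV[R]_N)
    (hOmega : bounded_domain Omega) (hbd : smooth_boundary Omega)
    (delta : R) (hdelta : 0 < delta)
    (A : 'rV[R]_N -> 'M[R]_N) (c : 'rV[R]_N -> R)
    (hL : elliptic_coefficients Omega delta A c)
    (f : R -> R) (hf : {within `[0, T], continuous f})
    (hf0 : exists2 t, 0 <= t <= T & f t != 0)
    (phi psi omega : 'rV[R]_N -> R)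
    (u1 u2 : R -> 'rV[R]_N -> R) (h1 h2 : 'rV[R]_N -> R) :
  solves_inverse_problem2 alpha T Omega A c f phi psi omega u1 h1 ->
  solves_inverse_problem2 alpha T Omega A c f phi psi omega u2 h2 ->
  (forall t x, 0 <= t <= T -> closure Omega x -> u1 t x = u2 t x) /\
  (forall x, closure Omega x -> h1 x = h2 x).
Proof.
move=> sol1 sol2; have [oOmega _ _ [M0 [_ HM0]]] := hOmega.
pose M := `|M0| + 2.
have M_gt0 : 0 < M by rewrite ltr_wpDl.
have OmegaM x : Omega x -> forall i, - M < x ord0 i < M.
  move=> Ox i; rewrite -ltr_norml.
  have nx : `|x| <= `|M0| + 1 by apply: HM0 Ox; rewrite (le_lt_trans (ler_norm _))// ltrDl.
  apply: (@le_lt_trans _ _ (`|M0| + 1)); last by rewrite ltrD2l ltr1n.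
  apply: le_trans nx; rewrite [leRHS]/Num.Def.normr /= mx_normrE.
  by apply/bigmax_geP; right => /=; exists (ord0, i).
have cOmega := compact_closure OmegaM.
have [G1 cG1 G1E] := Ca2_caputo (ip_u sol1).
have [G2 cG2 G2E] := Ca2_caputo (ip_u sol2).
have v0 t x : 0 <= t <= T -> Omega x -> dt T u1 t x = dt T u2 t x.
  move=> tT Ox; apply/eqP; rewrite -subr_eq0; apply/eqP.
  apply: (velocity_eq0 halpha hT oOmega hdelta M_gt0 OmegaM hL hf sol1 sol2 cG1 cG2 _ _ tT Ox).
  - by move=> s y sT Oy; rewrite G1E//; split => //=; rewrite in_itv.
  - by move=> s y sT Oy; rewrite G2E//; split => //=; rewrite in_itv.
have uE t x : 0 <= t <= T -> Omega x -> u1 t x = u2 t x.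
  move=> /andP[t0 tT] Ox; have clx := subset_closure Ox.
  have cu1 := cylinder_slice_time cOmega clx (C10_cont (Ca2_C10 (ip_u sol1))).
  have cu2 := cylinder_slice_time cOmega clx (C10_cont (Ca2_C10 (ip_u sol2))).
  have d0 s : 0 < s < T -> is_derive s (1 : R) (fun t => u1 t x - u2 t x) 0.
    move=> sT; have sT' : 0 <= s <= T by case/andP: sT => /ltW -> /ltW ->.
    have cyl : closed_cyl T Omega (s, x) by split => //=; rewrite in_itv.
    have D1 := derivable_in_interior sT (C10_dt (Ca2_C10 (ip_u sol1)) cyl).
    have D2 := derivable_in_interior sT (C10_dt (Ca2_C10 (ip_u sol2)) cyl).
    apply: is_derive_congr (is_deriveB D1 D2) _ _ => //.
    by have := v0 s x sT' Ox; rewrite /dt => ->; rewrite subrr.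
  have := @ftc_increment R T (fun t => u1 t x - u2 t x) (fun=> 0) 0 t.
  rewrite (ip_phi sol1 clx) (ip_phi sol2 clx) subrr subr0 Rintegral_cst// mul0r => H.
  by apply/eqP; rewrite -subr_eq0 H//; [exact: cst_continuous|exact: within_continuousB].
split.
  move=> t x tT; apply: closure_eq => [||y]; last exact: uE.
  - exact: (cylinder_slice_space cOmega tT (C10_cont (Ca2_C10 (ip_u sol1)))).
  - exact: (cylinder_slice_space cOmega tT (C10_cont (Ca2_C10 (ip_u sol2)))).
apply: closure_eq (ip_h sol1) (ip_h sol2) _ => x Ox.
have [t tT ft] := nonzero_at_positive hT hf hf0.
have tT' : 0 <= t <= T by case/andP: tT => /ltW -> ->.
apply: (mulfI ft); rewrite -(ip_eq sol1 tT Ox) -(ip_eq sol2 tT Ox).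
apply: (f_equal2 (fun a b => a - b)).
  by apply: caputo_eq tT => s sT; exact: v0.
exact (Lop_eq oOmega A c (fun y => uE t y tT') Ox).
Qed.
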